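(* There is a polynomial time procedure which takes as input a derivation, in the sequent calculus described below, of the sequent $\cdot\,;\,\Sigma(o_{in},o_{out},\vec a),\ \Sigma(o_{in},o_{out}',\vec a')\vdash o_{out}=_T o_{out}'$ (where $\Sigma(o_{in},o_{out},\vec a)$ is a $\Delta_0$ formula, $o_{out}:T$, and $o_{out}',\vec a'$ are fresh variables of the same types as $o_{out},\vec a$; such a derivation is called an intuitionistic proof that $\Sigma$ defines $o_{out}$ as a function of $o_{in}$), and returns an $\mathsf{NRC}$ expression $E$ with free variable $o_{in}$ such that for all objects $o_{in},o_{out},\vec a$ of the appropriate types, if $\Sigma(o_{in},o_{out},\vec a)$ holds then $E(o_{in})=o_{out}$.
   Context: Types: $T,U::=\mathcal U\mid T\times U\mid\mathsf{Unit}\mid\mathsf{Set}(T)$, interpreted over a set $\mathcal U$ of Ur-elements ($\mathsf{Unit}=\{()\}$, products are pairs, $\mathsf{Set}(T)$ is the set of all finite or infinite subsets of $T$); elements are objects. NRC expressions are typed expressions built from variables, $()$, $\langle e_1,e_2\rangle$, $\pi_i(e)$, $\{e\}$, $\bigcup\{e_2\mid x\in e_1\}$ (union over $x\in e_1$ of the set $e_2$, $x$ bound), $\emptyset_T$, $e_1\cup e_2$, $e_1\setminus e_2$, with standard set semantics. $\Delta_0$ formulas: terms $t::=x\mid()\mid\langle t,u\rangle\mid\pi_1(t)\mid\pi_2(t)$; formulas $\varphi::=t=_{\mathcal U}t'\mid t\neq_{\mathcal U}t'\mid\top\mid\bot\mid\varphi\vee\psi\mid\varphi\wedge\psi\mid\forall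 x\in_T t\,\varphi\mid\exists x\in_T t\,\varphi$. Derived predicates: $t\in_T u:=\exists z'\in u\ t=_T z'$; $t\subseteq_T u:=\forall z\in_T t\ z\in_T u$; $t=_{\mathsf{Set}(T)}u:= t\subseteq_T u\wedge u\subseteq_T t$; $t=_{\mathsf{Unit}}u:=\top$; $t=_{T_1\times T_2}u:=\pi_1(t)=_{T_1}\pi_1(u)\wedge\pi_2(t)=_{T_2}\pi_2(u)$. Sequent calculus: sequents are $\Theta;\Gamma\vdash\phi$ with $\Theta$ a multiset of atomic membership formulas $t\in_T u$, $\Gamma$ a multiset of $\Delta_0$ formulas, and $\phi$ of one of the shapes $t\in_T u$, $t=_T u$, $t\subseteq_T u$. $\mathrm{FV}$ denotes free variables and $[t/x]$ substitution. Rules (premises $\Rightarrow$ conclusion): (Contraction) $\Theta;\Gamma,\varphi,\varphi\vdash t\in_T u\ \Rightarrow\ \Theta;\Gamma,\varphi\vdash t\in_T u$. ($\in_{\mathcal U}$-R) axiom $\Theta, t\in_{\mathcal U}u;\Gamma\vdash t\in_{\mathcal U}u$. ($=_{\mathsf{Set}}$-R) $\Theta;\Gamma\vdash t\subseteq_T u$ and $\Theta;\Gamma\vdash u\subseteq_T t$ $\Rightarrow$ $\Theta;\Gamma\vdash t=_{\mathsf{Set}(T)}u$. ($=_\times$-R) $\Theta;\Gamma\vdash\pi_1(t)=_{T_1}\pi_1(u)$ and $\Theta;\Gamma\vdash\pi_2(t)=_{T_2}\pi_2(u)$ $\Rightarrow$ $\Theta;\Gamma\vdash t=_{T_1\times T_2}u$.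 ($=_{\mathsf{Unit}}$-R) axiom $\Theta;\Gamma\vdash t=_{\mathsf{Unit}}u$. ($=_{\mathcal U}$-R) $\Theta,t\in_{\mathcal U}z;\Gamma\vdash u\in_{\mathcal U}z$ with $z\notin\mathrm{FV}(\Theta,\Gamma,t,u)$ $\Rightarrow$ $\Theta;\Gamma\vdash t=_{\mathcal U}u$. ($\subseteq$-R) $\Theta,z\in_T t;\Gamma\vdash z\in_T u$ with $z\notin\mathrm{FV}(\Theta,\Gamma,t,u)$ $\Rightarrow$ $\Theta;\Gamma\vdash t\subseteq_T u$. ($\in_{\mathsf{Set}}$-R) $\Theta,t\in_{\mathsf{Set}(T)}v;\Gamma\vdash t=_{\mathsf{Set}(T)}u$ $\Rightarrow$ $\Theta,t\in_{\mathsf{Set}(T)}v;\Gamma\vdash u\in_{\mathsf{Set}(T)}v$. ($\bot$-L) axiom $\Theta;\Gamma,\bot\vdash t\in_T u$. ($\wedge$-L) $\Theta;\Gamma,\varphi,\psi\vdash t\in_T u\Rightarrow\Theta;\Gamma,\varphi\wedge\psi\vdash t\in_T u$. ($\vee$-L) $\Theta;\Gamma,\varphi\vdash t\in_T u$ and $\Theta;\Gamma,\psi\vdash t\in_T u$ $\Rightarrow$ $\Theta;\Gamma,\varphi\vee\psi\vdash t\in_T u$. ($\forall$-L) $\Theta,t\in_T z;\Gamma,\varphi[t/y]\vdash v\in_{T'}w\Rightarrow\Theta,t\in_T z;\Gamma,\forall y\in_T z\,\varphi\vdash v\in_{T'}w$. ($\exists$-L) $\Theta,x\in_T y;\Gamma,\varphi\vdash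 t\in_{T'}v$ with $x\notin\mathrm{FV}(\Theta,\Gamma,y,t,v)$ $\Rightarrow$ $\Theta;\Gamma,\exists x\in_T y\,\varphi\vdash t\in_{T'}v$. ($=$-subst) $\Theta[y/x];\Gamma[y/x]\vdash(v\in_T w)[y/x]\Rightarrow\Theta;\Gamma,x=_{\mathcal U}y\vdash v\in_T w$. ($\neq$-L) axiom $\Theta;\Gamma,t\neq_{\mathcal U}t\vdash u\in_T v$. ($\times_\beta$) for $i\in\{1,2\}$: $\Theta[t_i/y];\Gamma[t_i/y]\vdash(t\in_T u)[t_i/y]\Rightarrow\Theta[\pi_i(\langle t_1,t_2\rangle)/y];\Gamma[\pi_i(\langle t_1,t_2\rangle)/y]\vdash(t\in_T u)[\pi_i(\langle t_1,t_2\rangle)/y]$. ($\times_\eta$) $\Theta[\langle x_1,x_2\rangle/x];\Gamma[\langle x_1,x_2\rangle/x]\vdash(t\in_T u)[\langle x_1,x_2\rangle/x]$ with $x_1,x_2\notin\mathrm{FV}(\Theta,\Gamma,t,u)$ $\Rightarrow$ $\Theta;\Gamma\vdash t\in_T u$. On the right-hand side, $\in_T,\subseteq_T,=_T$ are treated as atomic; in $\Gamma$ all formulas are in the basic $\Delta_0$ grammar (derived predicates there stand for their definitions).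
   Formalization: If T has a component 𝒰 not under Set, E may also use an operator get: Set(𝒰)→𝒰 (the element of a singleton, else an arbitrary default); plain NRC fails there, e.g. for o_out the only element of o_in: Set(𝒰). For all other T, E is in NRC as given. *)

(* Defs.v *)
From mathcomp Require Import all_boot.
From mathcomp Require Import boolp classical_sets.
From Stdlib Require Import Permutation.

Set Implicit Arguments.
Unset Strict Implicit.
Unset Printing Implicit Defensive.

Local Open Scope classical_set_scope.

Inductive ty : Type :=
| TUr
| TProd of ty & ty
| TUnit
| TSet of ty.

(* [T] has a component of type [TUr] that is not below a [TSet]. *)
Fixpoint bare_ur (T : ty) : bool :=
  match T with
  | TUr => true
  | TProd A B => bare_ur A || bare_ur B
  | TUnit => false
  | TSet _ => false
  end.

Fixpoint obj (Ur : Type) (T : ty) : Type :=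
  match T with
  | TUr => Ur
  | TProd A B => (obj Ur A * obj Ur B)%type
  | TUnit => unit
  | TSet A => set (obj Ur A)
  end.

(* Syntax is intrinsically typed and identified up to renaming of bound
   variables: a variable is a typed de Bruijn index into a context.  A side
   condition "x is not free in ..." becomes weakening into a context extended
   by the type of x. *)
Definition ctx := seq ty.

Inductive var : ctx -> ty -> Type :=
| VZ G T : var (T :: G) T
| VS G T A : var G T -> var (A :: G) T.
Arguments VZ {G T}.
Arguments VS {G T A} x.

Fixpoint env (Ur : Type) (G : ctx) : Type :=
  match G with
  | [::] => unit
  | T :: G' => (obj Ur T * env Ur G')%type
  end.

Fixpoint lookup Ur G T (x : var G T) : env Ur G -> obj Ur T :=
  match x in var G T return env Ur G -> obj Ur T with
  | VZ _ _ => fun r => r.1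
  | VS _ _ _ y => fun r => lookup y r.2
  end.

Fixpoint var_inl G G' T (x : var G T) : var (G ++ G') T :=
  match x in var G T return var (G ++ G') T with
  | VZ _ _ => VZ
  | VS _ _ _ y => VS (var_inl G' y)
  end.

Fixpoint var_inr G G' T (x : var G' T) : var (G ++ G') T :=
  match G with
  | [::] => x
  | A :: G1 => VS (var_inr G1 x)
  end.

Inductive term (G : ctx) : ty -> Type :=
| Var T of var G T : term G T
| Tt : term G TUnit
| Pair A B of term G A & term G B : term G (TProd A B)
| Proj1 A B of term G (TProd A B) : term G A
| Proj2 A B of term G (TProd A B) : term G B.
Arguments Var {G T} _.
Arguments Tt {G}.
Arguments Pair {G A B} _ _.
Arguments Proj1 {G A B} _.
Arguments Proj2 {G A B} _.

Inductive form (G : ctx) : Type :=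
| FEq of term G TUr & term G TUr
| FNeq of term G TUr & term G TUr
| FTop
| FBot
| FOr of form G & form G
| FAnd of form G & form G
| FAll T of term G (TSet T) & form (T :: G)
| FEx T of term G (TSet T) & form (T :: G).
Arguments FTop {G}.
Arguments FBot {G}.

Fixpoint teval Ur G (r : env Ur G) T (t : term G T) : obj Ur T :=
  match t in term _ T return obj Ur T with
  | Var _ x => lookup x r
  | Tt => tt
  | Pair _ _ t1 t2 => (teval r t1, teval r t2)
  | Proj1 _ _ t1 => (teval r t1).1
  | Proj2 _ _ t1 => (teval r t1).2
  end.

Fixpoint holds Ur G (f : form G) : env Ur G -> Prop :=
  match f with
  | FEq t u => fun r => teval r t = teval r u
  | FNeq t u => fun r => teval r t <> teval r u
  | FTop => fun _ => True
  | FBot => fun _ => False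
  | FOr f1 f2 => fun r => holds f1 r \/ holds f2 r
  | FAnd f1 f2 => fun r => holds f1 r /\ holds f2 r
  | FAll T t f1 => fun r =>
      forall x : obj Ur T, (teval r t : set (obj Ur T)) x ->
        holds f1 ((x, r) : env Ur (T :: G))
  | FEx T t f1 => fun r =>
      exists2 x : obj Ur T, (teval r t : set (obj Ur T)) x &
        holds f1 ((x, r) : env Ur (T :: G))
  end.

Inductive atom (G : ctx) : Type :=
| Mem T of term G T & term G (TSet T).

Inductive goal (G : ctx) : Type :=
| GIn T of term G T & term G (TSet T)
| GEq T of term G T & term G T
| GSub T of term G (TSet T) & term G (TSet T).

Record sequent (G : ctx) : Type := Sequent {
  mems : seq (atom G);
  hyps : seq (form G);
  concl : goal G }.

Definition subst (G D : ctx) : Type := forall T, var G T -> term D T.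

Definition ids G : subst G G := fun T x => Var x.
Definition wk A G : subst G (A :: G) := fun T x => Var (VS x).

Definition scons G D A (t : term D A) (s : subst G D) : subst (A :: G) D :=
  fun B y =>
    match y in var G' B return
      match G' with
      | [::] => unit
      | A' :: G1 => term D A' -> subst G1 D -> term D B
      end with
    | VZ _ _ => fun t _ => t
    | VS _ _ _ z => fun _ s => s _ z
    end t s.

(* [upd x t s] maps [x] to [t] and agrees with [s] on all other variables. *)
Fixpoint upd G D A (x : var G A) : term D A -> subst G D -> subst G D :=
  match x in var G A return term D A -> subst G D -> subst G D with
  | VZ _ _ => fun t s => scons t (fun B y => s B (VS y))
  | VS _ _ _ x' => fun t s =>
      scons (s _ VZ) (upd x' t (fun B y => s B (VS y)))
  end.

Fixpoint tsubst G D (s : subst G D) T (t : term G T) : term D T :=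
  match t in term _ T return term D T with
  | Var _ x => s _ x
  | Tt => Tt
  | Pair _ _ t1 t2 => Pair (tsubst s t1) (tsubst s t2)
  | Proj1 _ _ t1 => Proj1 (tsubst s t1)
  | Proj2 _ _ t1 => Proj2 (tsubst s t1)
  end.

Definition up A G D (s : subst G D) : subst (A :: G) (A :: D) :=
  scons (Var VZ) (fun B y => tsubst (@wk A D) (s B y)).

Fixpoint fsubst G D (s : subst G D) (f : form G) : form D :=
  match f with
  | FEq t u => FEq (tsubst s t) (tsubst s u)
  | FNeq t u => FNeq (tsubst s t) (tsubst s u)
  | FTop => FTop
  | FBot => FBot
  | FOr f1 f2 => FOr (fsubst s f1) (fsubst s f2)
  | FAnd f1 f2 => FAnd (fsubst s f1) (fsubst s f2)
  | FAll T t f1 => FAll (tsubst s t) (fsubst (@up T _ _ s) f1)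
  | FEx T t f1 => FEx (tsubst s t) (fsubst (@up T _ _ s) f1)
  end.

Definition asubst G D (s : subst G D) (a : atom G) : atom D :=
  let: Mem _ t u := a in Mem (tsubst s t) (tsubst s u).

Definition gsubst G D (s : subst G D) (g : goal G) : goal D :=
  match g with
  | GIn _ t u => GIn (tsubst s t) (tsubst s u)
  | GEq _ t u => GEq (tsubst s t) (tsubst s u)
  | GSub _ t u => GSub (tsubst s t) (tsubst s u)
  end.

Definition ssubst G D (s : subst G D) (q : sequent G) : sequent D :=
  Sequent (map (asubst s) (mems q)) (map (fsubst s) (hyps q))
          (gsubst s (concl q)).

Notation wkt A t := (tsubst (@wk A _) t).
Notation wka A Th := (map (asubst (@wk A _)) Th).
Notation wkf A Ga := (map (fsubst (@wk A _)) Ga).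

(* Multisets are lists, with [DExch] to reorder them; each rule acts on the
   head of the lists. *)
Inductive deriv (G : ctx) : sequent G -> Type :=
| DExch Th Ga Th' Ga' g :
    Permutation Th Th' -> Permutation Ga Ga' ->
    deriv (Sequent Th Ga g) ->
    deriv (Sequent Th' Ga' g)
| DContr Th Ga f T (t : term G T) u :
    deriv (Sequent Th (f :: f :: Ga) (GIn t u)) ->
    deriv (Sequent Th (f :: Ga) (GIn t u))
| DInUrR Th Ga (t : term G TUr) u :
    deriv (Sequent (Mem t u :: Th) Ga (GIn t u))
| DEqSetR Th Ga T (t u : term G (TSet T)) :
    deriv (Sequent Th Ga (GSub t u)) ->
    deriv (Sequent Th Ga (GSub u t)) ->
    deriv (Sequent Th Ga (GEq t u))
| DEqProdR Th Ga A B (t u : term G (TProd A B)) :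
    deriv (Sequent Th Ga (GEq (Proj1 t) (Proj1 u))) ->
    deriv (Sequent Th Ga (GEq (Proj2 t) (Proj2 u))) ->
    deriv (Sequent Th Ga (GEq t u))
| DEqUnitR Th Ga (t u : term G TUnit) :
    deriv (Sequent Th Ga (GEq t u))
| DEqUrR Th Ga (t u : term G TUr) :
    deriv (Sequent (Mem (wkt (TSet TUr) t) (Var VZ) :: wka (TSet TUr) Th)
                   (wkf (TSet TUr) Ga)
                   (GIn (wkt (TSet TUr) u) (Var VZ))) ->
    deriv (Sequent Th Ga (GEq t u))
| DSubR Th Ga T (t u : term G (TSet T)) :
    deriv (Sequent (Mem (Var VZ) (wkt T t) :: wka T Th) (wkf T Ga)
                   (GIn (Var VZ) (wkt T u))) ->
    deriv (Sequent Th Ga (GSub t u))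
| DInSetR Th Ga T (t u : term G (TSet T)) v :
    deriv (Sequent (Mem t v :: Th) Ga (GEq t u)) ->
    deriv (Sequent (Mem t v :: Th) Ga (GIn u v))
| DBotL Th Ga T (t : term G T) u :
    deriv (Sequent Th (FBot :: Ga) (GIn t u))
| DAndL Th Ga f1 f2 T (t : term G T) u :
    deriv (Sequent Th (f1 :: f2 :: Ga) (GIn t u)) ->
    deriv (Sequent Th (FAnd f1 f2 :: Ga) (GIn t u))
| DOrL Th Ga f1 f2 T (t : term G T) u :
    deriv (Sequent Th (f1 :: Ga) (GIn t u)) ->
    deriv (Sequent Th (f2 :: Ga) (GIn t u)) ->
    deriv (Sequent Th (FOr f1 f2 :: Ga) (GIn t u))
| DAllL Th Ga T (t : term G T) (z : var G (TSet T)) f T' (v : term G T') w :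
    deriv (Sequent (Mem t (Var z) :: Th)
                   (fsubst (scons t (@ids G)) f :: Ga) (GIn v w)) ->
    deriv (Sequent (Mem t (Var z) :: Th) (FAll (Var z) f :: Ga) (GIn v w))
| DExL Th Ga T (y : var G (TSet T)) f T' (t : term G T') v :
    deriv (Sequent (Mem (Var VZ) (wkt T (Var y)) :: wka T Th) (f :: wkf T Ga)
                   (GIn (wkt T t) (wkt T v))) ->
    deriv (Sequent Th (FEx (Var y) f :: Ga) (GIn t v))
| DEqSubst Th Ga (x y : var G TUr) T (v : term G T) w :
    deriv (ssubst (upd x (Var y) (@ids G)) (Sequent Th Ga (GIn v w))) ->
    deriv (Sequent Th (FEq (Var x) (Var y) :: Ga) (GIn v w))
| DNeqL Th Ga (t : term G TUr) T (u : term G T) v :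
    deriv (Sequent Th (FNeq t t :: Ga) (GIn u v))
| DProdBeta1 A B (t1 : term G A) (t2 : term G B)
    Th Ga T (t : term (A :: G) T) u :
    deriv (ssubst (scons t1 (@ids G)) (Sequent Th Ga (GIn t u))) ->
    deriv (ssubst (scons (Proj1 (Pair t1 t2)) (@ids G))
                  (Sequent Th Ga (GIn t u)))
| DProdBeta2 A B (t1 : term G A) (t2 : term G B)
    Th Ga T (t : term (B :: G) T) u :
    deriv (ssubst (scons t2 (@ids G)) (Sequent Th Ga (GIn t u))) ->
    deriv (ssubst (scons (Proj2 (Pair t1 t2)) (@ids G))
                  (Sequent Th Ga (GIn t u)))
| DProdEta A B (x : var G (TProd A B)) Th Ga T (t : term G T) u :
    deriv (ssubst (upd x (Pair (Var (VS VZ)) (Var VZ))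
                         (fun C y => Var (VS (VS y)) : term (B :: A :: G) C))
                  (Sequent Th Ga (GIn t u))) ->
    deriv (Sequent Th Ga (GIn t u)).

(* The formula [S] has free variables o_in, o_out, a; the sequent has free
   variables o_in, o_out, a, o_out', a'. *)
Section Definability.
Variables (Tin T : ty) (As : ctx) (S : form (Tin :: T :: As)).

Let D : ctx := Tin :: (T :: As) ++ (T :: As).

Definition left_copy : subst (Tin :: T :: As) D :=
  scons (Var VZ) (fun B y => Var (VS (var_inl (T :: As) y))).
Definition right_copy : subst (Tin :: T :: As) D :=
  scons (Var VZ) (fun B y => Var (VS (var_inr (T :: As) y))).

Definition definability_sequent : sequent D :=
  Sequent [::] [:: fsubst left_copy S; fsubst right_copy S]
    (GEq (left_copy (VS VZ)) (right_copy (VS VZ))).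
End Definability.

(* [nrc false] is NRC.  [nrc true] adds the operator extracting the unique
   element of a set of Ur-elements: without it, no expression of type [TUr] has
   a variable of type [TSet TUr] as its only free variable, although the
   formula "o_out is the only element of o_in" has a derivation of its
   definability sequent. *)
Inductive nrc (get : bool) (G : ctx) : ty -> Type :=
| NVar T of var G T : nrc get G T
| NUnit : nrc get G TUnit
| NPair A B of nrc get G A & nrc get G B : nrc get G (TProd A B)
| NProj1 A B of nrc get G (TProd A B) : nrc get G A
| NProj2 A B of nrc get G (TProd A B) : nrc get G B
| NSing T of nrc get G T : nrc get G (TSet T)
| NBigU A B of nrc get G (TSet A) & nrc get (A :: G) (TSet B) :
    nrc get G (TSet B)
| NEmpty T : nrc get G (TSet T)
| NUnion T of nrc get G (TSet T) & nrc get G (TSet T) : nrc get G (TSet T)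
| NDiff T of nrc get G (TSet T) & nrc get G (TSet T) : nrc get G (TSet T)
| NGet of get & nrc get G (TSet TUr) : nrc get G TUr.

Definition unique_elt (X : Type) (s : set X) (d : X) : X :=
  match pselect (exists x, s = [set x]) with
  | left h => projT1 (cid h)
  | right _ => d
  end.

(* The value of the extraction operator on a non-singleton is an arbitrary
   [dflt], which is needed only if the operator is present. *)
Fixpoint neval Ur (get : bool) (dflt : get -> Ur) G T (e : nrc get G T) :
    env Ur G -> obj Ur T :=
  match e in nrc _ _ T return env Ur G -> obj Ur T with
  | NVar _ x => fun r => lookup x r
  | NUnit => fun _ => tt
  | NPair _ _ e1 e2 => fun r => (neval dflt e1 r, neval dflt e2 r)
  | NProj1 _ _ e1 => fun r => (neval dflt e1 r).1
  | NProj2 _ _ e1 => fun r => (neval dflt e1 r).2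
  | NSing A e1 => fun r => [set neval dflt e1 r : obj Ur A]
  | NBigU A B e1 e2 => fun r =>
      \bigcup_(x in (neval dflt e1 r : set (obj Ur A)))
        (neval dflt e2 ((x, r) : env Ur (A :: G)) : set (obj Ur B))
  | NEmpty A => fun _ => (set0 : set (obj Ur A))
  | NUnion A e1 e2 => fun r =>
      (neval dflt e1 r : set (obj Ur A)) `|` neval dflt e2 r
  | NDiff A e1 e2 => fun r =>
      (neval dflt e1 r : set (obj Ur A)) `\` neval dflt e2 r
  | NGet hget e1 => fun r => unique_elt (neval dflt e1 r) (dflt hget)
  end.

(* Prefix codes; types are written where the concrete syntax carries them
   (contexts, membership, quantifiers, equality, the empty set), which
   determines all other types. *)
Definition word := seq bool.

Definition enc_nat (n : nat) : word := rcons (nseq n true) false.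

Definition enc_seq (X : Type) (enc : X -> word) (s : seq X) : word :=
  enc_nat (size s) ++ flatten (map enc s).

Fixpoint enc_ty (T : ty) : word :=
  match T with
  | TUr => enc_nat 0
  | TProd A B => enc_nat 1 ++ enc_ty A ++ enc_ty B
  | TUnit => enc_nat 2
  | TSet A => enc_nat 3 ++ enc_ty A
  end.

Fixpoint var_index G T (x : var G T) : nat :=
  match x with
  | VZ _ _ => 0
  | VS _ _ _ y => (var_index y).+1
  end.

Definition enc_var G T (x : var G T) : word := enc_nat (var_index x).

Fixpoint enc_term G T (t : term G T) : word :=
  match t with
  | Var _ x => enc_nat 0 ++ enc_var x
  | Tt => enc_nat 1
  | Pair _ _ t1 t2 => enc_nat 2 ++ enc_term t1 ++ enc_term t2
  | Proj1 _ _ t1 => enc_nat 3 ++ enc_term t1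
  | Proj2 _ _ t1 => enc_nat 4 ++ enc_term t1
  end.

Fixpoint enc_form G (f : form G) : word :=
  match f with
  | FEq t u => enc_nat 0 ++ enc_term t ++ enc_term u
  | FNeq t u => enc_nat 1 ++ enc_term t ++ enc_term u
  | FTop => enc_nat 2
  | FBot => enc_nat 3
  | FOr f1 f2 => enc_nat 4 ++ enc_form f1 ++ enc_form f2
  | FAnd f1 f2 => enc_nat 5 ++ enc_form f1 ++ enc_form f2
  | FAll T t f1 => enc_nat 6 ++ enc_ty T ++ enc_term t ++ enc_form f1
  | FEx T t f1 => enc_nat 7 ++ enc_ty T ++ enc_term t ++ enc_form f1
  end.

Definition enc_atom G (a : atom G) : word :=
  let: Mem T t u := a in enc_ty T ++ enc_term t ++ enc_term u.

Definition enc_goal G (g : goal G) : word :=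
  match g with
  | GIn T t u => enc_nat 0 ++ enc_ty T ++ enc_term t ++ enc_term u
  | GEq T t u => enc_nat 1 ++ enc_ty T ++ enc_term t ++ enc_term u
  | GSub T t u => enc_nat 2 ++ enc_ty T ++ enc_term t ++ enc_term u
  end.

Definition enc_sequent G (q : sequent G) : word :=
  enc_seq enc_ty G ++ enc_seq (@enc_atom G) (mems q) ++
  enc_seq (@enc_form G) (hyps q) ++ enc_goal (concl q).

(* A derivation is written as a tree: each node carries its sequent, the name
   of the rule, and the instance of the substitution pattern for the two
   product rules, followed by the subderivations. *)
Fixpoint enc_deriv G (q : sequent G) (d : deriv q) : word :=
  enc_sequent q ++
  match d with
  | DExch _ _ _ _ _ _ _ d1 => enc_nat 0 ++ enc_deriv d1
  | DContr _ _ _ _ _ _ d1 => enc_nat 1 ++ enc_deriv d1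
  | DInUrR _ _ _ _ => enc_nat 2
  | DEqSetR _ _ _ _ _ d1 d2 => enc_nat 3 ++ enc_deriv d1 ++ enc_deriv d2
  | DEqProdR _ _ _ _ _ _ d1 d2 => enc_nat 4 ++ enc_deriv d1 ++ enc_deriv d2
  | DEqUnitR _ _ _ _ => enc_nat 5
  | DEqUrR _ _ _ _ d1 => enc_nat 6 ++ enc_deriv d1
  | DSubR _ _ _ _ _ d1 => enc_nat 7 ++ enc_deriv d1
  | DInSetR _ _ _ _ _ _ d1 => enc_nat 8 ++ enc_deriv d1
  | DBotL _ _ _ _ _ => enc_nat 9
  | DAndL _ _ _ _ _ _ _ d1 => enc_nat 10 ++ enc_deriv d1
  | DOrL _ _ _ _ _ _ _ d1 d2 => enc_nat 11 ++ enc_deriv d1 ++ enc_deriv d2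
  | DAllL _ _ _ _ _ _ _ _ _ d1 => enc_nat 12 ++ enc_deriv d1
  | DExL _ _ _ _ _ _ _ _ d1 => enc_nat 13 ++ enc_deriv d1
  | DEqSubst _ _ _ _ _ _ _ d1 => enc_nat 14 ++ enc_deriv d1
  | DNeqL _ _ _ _ _ _ => enc_nat 15
  | DProdBeta1 _ _ t1 t2 Th Ga _ t u d1 =>
      enc_nat 16 ++ enc_term t1 ++ enc_term t2 ++
      enc_sequent (Sequent Th Ga (GIn t u)) ++ enc_deriv d1
  | DProdBeta2 _ _ t1 t2 Th Ga _ t u d1 =>
      enc_nat 17 ++ enc_term t1 ++ enc_term t2 ++
      enc_sequent (Sequent Th Ga (GIn t u)) ++ enc_deriv d1
  | DProdEta _ _ x _ _ _ _ _ d1 => enc_nat 18 ++ enc_var x ++ enc_deriv d1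
  end.

Fixpoint enc_nrc get G T (e : nrc get G T) : word :=
  match e with
  | NVar _ x => enc_nat 0 ++ enc_var x
  | NUnit => enc_nat 1
  | NPair _ _ e1 e2 => enc_nat 2 ++ enc_nrc e1 ++ enc_nrc e2
  | NProj1 _ _ e1 => enc_nat 3 ++ enc_nrc e1
  | NProj2 _ _ e1 => enc_nat 4 ++ enc_nrc e1
  | NSing _ e1 => enc_nat 5 ++ enc_nrc e1
  | NBigU _ _ e1 e2 => enc_nat 6 ++ enc_nrc e1 ++ enc_nrc e2
  | NEmpty A => enc_nat 7 ++ enc_ty A
  | NUnion _ e1 e2 => enc_nat 8 ++ enc_nrc e1 ++ enc_nrc e2
  | NDiff _ e1 e2 => enc_nat 9 ++ enc_nrc e1 ++ enc_nrc e2
  | NGet _ e1 => enc_nat 10 ++ enc_nrc e1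
  end.

Inductive move := MLeft | MStay | MRight.

(* [None] is the blank; the input alphabet is [bool]. *)
Definition cell (aux : finType) : Type := option (bool + aux).

(* Tape number 0 of the [tm_tapes.+1] two-way infinite tapes holds the input
   and the output. *)
Record tm : Type := TM {
  tm_tapes : nat;
  tm_aux : finType;
  tm_state : finType;
  tm_start : tm_state;
  tm_final : pred tm_state;
  tm_delta : tm_state -> {ffun 'I_tm_tapes.+1 -> cell tm_aux} ->
             tm_state * {ffun 'I_tm_tapes.+1 -> cell tm_aux * move} }.

(* The cells left of the head are listed from right to left; those beyond the
   ends of both lists are blank. *)
Record tape (aux : finType) : Type := Tape {
  tleft : seq (cell aux);
  thead : cell aux;
  tright : seq (cell aux) }.

Definition tape_step aux (c : cell aux) (m : move) (t : tape aux) : tape aux :=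
  match m with
  | MLeft => Tape (behead (tleft t)) (head None (tleft t)) (c :: tright t)
  | MStay => Tape (tleft t) c (tright t)
  | MRight => Tape (c :: tleft t) (head None (tright t)) (behead (tright t))
  end.

Definition cells_of_word aux (w : word) : seq (cell aux) :=
  [seq Some (inl b) | b <- w].

Section Run.
Variable M : tm.

Record config : Type := Config {
  cstate : tm_state M;
  ctapes : 'I_(tm_tapes M).+1 -> tape (tm_aux M) }.

Definition step (c : config) : config :=
  if tm_final (cstate c) then c else
  let: (q, act) := tm_delta (cstate c) [ffun i => thead (ctapes c i)] in
  Config q (fun i => tape_step (act i).1 (act i).2 (ctapes c i)).

Definition init (w : word) : config :=
  let cs := cells_of_word (tm_aux M) w in
  Config (tm_start M)
    (fun i => if i == ord0 then Tape [::] (head None cs) (behead cs)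
              else Tape [::] None [::]).

(* The word read from the head of tape 0, up to blanks, is [w]. *)
Definition outputs (c : config) (w : word) : Prop :=
  exists k, thead (ctapes c ord0) :: tright (ctapes c ord0) =
            cells_of_word (tm_aux M) w ++ nseq k None.

Definition computes_within (time : nat) (win wout : word) : Prop :=
  let c := iter time step (init win) in
  tm_final (cstate c) /\ outputs c wout.
End Run.

(* Main.v *)
From mathcomp Require Import all_boot zify.
From mathcomp Require Import boolp classical_sets.
From Stdlib Require Eqdep_dec.
Require Import Defs.

Set Implicit Arguments.
Unset Strict Implicit.
Unset Printing Implicit Defensive.

(** The expression is read off the derivation by interpolation.  Every variable
    of a sequent is either private to one of two sides or common to both, in
    which case it denotes a given term over the context of the expression under
    construction; every membership and every formula on the left belongs to the
    side of its private variables.  For a chosen side [p], each subderivation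
    yields two things.  The first is an interpolant, a Boolean NRC expression
    over the common part that follows from the hypotheses of the side opposite
    to [p] and, together with those of side [p], implies the conclusion; here the
    private variables of the conclusion are all on side [p].  The second, when
    the two terms of the conclusion are on opposite sides, is an NRC expression
    for a value between them: a set that contains [t] if the conclusion is
    [t \in u], a set between [t] and [u] if it is an inclusion, and the common
    value if it is an equality.  For an inclusion, the eigenvariable is put on
    one side to get a superset of [t], which is then filtered by the interpolant
    computed with the eigenvariable common.  When a membership [t \in u] is used
    against a formula of the other side, [u] is common, and the variables of [t]
    become common by quantifying over the elements of [u].

    Each rule contributes a bounded number of pieces of text around the output of
    its premises, so the text of the expression is emitted, within polynomially
    many steps, from a stack of pending tasks.  Turing machines are obtained from
    programs on four stacks, by closing the functions on binary trees that such
    programs compute in polynomial time under composition, case analysis and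
    iteration with polynomially bounded intermediate values. *)

(** * Stack programs and Turing machines *)

(** The two copies of the formula share only [o_in], so the terms of the final equality lie on
    opposite sides, and what both sides describe has to be expressible over the common part. For an
    equality of Ur-elements the eigenvariable is a set: read as a singleton [{y}], it turns the
    interpolant into a test that only the right candidate [y] passes, and the extraction operator
    returns the element that is left.

    A common variable denotes a term and not just a variable, because the components of a tuple, and
    the variables split by the product rule, become projections. Variables that were common before
    keep their terms, so the expression must still test that the bound element equals the tuple.

    The value of an inclusion uses its premise twice, which might double the text at each rule. The
    growth is polynomial because an interpolant never calls for a value: a subderivation is visited
    at most once for its value and at most once per proper ancestor for an interpolant. *)

Inductive reg := RM | RA | RB | RC.
Record store := Store { sM : seq bool; sA : seq bool; sB : seq bool; sC : seq bool }.

Definition sget (r : reg) (s : store) : seq bool :=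
  match r with RM => sM s | RA => sA s | RB => sB s | RC => sC s end.
Definition sset (r : reg) (l : seq bool) (s : store) : store :=
  match r with
  | RM => Store l (sA s) (sB s) (sC s)
  | RA => Store (sM s) l (sB s) (sC s)
  | RB => Store (sM s) (sA s) l (sC s)
  | RC => Store (sM s) (sA s) (sB s) l
  end.

(* [Br r fl bd] pops [r], runs [bd c] on the popped symbol [c] ([None] if [r]
   is empty), and starts again if [fl c]. *)
Inductive prog :=
| Skip
| Push of reg & bool
| Seq of prog & prog
| Br of reg & (option bool -> bool) & (option bool -> prog).

(** The time is an upper bound, by [XLe]. A push is charged two steps, one to move the head and one
    to write. *)
Inductive exec : prog -> store -> nat -> store -> Prop :=
| XSkip s : exec Skip s 1 s
| XPush r b s : exec (Push r b) s 2 (sset r (b :: sget r s) s)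
| XSeq p q s t1 s1 t2 s2 :
    exec p s t1 s1 -> exec q s1 t2 s2 -> exec (Seq p q) s (t1 + t2) s2
| XStop r fl bd s t s' :
    fl (ohead (sget r s)) = false ->
    exec (bd (ohead (sget r s))) (sset r (behead (sget r s)) s) t s' ->
    exec (Br r fl bd) s t.+1 s'
| XLoop r fl bd s t s1 t' s2 :
    fl (ohead (sget r s)) = true ->
    exec (bd (ohead (sget r s))) (sset r (behead (sget r s)) s) t s1 ->
    exec (Br r fl bd) s1 t' s2 ->
    exec (Br r fl bd) s (t + t').+1 s2
| XLe p s t t' s' : t <= t' -> exec p s t s' -> exec p s t' s'.

Inductive instr :=
| IJmp of nat
| IPush of reg & bool & nat
| IBr of reg & (option bool -> nat).

Fixpoint len (p : prog) : nat :=
  match p with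
  | Skip | Push _ _ => 1
  | Seq p q => len p + len q
  | Br _ _ bd => (len (bd None) + (len (bd (Some true)) + len (bd (Some false)))).+1
  end.

Fixpoint comp (p : prog) (l e : nat) : seq instr :=
  match p with
  | Skip => [:: IJmp e]
  | Push r b => [:: IPush r b e]
  | Seq p q => comp p l (l + len p) ++ comp q (l + len p) e
  | Br r fl bd =>
      let ex c := if fl c then l else e in
      let l1 := l.+1 + len (bd None) in
      let l2 := l1 + len (bd (Some true)) in
      IBr r (fun c => match c with
                      | None => l.+1 | Some true => l1 | Some false => l2
                      end) ::
      comp (bd None) l.+1 (ex None) ++
      comp (bd (Some true)) l1 (ex (Some true)) ++
      comp (bd (Some false)) l2 (ex (Some false))
  end.

Lemma size_comp p l e : size (comp p l e) = len p.
Proof.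
elim: p l e => //= [p IHp q IHq|r fl bd IH] l e; rewrite !size_cat ?IHp ?IHq //.
by rewrite !IH.
Qed.

Definition code_at (cd : seq instr) (l : nat) (c : seq instr) : Prop :=
  forall i, i < size c -> nth (IJmp 0) cd (l + i) = nth (IJmp 0) c i.

Lemma code_at_cat cd l c1 c2 :
  code_at cd l (c1 ++ c2) -> code_at cd l c1 /\ code_at cd (l + size c1) c2.
Proof.
move=> H; split=> i Hi.
  rewrite H ?size_cat; last by lia.
  by rewrite nth_cat Hi.
rewrite -addnA H ?size_cat; last by lia.
by rewrite nth_cat ltnNge leq_addr /= addKn.
Qed.

Section Compile.
Variable P : prog.
Let N := len P.
Let cd := comp P 0 N.
Notation cel := (cell unit).

Definition idx (r : reg) : 'I_4 :=
  match r with RM => inord 0 | RA => inord 1 | RB => inord 2 | RC => inord 3 end.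

Definition dec_cell (c : cel) : option bool := if c is Some (inl b) then Some b else None.

Definition act (rd : {ffun 'I_4 -> cel}) (r : reg) (c : cel) (m : move) :
    {ffun 'I_4 -> cel * move} :=
  [ffun i => if i == idx r then (c, m) else (rd i, MStay)].

(** The boolean of the state is the phase of a push: a tape step writes before it moves, whereas a
    push has to move left first and then write. *)
Definition pdelta (q : 'I_N.+1 * bool) (rd : {ffun 'I_4 -> cel}) :
    ('I_N.+1 * bool) * {ffun 'I_4 -> cel * move} :=
  match nth (IJmp 0) cd q.1 with
  | IJmp l => ((inord l, false), [ffun i => (rd i, MStay)])
  | IPush r b l =>
      if q.2 then ((inord l, false), act rd r (Some (inl b)) MStay)
      else ((q.1, true), act rd r (rd (idx r)) MLeft)
  | IBr r f => ((inord (f (dec_cell (rd (idx r)))), false), act rd r None MRight)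
  end.

Definition ptm : tm :=
  @TM 3 unit ('I_N.+1 * bool)%type (ord0, false) (fun q => q.1 == ord_max) pdelta.

(** The top of the stack is under the head, and only blanks follow its bottom. The cells to the left
    are unconstrained, since a push overwrites the one it enters. *)
Definition repr (l : seq bool) (tp : tape unit) : Prop :=
  exists k, Defs.thead tp :: tright tp = [seq Some (inl b) | b <- l] ++ nseq k None.

Definition sims (l : nat) (s : store) (c : config ptm) : Prop :=
  cstate c = (inord l, false) /\ forall r, repr (sget r s) (ctapes c (idx r)).

Lemma idx_inj : injective idx.
Proof. by move=> [] [] // /(congr1 val); rewrite /= !inordK. Qed.

Lemma dec_repr l tp : repr l tp -> dec_cell (Defs.thead tp) = ohead l.
Proof. by case=> k; case: l => [|b l] /=; [case: k => [|k]|] => //= -[-> _]. Qed.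

Lemma repr_pop l tp c : repr l tp -> repr (behead l) (tape_step c MRight tp).
Proof.
case: tp => tl th tr [k] /=; case: l => [|b l] /=.
  case: k => // k [_ ->]; exists k.-1.+1; case: k => //.
case=> _ ->; case: l => [|b' l] /=; last by exists k.
by exists k.-1.+1; case: k.
Qed.

Lemma repr_push l tp b :
  repr l tp -> repr (b :: l) (tape_step (Some (inl b)) MStay (tape_step (Defs.thead tp) MLeft tp)).
Proof. by case: tp => tl th tr [k] /= ->; exists k. Qed.

Lemma repr_stay l tp : repr l tp -> repr l (tape_step (Defs.thead tp) MStay tp).
Proof. by case: tp. Qed.

Lemma get_set r r' l s : sget r (sset r' l s) = if idx r == idx r' then l else sget r s.
Proof. by case: r r' => [] []; rewrite -val_eqE /= !inordK. Qed.

Lemma sim_exec p s t s' : exec p s t s' ->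
  forall l e c, code_at cd l (comp p l e) -> l + len p <= N -> sims l s c ->
  exists2 t0, t0 <= t & sims e s' (iter t0 (@step ptm) c).
Proof.
have pos q : 0 < len q by elim: q => //= q1 H1 q2 H2; rewrite addn_gt0 H1.
have stepE l (c : config ptm) ph : l < N -> cstate c = (inord l, ph) ->
    step c = let: (q, ac) := pdelta (inord l, ph) [ffun i => Defs.thead (ctapes c i)] in
    Config (q : tm_state ptm) (fun i => tape_step (ac i).1 (ac i).2 (ctapes c i)).
  move=> Hl Hc; rewrite /step Hc /=.
  rewrite -val_eqE /= inordK; last by rewrite ltnS ltnW.
  by rewrite (ltn_eqF Hl).
(* One pop leads to the code of the selected body, whose exit is [l] if the loop goes on and [e]
   otherwise; this serves both rules for [Br]. *)
have brP r fl bd s0 l e c : code_at cd l (comp (Br r fl bd) l e) ->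
    l + len (Br r fl bd) <= N -> sims l s0 c ->
    let h := ohead (sget r s0) in
    exists l1, [/\ code_at cd l1 (comp (bd h) l1 (if fl h then l else e)),
      l1 + len (bd h) <= N & sims l1 (sset r (behead (sget r s0)) s0) (step c)].
  move=> Hc Hl [Hst Hr] h.
  have Hi : nth (IJmp 0) cd l = nth (IJmp 0) (comp (Br r fl bd) l e) 0.
    by rewrite -(Hc 0) ?addn0.
  have H2 : code_at cd l.+1 (behead (comp (Br r fl bd) l e)).
    by move=> i Hi'; rewrite addSnnS Hc.
  move: Hi H2 => /= Hi /code_at_cat [H0 /code_at_cat]; rewrite !size_comp => -[H1 H2].
  simpl in Hl.
  have Hrest l1 (Hl1 : (match h with None => l.+1 | Some true => l.+1 + len (bd None) |
      Some false => l.+1 + len (bd None) + len (bd (Some true)) end) = l1) :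
      sims l1 (sset r (behead (sget r s0)) s0) (step c).
    rewrite (stepE _ _ false _ Hst); last by lia.
    have -> : pdelta (inord l, false) [ffun i => Defs.thead (ctapes c i)] =
       ((inord l1, false), act [ffun i => Defs.thead (ctapes c i)] r None MRight).
      rewrite /pdelta /= inordK; last by lia.
      by rewrite Hi ffunE (dec_repr (Hr r)) -Hl1.
    split=> //= r'; rewrite !ffunE get_set.
    case: eqP => [/idx_inj ->|_] /=; first exact: repr_pop.
    by rewrite ?ffunE; apply: repr_stay.
  case Eh: h Hrest => [[]|] Hrest; eexists; (split; last exact: Hrest) => //; lia.
elim=> {p s t s'}.
- move=> s l e c Hc Hl [Hst Hr]; exists 1 => //=.
  move: (Hc 0 isT) => /=; rewrite addn0 => Hi.
  simpl in Hl; rewrite (stepE _ _ _ _ Hst); last by lia.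
  rewrite /pdelta /= inordK; last by lia.
  rewrite Hi; split=> //= r; rewrite !ffunE /=; exact: repr_stay.
- move=> r b s l e c Hc Hl [Hst Hr]; exists 2 => //=.
  move: (Hc 0 isT) => /=; rewrite addn0 => Hi.
  simpl in Hl; rewrite (stepE _ _ _ _ Hst); last by lia.
  rewrite {1}/pdelta /= inordK; last by lia.
  rewrite Hi /=.
  rewrite (stepE l _ true) /=; [|by lia|by []].
  rewrite /pdelta /= inordK; last by lia.
  rewrite Hi; split=> //= r'; rewrite !ffunE get_set.
  case: eqP => [E|_] /=; first by rewrite E ?ffunE /=; apply: repr_push.
  rewrite ?ffunE /=; move: (Hr r'); by case: (ctapes c (idx r')).
- move=> p q s t1 s1 t2 s2 _ IH1 _ IH2 l e c /= /code_at_cat [H1 H2] Hl Hs.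
  have [|t01 L1 S1] := IH1 _ _ _ H1 _ Hs; first by lia.
  rewrite size_comp in H2.
  have [|t02 L2 S2] := IH2 _ _ _ H2 _ S1; first by lia.
  exists (t02 + t01); first by lia.
  by rewrite iterD.
- move=> r fl bd s t s' Hf _ IH l e c Hc Hl Hs.
  have [l1 [C1 L1 S1]] := brP _ _ _ _ _ _ _ Hc Hl Hs.
  rewrite Hf in C1; have [t0 Lt S2] := IH _ _ _ C1 L1 S1.
  by exists t0.+1 => //; rewrite iterSr.
- move=> r fl bd s t s1 t' s2 Hf _ IH _ IH' l e c Hc Hl Hs.
  have [l1 [C1 L1 S1]] := brP _ _ _ _ _ _ _ Hc Hl Hs.
  rewrite Hf in C1; have [t0 Lt S2] := IH _ _ _ C1 L1 S1.
  have [t0' Lt' S2'] := IH' _ _ _ Hc Hl S2.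
  exists (t0' + t0).+1; first by lia.
  by rewrite iterSr iterD.
- move=> p s t t' s' Ht _ IH l e c Hc Hl Hs.
  by have [t0 Lt S2] := IH _ _ _ Hc Hl Hs; exists t0 => //; lia.
Qed.

Lemma ptm_computes w t s' T : exec P (Store w [::] [::] [::]) t s' -> t <= T ->
  computes_within ptm T w (sM s').
Proof.
move=> Hx Ht.
have [|||t0 Ht0 [Hst Hr]] := sim_exec Hx (l := 0) (e := N) (c := init ptm w).
- by move=> i _; rewrite add0n.
- by rewrite add0n.
- split; first by congr (_, _); apply: val_inj; rewrite /= inordK.
  case=> /=; rewrite -?val_eqE /= ?inordK //=; try by exists 1.
  by case: (w) => [|b l]; [exists 1|exists 0; rewrite cats0].
set c := iter t0 _ _ in Hst Hr.
have Hfin : tm_final (cstate c) by rewrite Hst /= -val_eqE /= inordK.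
(* [step] fixes final configurations, so the run can be prolonged to exactly [T] steps. *)
have -> : T = (T - t0) + t0 by lia.
rewrite /computes_within iterD -/c.
have -> : iter (T - t0) (@step ptm) c = c.
  by elim: (T - t0) => //= n ->; rewrite /step Hfin.
split=> //; have := Hr RM; rewrite /repr /outputs /=.
by have -> : inord 0 = ord0 :> 'I_4 by apply: val_inj; rewrite /= inordK.
Qed.
End Compile.

(** * Polynomial time on binary trees *)

(** Natural coefficients make every polynomial monotone, so that bounds on the argument can be
    substituted; [psub] is composition. *)
Inductive pol := PC of nat | PX | PA of pol & pol | PM of pol & pol.

Fixpoint ev (p : pol) (n : nat) : nat :=
  match p with
  | PC c => c
  | PX => n
  | PA p q => ev p n + ev q n
  | PM p q => ev p n * ev q n
  end.

Fixpoint psub (p r : pol) : pol :=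
  match p with
  | PC c => PC c
  | PX => r
  | PA p q => PA (psub p r) (psub q r)
  | PM p q => PM (psub p r) (psub q r)
  end.

Lemma ev_psub p r n : ev (psub p r) n = ev p (ev r n).
Proof. by elim: p => //= p -> q ->. Qed.

Lemma ev_mono p m n : m <= n -> ev p m <= ev p n.
Proof.
by move=> Hmn; elim: p => //= p Hp q Hq; [apply: leq_add|apply: leq_mul].
Qed.

Lemma ev_bound p : exists c k, forall n, ev p n <= c * n ^ k + c.
Proof.
(* For [n > 0] the sum of two exponents dominates both powers; the value at 0 goes into the additive
   constant. *)
suff [c [k H]] : exists c k, forall n, 0 < n -> ev p n <= c * n ^ k.
  exists (c + ev p 0), k => -[|n]; first by rewrite addnA leq_addl.
  by apply: leq_trans (H n.+1 isT) _; nia.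
elim: p => [c||p [c1 [k1 H1]] q [c2 [k2 H2]]|p [c1 [k1 H1]] q [c2 [k2 H2]]].
- by exists c, 0 => n _; rewrite muln1.
- by exists 1, 1 => n _; rewrite mul1n expn1.
- exists (c1 + c2), (k1 + k2) => n Hn /=.
  move: (H1 n Hn) (H2 n Hn); rewrite expnD.
  have := expn_gt0 n k1; have := expn_gt0 n k2; rewrite Hn /=; nia.
- exists (c1 * c2), (k1 + k2) => n Hn /=.
  by rewrite expnD mulnACA leq_mul ?H1 ?H2.
Qed.

Inductive tr := Lf | Nd of tr & tr.

(** These preorder bits form a prefix code, so several trees can follow each other on one stack
    without separators. *)
Fixpoint code (x : tr) : seq bool :=
  match x with Lf => [:: false] | Nd a b => true :: code a ++ code b end.

Fixpoint tsz (x : tr) : nat :=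
  match x with Lf => 1 | Nd a b => (tsz a + tsz b).+1 end.

Lemma size_code x : size (code x) = tsz x.
Proof. by elim: x => //= a Ha b Hb; rewrite size_cat Ha Hb. Qed.

Lemma tsz_gt0 x : 0 < tsz x.
Proof. by case: x. Qed.

Definition car x := if x is Nd a _ then a else Lf.
Definition cdr x := if x is Nd _ b then b else Lf.
Definition isN x := if x is Nd _ _ then true else false.

(** * Moving, copying and swapping coded trees *)

Notation st m := (Store m [::] [::] [::]).

(** Moves the first tree of [RM] to [RA], reversed. The height of [RC] is the number of subtrees
    still to be read: each node removes one and an inner node adds two. *)
Definition mvA : prog :=
  Seq (Push RC true)
  (Br RC (fun c => if c is Some _ then true else false)
    (fun c => if c is Some _ then
      Br RM (fun _ => false)
        (fun d => if d is Some b then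
           Seq (Push RA b) (if b then Seq (Push RC true) (Push RC true) else Skip)
         else Skip)
     else Skip)).

Definition drain (r r' : reg) : prog :=
  Br r (fun c => if c is Some _ then true else false)
    (fun c => if c is Some b then Push r' b else Skip).

Lemma exec_mvA x m a b :
  exec mvA (Store (code x ++ m) a b [::]) (12 * tsz x)
    (Store m (rev (code x) ++ a) b [::]).
Proof.
pose loop := Br RC (fun c => if c is Some _ then true else false)
    (fun c => if c is Some _ then
      Br RM (fun _ => false)
        (fun d => if d is Some b then
           Seq (Push RA b) (if b then Seq (Push RC true) (Push RC true) else Skip)
         else Skip)
     else Skip).
(* The rest of the run is a parameter, so one induction handles both subtrees without splitting the
   loop. *)
have H : forall m a c t s', exec loop (Store m (rev (code x) ++ a) b c) t s' ->
   exec loop (Store (code x ++ m) a b (true :: c)) (8 * tsz x + t) s'.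
  elim: x => [|x IHx y IHy] {}m {}a c t s' H /=.
    have -> : 8 * 1 + t = (4.+1 + t.+2).+1 by lia.
    apply: (@XLe _ _ (4 + t).+1); first by lia.
    apply: XLoop => //=; last exact: H.
    apply: (XStop (t := 3)) => //=; apply: (XSeq (t1 := 2) (t2 := 1)); exact: XPush || exact: XSkip.
  have -> : 8 * (tsz x + tsz y).+1 + t = (7 + (8 * tsz x + (8 * tsz y + t))).+1 by lia.
  apply: XLoop => //=.
    apply: (XStop (t := 6)) => //=; apply: (XSeq (t1 := 2) (t2 := 4)); first exact: XPush.
    by apply: (XSeq (t1 := 2) (t2 := 2)); exact: XPush.
  rewrite /= -catA; apply: IHx; apply: IHy.
  by move: H; rewrite rev_cons rev_cat cat_rcons -catA.
apply: (@XLe _ _ (2 + (8 * tsz x + 2))); first by have := tsz_gt0 x; lia.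
apply: XSeq; first exact: XPush.
apply: H; apply: (XStop (t := 1)) => //=; exact: XSkip.
Qed.

Lemma exec_drain r r' s : idx r != idx r' ->
  exec (drain r r') s (3 * size (sget r s) + 2)
    (sset r [::] (sset r' (rev (sget r s) ++ sget r' s) s)).
Proof.
move=> D; move E : (sget r s) => l.
elim: l s E => [|b l IH] s E /=.
  apply: (@XLe _ _ 2) => //; apply: (XStop (t := 1)); rewrite E //=.
  by case: s r r' E D => m a b c [] [] /= E D; rewrite ?eqxx // in D; rewrite ?E; exact: XSkip.
apply: (@XLe _ _ (2 + (3 * size l + 2)).+1); first by lia.
apply: XLoop; [by rewrite E|rewrite E /=; exact: XPush|].
rewrite rev_cons cat_rcons.
move: (IH (sset r' (b :: sget r' (sset r l s)) (sset r l s))).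
by case: s r r' E D {IH} => m a b' c [] [] /= E D; rewrite ?eqxx // in D; apply.
Qed.

Lemma exec_drain' r r' s s' : idx r != idx r' ->
  s' = sset r [::] (sset r' (rev (sget r s) ++ sget r' s) s) ->
  exec (drain r r') s (3 * size (sget r s) + 2) s'.
Proof. by move=> D ->; apply: exec_drain. Qed.

Ltac drn := apply: exec_drain'; [by rewrite -val_eqE /= !inordK | by rewrite /= ?cats0 ?revK ?cats0].
Ltac timed := eapply XLe; last first.

Definition clearA : prog :=
  Br RA (fun c => if c is Some _ then true else false) (fun _ => Skip).

Lemma exec_clearA m a b c :
  exec clearA (Store m a b c) (2 * size a + 2) (Store m [::] b c).
Proof.
elim: a => [|x a IH]; first by apply: XStop => //=; exact: XSkip.
apply: (@XLe _ _ (1 + (2 * size a + 2)).+1) => /=; first by lia.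
by apply: XLoop => //=; [exact: XSkip|exact: IH].
Qed.

Definition drop_tree : prog := Seq mvA clearA.

Lemma exec_drop x m b :
  exec drop_tree (Store (code x ++ m) [::] b [::]) (16 * tsz x) (Store m [::] b [::]).
Proof.
timed; first by apply: XSeq; [exact: exec_mvA|exact: exec_clearA].
by rewrite cats0 size_rev size_code; have := tsz_gt0 x; lia.
Qed.

Definition swap_tree : prog :=
  Seq mvA (Seq (drain RA RB) (Seq mvA (Seq (drain RB RC)
    (Seq (drain RC RM) (drain RA RM))))).

Lemma exec_swap x y m :
  exec swap_tree (st (code x ++ code y ++ m)) (40 * (tsz x + tsz y))
    (st (code y ++ code x ++ m)).
Proof.
timed.
  apply: XSeq; first exact: exec_mvA.
  apply: XSeq; first drn.
  apply: XSeq; first exact: exec_mvA.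
  apply: XSeq; first drn.
  by apply: XSeq; drn.
rewrite /= !cats0 !size_rev !size_code; have := tsz_gt0 x; have := tsz_gt0 y; lia.
Qed.

Definition dup_tree : prog :=
  Seq mvA (Seq (Br RA (fun c => if c is Some _ then true else false)
    (fun c => if c is Some b then Seq (Push RM b) (Push RB b) else Skip))
  (Seq (drain RB RA) (drain RA RM))).

Lemma exec_dup x m :
  exec dup_tree (st (code x ++ m)) (40 * tsz x) (st (code x ++ code x ++ m)).
Proof.
have H : forall a m b, exec (Br RA (fun c => if c is Some _ then true else false)
    (fun c => if c is Some b then Seq (Push RM b) (Push RB b) else Skip))
    (Store m a b [::]) (5 * size a + 2) (Store (rev a ++ m) [::] (rev a ++ b) [::]).
  elim=> [|c a IH] m' b; first by apply: XStop => //=; exact: XSkip.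
  apply: (@XLe _ _ (4 + (5 * size a + 2)).+1) => /=; first by lia.
  rewrite rev_cons !cat_rcons; apply: XLoop => //=.
    by apply: (XSeq (t1 := 2) (t2 := 2)); exact: XPush.
timed.
  apply: XSeq; first exact: exec_mvA.
  apply: XSeq; first exact: H.
  apply: XSeq; first drn.
  drn.
rewrite /= !cats0 !size_rev !size_code; have := tsz_gt0 x; lia.
Qed.

(** The rest [m] of the stack is preserved, so pending trees can wait below the argument. The bound
    is required on [D] only, because some iterations below have bounded values only on encodings of
    derivations. *)
Definition PT (D : tr -> Prop) (f : tr -> tr) : Prop :=
  exists (P : prog) (p : pol), forall x m, D x ->
    exec P (st (code x ++ m)) (ev p (tsz x)) (st (code (f x) ++ m)).

Definition anyt (x : tr) : Prop := True.

Lemma exec_size p s t s' : exec p s t s' -> forall r, size (sget r s') <= size (sget r s) + t.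
Proof.
elim=> {p s t s'}.
- by move=> s r; rewrite leq_addr.
- by move=> r b s r'; case: r r' => [] [] /=; lia.
- by move=> p q s t1 s1 t2 s2 _ IH1 _ IH2 r; move: (IH1 r) (IH2 r); lia.
- move=> r fl bd s t s' _ _ IH r'; move: (IH r').
  suff : size (sget r' (sset r (behead (sget r s)) s)) <= size (sget r' s) by lia.
  by case: r r' {IH} => [] [] /=; rewrite ?size_behead; lia.
- move=> r fl bd s t s1 t' s2 _ _ IH _ IH' r'; move: (IH r') (IH' r').
  suff : size (sget r' (sset r (behead (sget r s)) s)) <= size (sget r' s) by lia.
  by case: r r' {IH IH'} => [] [] /=; rewrite ?size_behead; lia.
- by move=> p s t t' s' Ht _ IH r; move: (IH r); lia.
Qed.

(** A step adds at most one symbol to a stack, so the running time bounds the growth. *)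
Lemma PT_size D f : PT D f -> exists q, forall x, D x -> tsz (f x) <= ev q (tsz x).
Proof.
case=> P [p H]; exists (PA PX p) => x Dx.
by have /(_ RM) := exec_size (H x [::] Dx); rewrite /= !cats0 !size_code.
Qed.

Lemma PT_ext D f g : (forall x, D x -> f x = g x) -> PT D f -> PT D g.
Proof. by move=> E [P [p H]]; exists P, p => x m Dx; rewrite -E //; exact: H. Qed.

Lemma PT_sub (D D' : tr -> Prop) f : (forall x, D' x -> D x) -> PT D f -> PT D' f.
Proof. by move=> S [P [p H]]; exists P, p => x m /S; exact: H. Qed.

Lemma PT_id D : PT D id.
Proof. by exists Skip, (PC 1) => x m _; exact: XSkip. Qed.

Lemma PT_comp D D' f g :
  PT D f -> PT D' g -> (forall x, D x -> D' (f x)) -> PT D (fun x => g (f x)).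
Proof.
move=> Hf [Q [q HQ]] S; have [r Hr] := PT_size Hf; case: Hf => P [p HP].
exists (Seq P Q), (PA p (psub q r)) => x m Dx /=.
apply: XSeq; first exact: HP.
rewrite ev_psub; apply: XLe; last by apply: HQ; exact: S.
by apply: ev_mono; apply: Hr.
Qed.

Lemma PT_car D : PT D car.
Proof.
exists (Br RM (fun _ => false) (fun c => match c with
   | Some true => Seq mvA (Seq (drain RA RB) (Seq drop_tree (Seq (drain RB RA) (drain RA RM))))
   | Some false => Push RM false | None => Skip end)), (PM (PC 100) PX) => -[|x y] m _ /=.
  by apply: XLe; last (by apply: XStop => //=; exact: XPush).
timed.
  apply: XStop => //=.
  rewrite -catA; apply: XSeq; first exact: exec_mvA.
  apply: XSeq; first drn.
  apply: XSeq; first exact: exec_drop.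
  apply: XSeq; first drn.
  drn.
rewrite /= !cats0 !size_rev !size_code; have := tsz_gt0 x; lia.
Qed.

Lemma PT_cdr D : PT D cdr.
Proof.
exists (Br RM (fun _ => false) (fun c => match c with
   | Some true => drop_tree
   | Some false => Push RM false | None => Skip end)), (PM (PC 20) PX) => -[|x y] m _ /=.
  by apply: XLe; last (by apply: XStop => //=; exact: XPush).
timed.
  by apply: XStop => //=; rewrite -catA; exact: exec_drop.
rewrite /=; have := tsz_gt0 x; lia.
Qed.

Fixpoint pushs (l : seq bool) : prog :=
  if l is b :: l' then Seq (pushs l') (Push RM b) else Skip.

Lemma exec_pushs l m : exec (pushs l) (st m) (2 * size l + 1) (st (l ++ m)).
Proof.
elim: l => [|b l IH] /=; first exact: XSkip.
by timed; [apply: XSeq; [exact: IH|exact: XPush]|lia].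
Qed.

Lemma PT_const D c : PT D (fun _ => c).
Proof.
exists (Seq drop_tree (pushs (code c))), (PA (PM (PC 20) PX) (PC (2 * size (code c) + 1))) => x m _.
timed; first by apply: XSeq; [exact: exec_drop|exact: exec_pushs].
by move=> /=; lia.
Qed.

Lemma PT_Nd D f g : PT D f -> PT D g -> PT D (fun x => Nd (f x) (g x)).
Proof.
move=> Hf [Q [q HQ]]; have [r Hr] := PT_size Hf.
have [r' Hr'] : exists q, forall x, D x -> tsz (g x) <= ev q (tsz x).
  by apply: PT_size; exists Q, q.
case: Hf => P [p HP].
exists (Seq dup_tree (Seq P (Seq swap_tree (Seq Q (Seq swap_tree (Push RM true)))))).
exists (PA (PM (PC 80) (PA PX (PA r r'))) (PA p (PA q (PC 2)))) => x m Dx.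
timed.
  apply: XSeq; first exact: exec_dup.
  apply: XSeq; first exact: HP.
  apply: XSeq; first exact: exec_swap.
  apply: XSeq; first exact: HQ.
  apply: XSeq; first exact: exec_swap.
  by rewrite catA; exact: XPush.
by move: (Hr x Dx) (Hr' x Dx) => /=; lia.
Qed.

Lemma PT_if D c f g : PT D c -> PT (fun x => D x /\ isN (c x)) f ->
  PT (fun x => D x /\ ~~ isN (c x)) g ->
  PT D (fun x => if isN (c x) then f x else g x).
Proof.
move=> Hc [P [p HP]] [Q [q HQ]]; have [r Hr] := PT_size Hc; case: Hc => C [k HC].
exists (Seq dup_tree (Seq C (Br RM (fun _ => false) (fun b => match b with
  | Some true => Seq drop_tree (Seq drop_tree P)
  | Some false => Q | None => Skip end)))).
exists (PA (PM (PC 80) (PA PX r)) (PA k (PA p q))) => x m Dx.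
timed.
  apply: XSeq; first exact: exec_dup.
  apply: XSeq; first exact: HC.
  apply: (XStop (t := 32 * ev r (tsz x) + ev p (tsz x) + ev q (tsz x))) => //=.
  have {HC} HD := Hr x Dx; case E : (c x) HD => [|a b] /= HD.
    apply: XLe; last by apply: HQ; rewrite E.
    by lia.
  rewrite -catA; timed.
    apply: XSeq; first exact: exec_drop.
    apply: XSeq; first exact: exec_drop.
    by apply: HP; rewrite E.
  by lia.
by have := tsz_gt0 x => /=; lia.
Qed.

(* [tn n] codes the number [n]; more generally a tree is read as the list of
   the left children along its right spine, of length [llen]. *)
Definition tn n := iter n (Nd Lf) Lf.
Fixpoint llen x := if x is Nd _ b then (llen b).+1 else 0.

Lemma llen_tn n : llen (tn n) = n.
Proof. by elim: n => //= n ->. Qed.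

Lemma tsz_tn n : tsz (tn n) = n.*2.+1.
Proof. by elim: n => //= n ->; lia. Qed.

Lemma llen_tsz x : llen x < tsz x.
Proof. by elim: x => //= a _ b; lia. Qed.

(** The size of the input in unary is the source of iteration counts: a loop that is stable once its
    work is done can be run this many times. *)
Lemma PT_ones D : PT D (fun x => tn (tsz x)).
Proof.
exists (Seq mvA (Seq (Push RM false) (Br RA (fun c => if c is Some _ then true else false)
   (fun c => if c is Some _ then Seq (Push RM false) (Push RM true) else Skip)))).
exists (PM (PC 30) PX) => x m _.
have H : forall a y m, exec (Br RA (fun c => if c is Some _ then true else false)
   (fun c => if c is Some _ then Seq (Push RM false) (Push RM true) else Skip))
    (Store (code y ++ m) a [::] [::]) (5 * size a + 2)
    (st (code (iter (size a) (Nd Lf) y) ++ m)).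
  elim=> [|c a IH] y m'; first by apply: XStop => //=; exact: XSkip.
  apply: (@XLe _ _ (4 + (5 * size a + 2)).+1); first by rewrite /=; lia.
  rewrite iterSr; apply: XLoop => //=.
  by apply: (XSeq (t1 := 2) (t2 := 2)); exact: XPush.
timed.
  apply: XSeq; first exact: exec_mvA.
  apply: XSeq; first exact: XPush.
  by move: (H (rev (code x)) Lf m); rewrite size_rev size_code /= cats0; exact.
by rewrite /= ?size_rev; have := tsz_gt0 x; lia.
Qed.

(** Iterating a polynomial-time function may blow up, so a bound on all intermediate values is
    assumed. The spine of [car x] is used up as the counter, and swaps bring the value to the top
    for each run of [f]. *)
Lemma PT_iter D f q : PT anyt f ->
  (forall x i, D x -> i <= llen (car x) -> tsz (iter i f (cdr x)) <= ev q (tsz x)) ->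
  PT D (fun x => iter (llen (car x)) f (cdr x)).
Proof.
move=> [P [p HP]] Hq.
pose loop := Br RM (fun c => if c is Some true then true else false)
  (fun c => if c is Some true then Seq drop_tree (Seq swap_tree (Seq P swap_tree))
            else Skip).
have H K S c : forall y m, tsz c <= K ->
    (forall i, i <= llen c -> tsz (iter i f y) <= S) ->
    exec loop (st (code c ++ code y ++ m)) (tsz c * (100 * (K + S) + ev p S))
      (st (code (iter (llen c) f y) ++ m)).
  elim: c => [|a _ c IH] y m /= HK HS.
    by apply: XLe; last (by apply: XStop => //=; exact: XSkip); lia.
  have S1 := HS 0 isT; have S2 := HS 1 isT; rewrite /= in S1 S2.
  timed.
    apply: XLoop => //=.
      rewrite -catA.
      apply: XSeq; first exact: exec_drop.
      apply: XSeq; first exact: exec_swap.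
      by apply: XSeq; [exact: HP|exact: exec_swap].
    rewrite -[f (iter _ _ _)]iterS iterSr; apply: IH; first by lia.
    by move=> i Hi; rewrite -iterSr; exact: HS.
  have := ev_mono p S1; have := tsz_gt0 a; have := tsz_gt0 y; nia.
exists (Br RM (fun _ => false) (fun c => match c with
  | Some true => loop | Some false => Push RM false | None => Skip end)).
exists (PA (PC 10) (PM PX (PA (PM (PC 100) (PA PX q)) (psub p q)))) => -[|c y] m Dx.
  by apply: XLe; last (by apply: XStop => //=; exact: XPush); rewrite /=; lia.
timed.
  apply: XStop => //=; rewrite -catA; apply: (H (tsz (Nd c y)) (ev q (tsz (Nd c y)))).
    by rewrite /=; lia.
  by move=> i Hi; apply: (Hq (Nd c y)).
by rewrite /= ev_psub; nia.
Qed.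

Lemma PT_call D h f : PT anyt h -> PT D f -> PT D (fun x => h (f x)).
Proof. by move=> Hh Hf; apply: (PT_comp Hf Hh). Qed.

Definition tif (c a b : tr) : tr := if isN c then a else b.
Arguments tif c a b /.
Notation "'If' c 'Then' a 'Else' b" := (tif c a b)
  (at level 200, c, a, b at level 200, only parsing).

Lemma PT_tif D c f g : PT D c -> PT anyt f -> PT anyt g ->
  PT D (fun x => tif (c x) (f x) (g x)).
Proof. by move=> Hc Hf Hg; apply: PT_if => //; [apply: PT_sub Hf|apply: PT_sub Hg]. Qed.

Create HintDb pt.
Hint Resolve PT_car PT_cdr PT_id PT_ones : pt.

Ltac pt_step :=
  lazymatch goal with
  | |- PT _ (fun x => x) => apply: PT_id
  | |- PT _ (fun _ => ?c) => apply: PT_const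
  | |- PT _ (fun x => Nd (@?f x) (@?g x)) => apply: (@PT_Nd _ f g)
  | |- PT _ (fun x => tif (@?c x) (@?f x) (@?g x)) => apply: (@PT_tif _ c f g)
  | |- PT _ (fun x => car (@?f x)) => apply: (@PT_call _ car f); [exact: PT_car|]
  | |- PT _ (fun x => cdr (@?f x)) => apply: (@PT_call _ cdr f); [exact: PT_cdr|]
  | |- PT _ (fun x => ?h (@?f x)) => apply: (@PT_call _ h f); [solve [auto with pt nocore]|]
  | |- PT _ _ => solve [auto with pt nocore]
  end.
Ltac pt := repeat pt_step.

(** The bound is in the size of [x], which may exceed the sizes of the counter and of the starting
    value; [f'] therefore carries [x] along. *)
Lemma PT_it D c y f q : PT D c -> PT D y -> PT anyt f ->
  (forall x i, D x -> i <= llen (c x) -> tsz (iter i f (y x)) <= ev q (tsz x)) ->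
  PT D (fun x => iter (llen (c x)) f (y x)).
Proof.
move=> Hc Hy Hf Hq.
pose f' z := Nd (car z) (f (cdr z)).
have Ef i x z : iter i f' (Nd x z) = Nd x (iter i f z) by elim: i => //= i ->.
pose D' z := exists2 x, D x & z = Nd (c x) (Nd x (y x)).
apply: (@PT_ext _ (fun x => cdr (iter (llen (car (Nd (c x) (Nd x (y x))))) f' (cdr (Nd (c x) (Nd x (y x))))))).
  by move=> x _ /=; rewrite Ef.
apply: (@PT_call _ cdr); first exact: PT_cdr.
apply: (@PT_comp D D' (fun x => Nd (c x) (Nd x (y x)))
         (fun z => iter (llen (car z)) f' (cdr z))).
- by apply: PT_Nd => //; apply: PT_Nd => //; exact: PT_id.
- apply: (@PT_iter _ _ (PA (PM (PC 2) PX) q)).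
    by rewrite /f'; pt.
  move=> _ i [x Dx ->] /= Hi; rewrite Ef /=.
  have := Hq x i Dx Hi.
  have : ev q (tsz x) <= ev q (tsz (c x) + (tsz x + tsz (y x)).+1).+1.
    by apply: ev_mono; lia.
  lia.
- by move=> x Dx; exists x.
Qed.

Lemma PT_it_add D c y f K : PT D c -> PT D y -> PT anyt f ->
  (forall s, tsz (f s) <= tsz s + K) ->
  PT D (fun x => iter (llen (c x)) f (y x)).
Proof.
move=> Hc Hy Hf HK; have [p Hp] := PT_size Hc; have [r Hr] := PT_size Hy.
apply: (@PT_it _ _ _ _ (PA r (PM (PC K) p))) => // x i Dx Hi /=.
have : tsz (iter i f (y x)) <= tsz (y x) + i * K.
  by elim: i {Hi} => [|i IH] /=; [lia|move: (HK (iter i f (y x))); lia].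
move: (Hp x Dx) (Hr x Dx) (llen_tsz (c x)); nia.
Qed.

Fixpoint lfold (f : tr -> tr) (l s : tr) : tr :=
  if l is Nd a l' then lfold f l' (f (Nd a s)) else s.

(** The item consumed in a round pays for what it contributes to the state, so the remaining list
    and the state together grow by at most [K]. *)
Lemma PT_lfold D f l s K : PT anyt f ->
  (forall a s, tsz (f (Nd a s)) <= tsz a + tsz s + K) -> PT D l -> PT D s ->
  PT D (fun x => lfold f (l x) (s x)).
Proof.
move=> Hf HK Hl Hs.
pose g z := If car z Then Nd (cdr (car z)) (f (Nd (car (car z)) (cdr z))) Else z.
have E a z : lfold f a z = cdr (iter (llen a) g (Nd a z)).
  elim: a z => //= a _ b IH z; rewrite IH; congr (cdr _).
  by rewrite -[g (iter _ _ _)]iterS iterSr /g /=.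
apply: (@PT_ext _ (fun x => cdr (iter (llen (l x)) g (Nd (l x) (s x))))) => [x _|].
  by rewrite E.
apply: (@PT_call _ cdr); first exact: PT_cdr.
apply: (@PT_it_add _ l _ g K) => //.
- exact: PT_Nd.
- by rewrite /g; pt.
- move=> [|[|a b] z] //=; rewrite /g /=; try lia.
  by move: (HK a z); lia.
Qed.

Definition ltr (s : seq tr) (t : tr) : tr := foldr Nd t s.

Lemma lfold_ltr f s t : lfold f (ltr s Lf) t = foldl (fun z a => f (Nd a z)) t s.
Proof. by elim: s t => //= a s IH t; rewrite IH. Qed.

Lemma lfold_tn f n t : lfold f (tn n) t = iter n (fun z => f (Nd Lf z)) t.
Proof. by elim: n t => //= n IH t; rewrite IH -iterSr. Qed.

Definition tnth_ (z : tr) : tr := car (lfold (fun y => cdr (cdr y)) (car z) (cdr z)).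

Lemma PT_tnth : PT anyt tnth_.
Proof.
rewrite /tnth_; pt_step; apply: (@PT_lfold _ _ _ _ 0); try by pt.
by move=> a [|b c] /=; lia.
Qed.
Hint Resolve PT_tnth : pt.

Lemma tnth_E i s : tnth_ (Nd (tn i) (ltr s Lf)) = nth Lf s i.
Proof.
rewrite /tnth_ /= lfold_tn.
elim: i s => [|i IH] [|a s] //; rewrite ?iterSr ?IH ?nth_nil //=.
by have -> : iter i cdr Lf = Lf by elim: i {IH} => //= i ->.
Qed.

Definition revcat (z : tr) : tr := lfold id (car z) (cdr z).

Lemma PT_revcat : PT anyt revcat.
Proof.
rewrite /revcat; apply: (@PT_lfold _ _ _ _ 1); try by pt.
by move=> a s /=; lia.
Qed.
Hint Resolve PT_revcat : pt.

Lemma revcat_E s t : revcat (Nd (ltr s Lf) t) = ltr (rev s) t.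
Proof.
rewrite /revcat /= lfold_ltr; elim: s t => //= a s IH t.
by rewrite IH rev_cons -cats1 /ltr foldr_cat.
Qed.

(* [tset (Nd i (Nd l e))] replaces the item [i] of the list [l] by [e]. *)
Definition tset_split (z : tr) : tr :=
  lfold (fun y => Nd (Nd (car (cdr (cdr y))) (car (cdr y))) (cdr (cdr (cdr y))))
    (car z) (Nd Lf (car (cdr z))).
Definition tset (z : tr) : tr :=
  revcat (Nd (car (tset_split z)) (Nd (cdr (cdr z)) (cdr (cdr (tset_split z))))).

Lemma PT_tset_split : PT anyt tset_split.
Proof.
rewrite /tset_split; apply: (@PT_lfold _ _ _ _ 5); try by pt.
by move=> a [|b [|c d]] /=; lia.
Qed.
Hint Resolve PT_tset_split : pt.
Lemma PT_tset : PT anyt tset.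
Proof. by rewrite /tset; pt. Qed.
Hint Resolve PT_tset : pt.

Lemma tset_E i s e : i < size s ->
  tset (Nd (tn i) (Nd (ltr s Lf) e)) = ltr (take i s ++ e :: drop i.+1 s) Lf.
Proof.
move=> Hi; rewrite /tset /tset_split /= lfold_tn.
have -> : iter i (fun z => Nd (Nd (car (cdr (cdr (Nd Lf z)))) (car (cdr (Nd Lf z))))
     (cdr (cdr (cdr (Nd Lf z))))) (Nd Lf (ltr s Lf)) =
     Nd (ltr (rev (take i s)) Lf) (ltr (drop i s) Lf).
  elim: i Hi => [|i IH] Hi; first by rewrite take0 drop0.
  rewrite iterS IH ?(ltnW Hi) //= (drop_nth Lf (ltnW Hi)) /= (take_nth Lf (ltnW Hi)).
  by rewrite rev_rcons.
by rewrite /= revcat_E revK (drop_nth Lf Hi) /= /ltr foldr_cat.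
Qed.

(** * Booleans, equality of trees and association lists *)

Definition tb (b : bool) : tr := if b then Nd Lf Lf else Lf.
Lemma isN_tb b : isN (tb b) = b. Proof. by case: b. Qed.

Definition tnot (a : tr) : tr := If a Then Lf Else Nd Lf Lf.
Definition txnor (z : tr) : tr := If car z Then cdr z Else tnot (cdr z).
Lemma PT_tnot : PT anyt tnot. Proof. by rewrite /tnot; pt. Qed.
Hint Resolve PT_tnot : pt.
Lemma PT_txnor : PT anyt txnor. Proof. by rewrite /txnor; pt. Qed.
Hint Resolve PT_txnor : pt.
Lemma tnot_E b : tnot (tb b) = tb (~~ b). Proof. by case: b. Qed.
Lemma txnor_E a b : txnor (Nd (tb a) (tb b)) = tb (a == b). Proof. by case: a; case: b. Qed.

Fixpoint teqb (a b : tr) : bool :=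
  match a, b with
  | Lf, Lf => true
  | Nd a1 a2, Nd b1 b2 => teqb a1 b1 && teqb a2 b2
  | _, _ => false
  end.

Lemma teqbP a b : reflect (a = b) (teqb a b).
Proof.
apply: (iffP idP) => [|<-]; last by elim: a => //= x -> y ->.
by elim: a b => [|x IHx y IHy] [|x' y'] //= /andP [/IHx -> /IHy ->].
Qed.

(** The state is a worklist of pairs of subtrees, with the verdict. A mismatch collapses it to [Lf],
    whose [cdr] reads as false. Each round uses up a node of the left tree, so the size of the input
    is enough rounds. *)
Definition teq_step (s : tr) : tr :=
  If car s Then
    If car (car (car s)) Then
      If cdr (car (car s)) Then
        Nd (Nd (Nd (car (car (car (car s)))) (car (cdr (car (car s)))))
           (Nd (Nd (cdr (car (car (car s)))) (cdr (cdr (car (car s)))))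
               (cdr (car s)))) (cdr s)
      Else Lf
    Else (If cdr (car (car s)) Then Lf Else Nd (cdr (car s)) (cdr s))
  Else s.
Definition teq (z : tr) : tr := cdr (iter (llen (tn (tsz z))) teq_step (Nd (Nd z Lf) (tb true))).

Lemma PT_teq : PT anyt teq.
Proof.
rewrite /teq; pt_step; apply: (@PT_it_add _ _ _ _ 10).
- exact: PT_ones.
- by pt.
- by rewrite /teq_step; pt.
- case=> [|[|[|[|a b] [|c d]] e] f]; rewrite /teq_step /=; lia.
Qed.
Hint Resolve PT_teq : pt.

Lemma teq_E a b : teq (Nd a b) = tb (teqb a b).
Proof.
have stab n f : iter n teq_step (Nd Lf f) = Nd Lf f by elim: n => //= n ->.
have stab' n : iter n teq_step Lf = Lf by elim: n => //= n ->.
have H : forall a b wl f n, tsz a <= n -> exists2 k, k <= tsz a &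
    iter n teq_step (Nd (Nd (Nd a b) wl) f) =
    if teqb a b then iter (n - k) teq_step (Nd wl f) else Lf.
  elim=> [|x IHx y IHy] [|x' y'] wl f [|n] //= Hn; rewrite -?[teq_step (iter _ _ _)]iterS ?iterSr.
  - by exists 1; rewrite // subn1.
  - by exists 0 => //; rewrite stab'.
  - by exists 0 => //; rewrite stab'.
  have [|k1 H1 E1] := IHx x' (Nd (Nd y y') wl) f n; first by lia.
  rewrite /teq_step /= -/teq_step E1.
  case: (teqb x x') => /=; last by exists 0 => //; lia.
  have [|k2 H2 E2] := IHy y' wl f (n - k1); first by lia.
  exists (k1 + k2).+1; first by lia.
  by rewrite E2 subSS subnDA.
rewrite /teq llen_tn.
have [|k Hk ->] := H a b Lf (tb true) (tsz (Nd a b)); first by rewrite /=; lia.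
by case: (teqb a b) => //; rewrite stab.
Qed.

(* [assoc (Nd a (Nd qs ts))] is the boolean in the list [ts] at the position of
   the first occurrence of [a] in [qs]; the state of the search is
   [Nd a (Nd ts (Nd found result))]. *)
Definition assoc_step (y : tr) : tr :=
  If car (cdr (cdr (cdr y))) Then cdr y
  Else If teq (Nd (car (cdr y)) (car y)) Then
    Nd (car (cdr y)) (Nd Lf (Nd (tb true)
      (If car (car (cdr (cdr y))) Then tb true Else tb false)))
  Else Nd (car (cdr y)) (Nd (cdr (car (cdr (cdr y)))) Lf).
Definition assoc (z : tr) : tr :=
  cdr (cdr (cdr (lfold assoc_step (car (cdr z)) (Nd (car z) (Nd (cdr (cdr z)) Lf))))).

Lemma PT_assoc : PT anyt assoc.
Proof.
rewrite /assoc; do 3 (apply: (@PT_call _ cdr); first exact: PT_cdr).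
apply: (@PT_lfold _ _ _ _ 15); try by rewrite /assoc_step; pt.
have tc x : tsz (cdr x) <= tsz x by case: x => //= *; lia.
move=> q [|a [|ts u]]; rewrite /assoc_step /=; repeat case: ifP => _ /=; try lia.
by have := tc ts; have := tsz_gt0 u; lia.
Qed.
Hint Resolve PT_assoc : pt.

Definition retag_step (y : tr) : tr :=
  Nd (car (cdr y)) (Nd (If assoc (Nd (car y) (car (cdr y))) Then tb true Else tb false) (cdr (cdr y))).
(* [retag (Nd ps (Nd qs ts))] maps [assoc] over the list [ps]. *)
Definition retag (z : tr) : tr :=
  revcat (Nd (cdr (lfold retag_step (car z) (Nd (cdr z) Lf))) Lf).

Lemma PT_retag : PT anyt retag.
Proof.
rewrite /retag; pt_step.
apply: PT_Nd; last exact: PT_const.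
apply: (@PT_call _ cdr); first exact: PT_cdr.
apply: (@PT_lfold _ _ _ _ 6); try by rewrite /retag_step; pt.
move=> a s; rewrite /retag_step /tif.
by case: (isN _); case: s => [|s t] /=; lia.
Qed.
Hint Resolve PT_retag : pt.

Fixpoint sassoc (a : tr) (qs : seq tr) (ts : seq bool) : bool :=
  match qs, ts with
  | q :: qs', t :: ts' => if teqb a q then t else sassoc a qs' ts'
  | _, _ => false
  end.

Definition ltb (ts : seq bool) : tr := ltr (map tb ts) Lf.

Lemma retag_E ps qs ts : size ts = size qs ->
  retag (Nd (ltr ps Lf) (Nd (ltr qs Lf) (ltb ts))) =
  ltb [seq sassoc a qs ts | a <- ps].
Proof.
move=> Hsz; have assocE a : assoc (Nd a (Nd (ltr qs Lf) (ltb ts))) = tb (sassoc a qs ts).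
  rewrite /assoc /= lfold_ltr.
  have stab l r : foldl (fun z b => assoc_step (Nd b z)) (Nd a (Nd Lf (Nd (tb true) r))) l
     = Nd a (Nd Lf (Nd (tb true) r)) by elim: l.
  elim: qs ts Hsz => [|q qs IH] [|t ts] //= [/IH {}IH].
  rewrite {2}/assoc_step /= teq_E isN_tb; case: (teqb a q); last exact: IH.
  by rewrite isN_tb stab /=; case: t.
rewrite /retag /= lfold_ltr.
have H l out : foldl (fun z b => retag_step (Nd b z)) (Nd (Nd (ltr qs Lf) (ltb ts)) (ltr out Lf)) l
   = Nd (Nd (ltr qs Lf) (ltb ts)) (ltr (rev [seq tb (sassoc a qs ts) | a <- l] ++ out) Lf).
  elim: l out => //= a l IH out; rewrite {2}/retag_step /= assocE isN_tb.
  rewrite -[if _ then _ else _]/(tb _) (IH (_ :: out)) rev_cons -cats1 -catA.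
  by [].
by rewrite (H ps [::]) /= cats0 revcat_E revK /ltb -map_comp.
Qed.

(** Makes counters of any fixed polynomial length: each stage puts together [tsz (c x)] copies of
    the previous tree, and the size of the last one is turned into a spine. *)
Lemma PT_big D c k : PT D c -> exists g, PT D g /\ forall x, D x -> (tsz (c x)) ^ k <= llen (g x).
Proof.
move=> Hc.
have [g [Hg H]] : exists g, PT D g /\ forall x, D x -> (tsz (c x)) ^ k <= tsz (g x).
  elim: k => [|k [g [Hg IH]]].
    by exists (fun _ => Lf); split=> //; exact: PT_const.
  pose f z := Nd (car z) (Nd (car z) (cdr z)).
  have E i a b : iter i f (Nd a b) = Nd a (iter i (Nd a) b) by elim: i => //= i ->.
  have S i a b : tsz (iter i (Nd a) b) = i * (tsz a).+1 + tsz b.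
    by elim: i => //= i ->; lia.
  have [p Hp] := PT_size Hc; have [r Hr] := PT_size Hg.
  exists (fun x => iter (llen (tn (tsz (c x)))) f (Nd (g x) Lf)); split.
    apply: (@PT_it _ _ _ _ (PM (PA p (PC 2)) (PA r (PC 2)))).
    - by apply: (@PT_call _ (fun x => tn (tsz x))) => //; exact: PT_ones.
    - by apply: PT_Nd => //; exact: PT_const.
    - by rewrite /f; pt.
    move=> x i Dx; rewrite llen_tn E /= S /= => Hi; move: (Hp x Dx) (Hr x Dx); nia.
  move=> x Dx; rewrite llen_tn E /= S expnS; move: (IH x Dx); nia.
exists (fun x => tn (tsz (g x))); split; last by move=> x Dx; rewrite llen_tn; exact: H.
by apply: (@PT_call _ (fun x => tn (tsz x))) => //; exact: PT_ones.
Qed.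

Definition wtr (w : word) : tr := ltb w.

(** A word is first rewritten as the coded list [wtr w], and the resulting list back as a word, each
    time by passing it through [RA]. *)
Lemma PT_tm f D : PT D f -> exists (M : tm) (c k : nat), forall w w', D (wtr w) ->
  f (wtr w) = wtr w' -> computes_within M (c * size w ^ k + c) w w'.
Proof.
case=> P [p HP].
pose inp := Seq (drain RM RA) (Seq (Push RM false)
  (Br RA (fun c => if c is Some _ then true else false)
   (fun c => if c is Some b then
      Seq (Seq (Push RM false) (if b then Seq (Push RM false) (Push RM true) else Skip))
         (Push RM true) else Skip))).
pose outp := Seq (Br RM (fun c => if c is Some true then true else false)
  (fun c => if c is Some true then
     Br RM (fun _ => false) (fun c => match c with
        | Some true => Seq (Br RM (fun _ => false) (fun _ => Skip))
                      (Seq (Br RM (fun _ => false) (fun _ => Skip)) (Push RA true))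
        | _ => Push RA false end)
   else Skip)) (drain RA RM).
have Hin w : exec inp (st w) (20 * size w + 10) (st (code (wtr w))).
  have H : forall l w, exec (Br RA (fun c => if c is Some _ then true else false)
   (fun c => if c is Some b then
      Seq (Seq (Push RM false) (if b then Seq (Push RM false) (Push RM true) else Skip))
         (Push RM true) else Skip)) (Store (code (wtr w)) l [::] [::]) (9 * size l + 3)
     (st (code (wtr (rev l ++ w)))).
    elim=> [|b l IH] w' /=; first by apply: XLe; last (apply: XStop => //=; exact: XSkip).
    apply: (@XLe _ _ (8 + (9 * size l + 3)).+1); first by lia.
    rewrite rev_cons cat_rcons.
    apply: (XLoop (s1 := Store (code (wtr (b :: w'))) l [::] [::])) => //.
    case: b => /=.
      apply: (XSeq (t1 := 6) (t2 := 2)).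
        apply: (XSeq (t1 := 2) (t2 := 4)); first exact: XPush.
        by apply: (XSeq (t1 := 2) (t2 := 2)); exact: XPush.
      exact: XPush.
    apply: (XSeq (t1 := 6) (t2 := 2)).
      apply: (XSeq (t1 := 2) (t2 := 4)); first exact: XPush.
      by apply: (@XLe _ _ 1) => //; exact: XSkip.
    exact: XPush.
  timed.
    apply: XSeq; first drn.
    apply: XSeq; first exact: XPush.
    by move: (H (rev w) [::]); rewrite revK cats0; exact.
  rewrite /= size_rev; lia.
have Hout w : exec outp (st (code (wtr w))) (20 * size w + 10) (st w).
  have H : forall w l, exec (Br RM (fun c => if c is Some true then true else false)
  (fun c => if c is Some true then
     Br RM (fun _ => false) (fun c => match c with
        | Some true => Seq (Br RM (fun _ => false) (fun _ => Skip))
                      (Seq (Br RM (fun _ => false) (fun _ => Skip)) (Push RA true))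
        | _ => Push RA false end)
   else Skip)) (Store (code (wtr w)) l [::] [::]) (9 * size w + 3)
     (Store [::] (rev w ++ l) [::] [::]).
    elim=> [|b l IH] w' /=; first by apply: XLe; last (apply: XStop => //=; exact: XSkip).
    apply: (@XLe _ _ (8 + (9 * size l + 3)).+1); first by lia.
    rewrite rev_cons cat_rcons.
    apply: (XLoop (s1 := Store (code (wtr l)) (b :: w') [::] [::])) => //.
    apply: (XStop (t := 7)) => //=; case: b => /=; first 1 last.
      by apply: (@XLe _ _ 2) => //; exact: XPush.
    apply: (@XLe _ _ (2 + (2 + 2))) => //.
    apply: XSeq; first by apply: XStop => //=; exact: XSkip.
    apply: XSeq; first by apply: XStop => //=; exact: XSkip.
    exact: XPush.
  timed.
    apply: XSeq; first exact: H.
    drn.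
  by rewrite /= cats0 ?size_rev; lia.
pose q := PA (PA (PM (PC 20) PX) (PC 10)) (PA (PM (PA (PM (PC 20) PX) (PC 10)) (PC 1)) (PC 0)).
pose p' := psub p (PA (PM (PC 4) PX) (PC 1)).
have Hsz w : tsz (wtr w) <= 4 * size w + 1 by rewrite /wtr /ltb; elim: w => //= -[] w /=; lia.
have [r Hr] := PT_size (ex_intro _ P (ex_intro _ p HP) : PT D f).
(* [4 * n + 1] bounds the size of [wtr w], and [r] the size of the result; this polynomial dominates
   reading, running and writing together. *)
have [c [k Hck]] := ev_bound (PA (PM (PC 100) PX)
  (PA (PC 100) (PA (PM (PC 40) (psub r (PA (PM (PC 4) PX) (PC 1)))) (psub p (PA (PM (PC 4) PX) (PC 1)))))).
exists (ptm (Seq inp (Seq P outp))), c, k => w w' Dw E.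
have X : exec (Seq inp (Seq P outp)) (st w) (20 * size w + 10 +
    (ev p (tsz (wtr w)) + (20 * size w' + 10))) (st w').
  apply: XSeq; first exact: Hin.
  apply: XSeq; last exact: Hout.
  by have := HP (wtr w) [::] Dw; rewrite !cats0 E.
apply: (ptm_computes X).
apply: leq_trans (Hck (size w)) => /=.
rewrite !ev_psub /=.
have H1 := ev_mono p (Hsz w); have H2 := ev_mono r (Hsz w).
have H3 := Hr _ Dw; rewrite E in H3.
have H4 : size w' <= tsz (wtr w') by rewrite /wtr /ltb; elim: (w') => //= -[] l /=; lia.
lia.
Qed.

(** * Parsing derivations *)

(** The first component is the number that the encoding writes in unary at the head of the object,
    and 0 for the sorts without a head token. *)
Definition node (k : nat) (cs : seq tr) : tr := Nd (tn k) (ltr cs Lf).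
Definition rawlist (X : Type) (f : X -> tr) (s : seq X) : tr := Nd Lf (ltr (map f s) Lf).

Fixpoint rawty (T : ty) : tr :=
  match T with
  | TUr => node 0 [::]
  | TProd A B => node 1 [:: rawty A; rawty B]
  | TUnit => node 2 [::]
  | TSet A => node 3 [:: rawty A]
  end.

Definition rawvar G T (x : var G T) : tr := node (var_index x) [::].

Fixpoint rawterm G T (t : term G T) : tr :=
  match t with
  | Var _ x => node 0 [:: rawvar x]
  | Tt => node 1 [::]
  | Pair _ _ t1 t2 => node 2 [:: rawterm t1; rawterm t2]
  | Proj1 _ _ t1 => node 3 [:: rawterm t1]
  | Proj2 _ _ t1 => node 4 [:: rawterm t1]
  end.

Fixpoint rawform G (f : form G) : tr :=
  match f with
  | FEq t u => node 0 [:: rawterm t; rawterm u]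
  | FNeq t u => node 1 [:: rawterm t; rawterm u]
  | FTop => node 2 [::]
  | FBot => node 3 [::]
  | FOr f1 f2 => node 4 [:: rawform f1; rawform f2]
  | FAnd f1 f2 => node 5 [:: rawform f1; rawform f2]
  | FAll T t f1 => node 6 [:: rawty T; rawterm t; rawform f1]
  | FEx T t f1 => node 7 [:: rawty T; rawterm t; rawform f1]
  end.

Definition rawatom G (a : atom G) : tr :=
  let: Mem T t u := a in node 0 [:: rawty T; rawterm t; rawterm u].

Definition rawgoal G (g : goal G) : tr :=
  match g with
  | GIn T t u => node 0 [:: rawty T; rawterm t; rawterm u]
  | GEq T t u => node 1 [:: rawty T; rawterm t; rawterm u]
  | GSub T t u => node 2 [:: rawty T; rawterm t; rawterm u]
  end.

Definition rawsequent G (q : sequent G) : tr :=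
  node 0 [:: rawlist rawty G; rawlist (@rawatom G) (mems q);
             rawlist (@rawform G) (hyps q); rawgoal (concl q)].

Fixpoint rawderiv G (q : sequent G) (d : deriv q) : tr :=
  node 0 [:: rawsequent q;
  match d with
  | DExch _ _ _ _ _ _ _ d1 => node 0 [:: rawderiv d1]
  | DContr _ _ _ _ _ _ d1 => node 1 [:: rawderiv d1]
  | DInUrR _ _ _ _ => node 2 [::]
  | DEqSetR _ _ _ _ _ d1 d2 => node 3 [:: rawderiv d1; rawderiv d2]
  | DEqProdR _ _ _ _ _ _ d1 d2 => node 4 [:: rawderiv d1; rawderiv d2]
  | DEqUnitR _ _ _ _ => node 5 [::]
  | DEqUrR _ _ _ _ d1 => node 6 [:: rawderiv d1]
  | DSubR _ _ _ _ _ d1 => node 7 [:: rawderiv d1]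
  | DInSetR _ _ _ _ _ _ d1 => node 8 [:: rawderiv d1]
  | DBotL _ _ _ _ _ => node 9 [::]
  | DAndL _ _ _ _ _ _ _ d1 => node 10 [:: rawderiv d1]
  | DOrL _ _ _ _ _ _ _ d1 d2 => node 11 [:: rawderiv d1; rawderiv d2]
  | DAllL _ _ _ _ _ _ _ _ _ d1 => node 12 [:: rawderiv d1]
  | DExL _ _ _ _ _ _ _ _ d1 => node 13 [:: rawderiv d1]
  | DEqSubst _ _ _ _ _ _ _ d1 => node 14 [:: rawderiv d1]
  | DNeqL _ _ _ _ _ _ => node 15 [::]
  | DProdBeta1 _ _ t1 t2 Th Ga _ t u d1 =>
      node 16 [:: rawterm t1; rawterm t2; rawsequent (Sequent Th Ga (GIn t u)); rawderiv d1]
  | DProdBeta2 _ _ t1 t2 Th Ga _ t u d1 =>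
      node 17 [:: rawterm t1; rawterm t2; rawsequent (Sequent Th Ga (GIn t u)); rawderiv d1]
  | DProdEta _ _ x _ _ _ _ _ d1 => node 18 [:: rawvar x; rawderiv d1]
  end].

(* Sorts: 0 variable, 1 type, 2 term, 3 formula, 4 goal, 5 rule, 6 atom,
   7 sequent, 8 derivation, 9 list of types, 10 list of atoms, 11 list of
   formulas.  Row [s] lists, for each head token, the sorts of the arguments. *)
Definition sorts_tbl : seq (seq (seq nat)) :=
  [:: [::];
   [:: [::]; [:: 1; 1]; [::]; [:: 1]];
   [:: [:: 0]; [::]; [:: 2; 2]; [:: 2]; [:: 2]];
   [:: [:: 2; 2]; [:: 2; 2]; [::]; [::]; [:: 3; 3]; [:: 3; 3]; [:: 1; 2; 3]; [:: 1; 2; 3]];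
   [:: [:: 1; 2; 2]; [:: 1; 2; 2]; [:: 1; 2; 2]];
   [:: [:: 8]; [:: 8]; [::]; [:: 8; 8]; [:: 8; 8]; [::]; [:: 8]; [:: 8]; [:: 8]; [::];
       [:: 8]; [:: 8; 8]; [:: 8]; [:: 8]; [:: 8]; [::]; [:: 2; 2; 7; 8]; [:: 2; 2; 7; 8];
       [:: 0; 8]];
   [:: [:: 1; 2; 2]];
   [:: [:: 9; 10; 11; 4]];
   [:: [:: 7; 5]]].
Definition args_of (s k : nat) : seq nat := nth [::] (nth [::] sorts_tbl s) k.

Definition T_args : tr :=
  Eval vm_compute in ltr [seq ltr [seq ltr [seq tn s | s <- ss] Lf | ss <- r] Lf | r <- sorts_tbl] Lf.
(* 1 for the sorts without a head token. *)
Definition T_tuple : tr :=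
  Eval vm_compute in ltr [seq tn s | s <- [:: 0; 0; 0; 0; 0; 0; 1; 1; 1]] Lf.
(* For the sorts of lists, the sort of the items. *)
Definition T_item : tr :=
  Eval vm_compute in ltr [seq tn s | s <- [:: 0; 0; 0; 0; 0; 0; 0; 0; 0; 1; 6; 3]] Lf.
Definition T_sort : tr := Eval vm_compute in ltr [seq tn s | s <- iota 0 12] Lf.

(** The commands of the parser. [cTok s acc] reads the head token of an object of sort [s], [acc]
    being the number of ones seen; [cList ss] reads one object for each sort in [ss]; [cRep s n]
    reads [n] objects of sort [s]; [cCons] pairs the two topmost values, the top one being the
    tail. *)
Notation cCons := (Nd Lf Lf).
Notation cTok s acc := (Nd (Nd Lf Lf) (Nd s acc)).
Notation cList ss := (Nd (Nd Lf (Nd Lf Lf)) ss).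
Notation cRep s n := (Nd (Nd Lf (Nd Lf (Nd Lf Lf))) (Nd s n)).

Definition tk_args (z : tr) : tr := tnth_ (Nd (cdr z) (tnth_ (Nd (car z) T_args))).
Definition tk_tuple (z : tr) : tr := tnth_ (Nd z T_tuple).
Definition tk_item (z : tr) : tr := tnth_ (Nd z T_item).
Definition tk_sort (z : tr) : tr := tnth_ (Nd z T_sort).

Lemma PT_tk_args : PT anyt tk_args. Proof. by rewrite /tk_args; pt. Qed.
Lemma PT_tk_tuple : PT anyt tk_tuple. Proof. by rewrite /tk_tuple; pt. Qed.
Lemma PT_tk_item : PT anyt tk_item. Proof. by rewrite /tk_item; pt. Qed.
Lemma PT_tk_sort : PT anyt tk_sort. Proof. by rewrite /tk_sort; pt. Qed.
Hint Resolve PT_tk_args PT_tk_tuple PT_tk_item PT_tk_sort : pt.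

(* [disp (Nd bits (Nd (Nd s acc) (Nd cmds vals)))] *)
Definition disp (z : tr) : tr :=
  If tk_item (car (car (cdr z))) Then
    Nd (car z) (Nd (Nd (cRep (tk_item (car (car (cdr z)))) (cdr (car (cdr z))))
                   (Nd cCons (car (cdr (cdr z))))) (Nd Lf (cdr (cdr (cdr z)))))
  Else
    Nd (car z) (Nd (Nd (cList (tk_args (car (cdr z))))
                   (Nd cCons (car (cdr (cdr z))))) (Nd (cdr (car (cdr z))) (cdr (cdr (cdr z))))).
Lemma PT_disp : PT anyt disp. Proof. by rewrite /disp; pt. Qed.
Hint Resolve PT_disp : pt.

Notation p_b z := (car z).
Notation p_c z := (car (cdr z)).
Notation p_v z := (cdr (cdr z)).
Notation p_op z := (car (car (p_c z))).
Notation p_ar z := (cdr (car (p_c z))).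

Definition pstep (z : tr) : tr :=
  If p_c z Then
    If p_op z Then
      If cdr (p_op z) Then
        If cdr (cdr (p_op z)) Then
          If cdr (p_ar z) Then
            Nd (p_b z) (Nd (Nd (cTok (tk_sort (car (p_ar z))) Lf)
                           (Nd (cRep (tk_sort (car (p_ar z))) (cdr (cdr (p_ar z))))
                           (Nd cCons (cdr (p_c z))))) (p_v z))
          Else Nd (p_b z) (Nd (cdr (p_c z)) (Nd Lf (p_v z)))
        Else
          If p_ar z Then
            Nd (p_b z) (Nd (Nd (cTok (car (p_ar z)) Lf) (Nd (cList (cdr (p_ar z)))
                           (Nd cCons (cdr (p_c z))))) (p_v z))
          Else Nd (p_b z) (Nd (cdr (p_c z)) (Nd Lf (p_v z)))
      Else
        If tk_tuple (car (p_ar z)) Then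
          disp (Nd (p_b z) (Nd (p_ar z) (Nd (cdr (p_c z)) (p_v z))))
        Else If car (p_b z) Then
          Nd (cdr (p_b z)) (Nd (Nd (cTok (car (p_ar z)) (Nd Lf (cdr (p_ar z)))) (cdr (p_c z))) (p_v z))
        Else disp (Nd (cdr (p_b z)) (Nd (p_ar z) (Nd (cdr (p_c z)) (p_v z))))
    Else Nd (p_b z) (Nd (cdr (p_c z)) (Nd (Nd (car (cdr (p_v z))) (car (p_v z))) (cdr (cdr (p_v z)))))
  Else z.
Lemma PT_pstep : PT anyt pstep. Proof. by rewrite /pstep; pt. Qed.

Lemma tsz_carcdr x : tsz (car x) + tsz (cdr x) <= tsz x + 1.
Proof. by case: x => //= a b; lia. Qed.

Arguments disp : simpl never.
Arguments tnth_ : simpl never.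
Lemma tsz_tnth i l : tsz (tnth_ (Nd i l)) <= tsz l.
Proof.
rewrite /tnth_ /=.
suff : tsz (lfold (fun y => cdr (cdr y)) i l) <= tsz l.
  by case: lfold => //= a b; lia.
elim: i l => //= _ _ b IH l; apply: leq_trans (IH _) _.
by case: l => //= a c; lia.
Qed.

Opaque T_args T_item T_sort T_tuple.
(** A step only rearranges the state and copies entries of the tables, so its growth is a constant
    and [PT_it_add] applies. *)
Lemma tsz_pstep z : tsz (pstep z) <= tsz z + (tsz T_args + tsz T_item + 2 * tsz T_sort + 50).
Proof.
move EA : (tsz T_args) => A; move EI : (tsz T_item) => I; move ES : (tsz T_sort) => S.
have hd b a c v : tsz (disp (Nd b (Nd a (Nd c v)))) <=
    tsz b + tsz a + tsz c + tsz v + (A + I + 20).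
  have := tsz_tnth (cdr a) (tnth_ (Nd (car a) T_args)).
  have := tsz_tnth (car a) T_args; have := tsz_tnth (car a) T_item.
  rewrite /disp /tif; case: (isN _); rewrite /tk_item /tk_args /= EA EI; move: (tsz_carcdr a); lia.
have := tsz_tnth (car (p_ar z)) T_sort; rewrite ES.
have h1 := tsz_carcdr z; have h2 := tsz_carcdr (cdr z); have h3 := tsz_carcdr (p_c z).
have h4 := tsz_carcdr (car (p_c z)); have h5 := tsz_carcdr (p_ar z).
have h6 := tsz_carcdr (p_b z); have h7 := tsz_carcdr (p_v z); have h8 := tsz_carcdr (cdr (p_v z)).
have h9 := tsz_carcdr (cdr (p_ar z)).
have d1 := hd (p_b z) (p_ar z) (cdr (p_c z)) (p_v z).
have d2 := hd (cdr (p_b z)) (p_ar z) (cdr (p_c z)) (p_v z).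
have pos := tsz_gt0.
have k1 := pos (p_op z); have k2 := pos (car (p_b z)); have k3 := pos (car (cdr (p_ar z))).
rewrite /pstep /tif /tk_sort.
have tN a b : tsz (Nd a b) = (tsz a + tsz b).+1 by [].
have tL : tsz Lf = 1 by [].
repeat case: ifP => _; rewrite ?tN ?tL; clear hd tN tL pos EA EI ES; lia.
Qed.

Definition lbits (w : word) (b : tr) : tr := ltr (map tb w) b.
Lemma lbits_cat w1 w2 b : lbits (w1 ++ w2) b = lbits w1 (lbits w2 b).
Proof. by rewrite /lbits /ltr map_cat foldr_cat. Qed.

Definition pst b c v := Nd b (Nd c v).

(** The slack 7 here and 5 per item in [parses_list] make the linear bounds compositional: an item
    in a list spends two steps on its commands and leaves 5 for the list. *)
Definition parses (s : nat) (w : word) (v : tr) : Prop :=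
  exists2 m, m + 7 <= 10 * size w & forall b c v0,
    iter m pstep (pst (lbits w b) (Nd (cTok (tn s) Lf) c) v0) = pst b c (Nd v v0).

Definition parses_list (ss : seq nat) (w : word) (vs : seq tr) : Prop :=
  exists2 m, m + 5 * size ss <= 10 * size w + 1 & forall b c v0,
    iter m pstep (pst (lbits w b) (Nd (cList (ltr (map tn ss) Lf)) c) v0) =
    pst b c (Nd (ltr vs Lf) v0).

Lemma parses_nil : parses_list [::] [::] [::].
Proof. by exists 1. Qed.

Lemma parses_cons s ss w1 w2 v vs : parses s w1 v -> parses_list ss w2 vs ->
  parses_list (s :: ss) (w1 ++ w2) (v :: vs).
Proof.
move=> [m1 L1 E1] [m2 L2 E2]; exists (1 + m2 + m1).+1.
  by rewrite size_cat /=; lia.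
by move=> b c v0; rewrite iterSr -addnA iterD iterD lbits_cat /= E1 E2.
Qed.

Lemma parses_one s w v : parses s w v -> parses_list [:: s] w [:: v].
Proof. by move=> H; rewrite -[w]cats0; apply: parses_cons H parses_nil. Qed.

Lemma tk_itemE s : tk_item (tn s) = tn (nth 0 [:: 0; 0; 0; 0; 0; 0; 0; 0; 0; 1; 6; 3] s).
Proof.
rewrite /tk_item -[T_item]/(ltr [seq tn s | s <- [:: 0; 0; 0; 0; 0; 0; 0; 0; 0; 1; 6; 3]] Lf).
by rewrite tnth_E; do 12 (case: s => // s); rewrite /= !nth_nil.
Qed.

Lemma tk_tupleE s : isN (tk_tuple (tn s)) = (s \in [:: 6; 7; 8]).
Proof.
rewrite /tk_tuple -[T_tuple]/(ltr [seq tn s | s <- [:: 0; 0; 0; 0; 0; 0; 1; 1; 1]] Lf).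
by rewrite tnth_E; do 9 (case: s => // s); rewrite /= nth_nil.
Qed.

Lemma tk_argsE s k : tk_args (Nd (tn s) (tn k)) = ltr (map tn (args_of s k)) Lf.
Proof.
rewrite -[tk_args _]/(tnth_ (Nd (tn k) (tnth_ (Nd (tn s)
  (ltr [seq ltr [seq ltr [seq tn s | s <- ss] Lf | ss <- r] Lf | r <- sorts_tbl] Lf))))) /args_of.
rewrite tnth_E.
set r := nth _ _ _; have {r}-> : r = ltr [seq ltr [seq tn s | s <- ss] Lf | ss <- nth [::] sorts_tbl s] Lf.
  rewrite /r; case: (ltnP s (size sorts_tbl)) => Hs; first by rewrite (nth_map [::]).
  by rewrite !nth_default ?size_map.
rewrite tnth_E; set l := nth [::] sorts_tbl s.
case: (ltnP k (size l)) => Hs; first by rewrite (nth_map [::]).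
by rewrite !nth_default ?size_map.
Qed.

Lemma tok_read s k a b c v : s \notin [:: 6; 7; 8] ->
  iter k.+1 pstep (pst (lbits (enc_nat k) b) (Nd (cTok (tn s) (tn a)) c) v) =
  disp (Nd b (Nd (Nd (tn s) (tn (k + a))) (Nd c v))).
Proof.
move=> Hs; elim: k a => [|k IH] a.
  by rewrite /= /pstep /tif /= tk_tupleE (negbTE Hs).
rewrite iterSr addSnnS -IH; congr (iter _ _ _).
by rewrite /pstep /tif /= tk_tupleE (negbTE Hs).
Qed.

Lemma parses_tok s k w vs : s < 6 -> parses_list (args_of s k) w vs ->
  parses s (enc_nat k ++ w) (node k vs).
Proof.
move=> Hs [m L E]; exists (1 + m + k.+1).
  by rewrite size_cat /enc_nat size_rcons size_nseq; lia.
move=> b c v0; rewrite 2!iterD lbits_cat (@tok_read s k 0); last first.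
  by move: s Hs {E L}; do 6 case=> //.
rewrite addn0 /disp /tif /= tk_itemE.
have -> /= : nth 0 [:: 0; 0; 0; 0; 0; 0; 0; 0; 0; 1; 6; 3] s = 0.
  by move: s Hs {E L}; do 6 case=> //.
by rewrite tk_argsE E.
Qed.

Lemma parses_tuple s w vs : s \in [:: 6; 7; 8] -> parses_list (args_of s 0) w vs ->
  parses s w (node 0 vs).
Proof.
move=> Hs [m L E]; exists (1 + m + 1).
  by move: Hs L; rewrite !inE => /or3P [] /eqP -> /=; lia.
move=> b c v0; rewrite 2!iterD.
have -> : iter 1 pstep (pst (lbits w b) (Nd (cTok (tn s) Lf) c) v0) =
  disp (Nd (lbits w b) (Nd (Nd (tn s) Lf) (Nd c v0))).
  by rewrite /= /pstep /tif /= tk_tupleE Hs.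
rewrite /disp /tif /= tk_itemE.
have -> /= : nth 0 [:: 0; 0; 0; 0; 0; 0; 0; 0; 0; 1; 6; 3] s = 0.
  by move: Hs; rewrite !inE => /or3P [] /eqP ->.
by rewrite (tk_argsE s 0) E.
Qed.

Lemma parses_seq s s' X (enc : X -> word) (raw : X -> tr) (l : seq X) :
  (s, s') \in [:: (9, 1); (10, 6); (11, 3)] -> (forall x, parses s' (enc x) (raw x)) ->
  parses s (enc_seq enc l) (rawlist raw l).
Proof.
move=> Hs H.
have [m L E] : exists2 m, m <= 10 * size (flatten (map enc l)) + 1 & forall b c v0,
    iter m pstep (pst (lbits (flatten (map enc l)) b) (Nd (cRep (tn s') (tn (size l))) c) v0) =
    pst b c (Nd (ltr (map raw l) Lf) v0).
  elim: l => [|x l [m2 L2 E2]]; first by exists 1.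
  have [m1 L1 E1] := H x; exists (1 + m2 + m1).+1.
    by rewrite /= size_cat; lia.
  move=> b c v0; rewrite iterSr -addnA iterD iterD lbits_cat /=.
  have -> : pstep (pst (lbits (enc x) (lbits (flatten [seq enc i | i <- l]) b))
      (Nd (cRep (tn s') (Nd Lf (tn (size l)))) c) v0) =
    pst (lbits (enc x) (lbits (flatten [seq enc i | i <- l]) b))
      (Nd (cTok (tn s') Lf) (Nd (cRep (tn s') (tn (size l))) (Nd cCons c))) v0.
    rewrite /pstep /tif /=.
    by move: Hs; rewrite !inE => /or3P [] /eqP [_ ->].
  by rewrite E1 E2.
exists (1 + m + (size l).+1).
  by rewrite size_cat /enc_nat size_rcons size_nseq; lia.
move=> b c v0; rewrite 2!iterD lbits_cat (@tok_read s (size l) 0); last first.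
  by move: Hs; rewrite !inE => /or3P [] /eqP [-> _].
rewrite addn0 /disp /tif /= tk_itemE.
have -> : nth 0 [:: 0; 0; 0; 0; 0; 0; 0; 0; 0; 1; 6; 3] s = s'.
  by move: Hs; rewrite !inE => /or3P [] /eqP [-> ->].
have -> : isN (tn s') by move: Hs; rewrite !inE => /or3P [] /eqP [_ ->].
by rewrite E.
Qed.

Ltac ps_list := repeat first [exact: parses_nil | assumption
  | apply: parses_one | apply: parses_cons].
Lemma parses_tok0 s k : s < 6 -> parses_list (args_of s k) [::] [::] ->
  parses s (enc_nat k) (node k [::]).
Proof. by move=> Hs H; rewrite -[enc_nat k]cats0; apply: parses_tok. Qed.

Ltac ps k := first [apply: (@parses_tok0 _ k) | apply: (@parses_tok _ k)] => //; ps_list.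

Lemma parses_nat k : parses 0 (enc_nat k) (node k [::]).
Proof. by apply: parses_tok0 => //; case: k => [|k]; exact: parses_nil. Qed.

Lemma parses_ty T : parses 1 (enc_ty T) (rawty T).
Proof. by elim: T => [|A IA B IB||A IA]; [ps 0|ps 1|ps 2|ps 3]. Qed.

Lemma parses_term G T (t : term G T) : parses 2 (enc_term t) (rawterm t).
Proof.
elim: t => [T' x||A B t It u Iu|A B t It|A B t It]; [|ps 1|ps 2|ps 3|ps 4].
by have := parses_nat (var_index x) => H; ps 0.
Qed.

Lemma parses_form G (f : form G) : parses 3 (enc_form f) (rawform f).
Proof.
have Ht := parses_term; have Hy := parses_ty.
elim: f => {G} [G t u|G t u|G|G|G f If1 g Ig|G f If1 g Ig|G T t f If1|G T t f If1];
  [ps 0|ps 1|ps 2|ps 3|ps 4|ps 5|ps 6|ps 7]; auto.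
Qed.

Lemma parses_atom G (a : atom G) : parses 6 (enc_atom a) (rawatom a).
Proof.
have Ht := parses_term; have Hy := parses_ty.
by case: a => T t u /=; apply: parses_tuple => //; ps_list; auto.
Qed.

Lemma parses_goal G (g : goal G) : parses 4 (enc_goal g) (rawgoal g).
Proof.
have Ht := parses_term; have Hy := parses_ty.
by case: g => T t u; [ps 0|ps 1|ps 2]; auto.
Qed.

Lemma parses_sequent G (q : sequent G) : parses 7 (enc_sequent q) (rawsequent q).
Proof.
apply: parses_tuple => //; apply: parses_cons; first by apply: (@parses_seq 9 1) => //; exact: parses_ty.
apply: parses_cons; first by apply: (@parses_seq 10 6) => //; exact: parses_atom.
apply: parses_cons; first by apply: (@parses_seq 11 3) => //; exact: parses_form.
by apply: parses_one; exact: parses_goal.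
Qed.

Lemma parses_deriv G (q : sequent G) (d : deriv q) : parses 8 (enc_deriv d) (rawderiv d).
Proof.
have Ht := parses_term; have Hs := parses_sequent; have Hn := parses_nat.
elim: d => {G q} *; (apply: parses_tuple => //; apply: parses_cons; [exact: Hs|apply: parses_one]);
  [ps 0|ps 1|ps 2|ps 3|ps 4|ps 5|ps 6|ps 7|ps 8|ps 9|ps 10|ps 11|ps 12|ps 13|ps 14|ps 15
  |ps 16|ps 17|ps 18]; auto; try exact: Hs; try exact: Hn.
Qed.

(** * The transducer *)

Fixpoint sw (x : tr) (l : seq tr) : tr :=
  if l is a :: l' then tif x (sw (cdr x) l') a else Lf.

Lemma PT_sw D c a l : PT D (fun x => tif (c x) (sw (cdr (c x)) (l x)) (a x)) ->
  PT D (fun x => sw (c x) (a x :: l x)).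
Proof. by []. Qed.
Lemma PT_sw0 D c : PT D (fun x => sw (c x) [::]).
Proof. exact: PT_const. Qed.

Ltac pt2_step :=
  lazymatch goal with
  | |- PT _ (fun x => sw (@?c x) [::]) => apply: (@PT_sw0 _ c)
  | |- PT _ (fun x => sw (@?c x) (@?a x :: @?l x)) => apply: (@PT_sw _ c a l)
  | _ => pt_step
  end.
Ltac pt2 := repeat pt2_step.

Definition tapp (z : tr) : tr := revcat (Nd (revcat (Nd (car z) Lf)) (cdr z)).
Lemma PT_tapp : PT anyt tapp. Proof. by rewrite /tapp; pt. Qed.
Hint Resolve PT_tapp : pt.
Lemma tapp_E s t : tapp (Nd (ltr s Lf) t) = ltr s t.
Proof. by rewrite /tapp /= !revcat_E revK. Qed.

Lemma tsz_revcat l r : tsz (revcat (Nd l r)) <= tsz l + tsz r.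
Proof.
rewrite /revcat /=; elim: l r => [|a _ b IH] r /=; first by lia.
by move: (IH (Nd a r)) => /=; lia.
Qed.
Lemma tsz_tapp l r : tsz (tapp (Nd l r)) <= tsz l + tsz r + 1.
Proof.
by rewrite /tapp /=; have := tsz_revcat (revcat (Nd l Lf)) r; have := tsz_revcat l Lf => /=; lia.
Qed.

(* A variable private to side [b] is entered in the context as [tb b], a common
   one as [Nd Lf e]; the variables of [e] are de Bruijn levels. *)
Definition setif (z : tr) : tr :=
  If cdr (tnth_ (Nd (car (cdr z)) (car z))) Then car z
  Else tset (Nd (car (cdr z)) (Nd (car z) (Nd Lf (cdr (cdr z))))).
Lemma PT_setif : PT anyt setif. Proof. by rewrite /setif; pt. Qed.
Hint Resolve PT_setif : pt.

Notation tPi1 e := (Nd (tn 3) (Nd e Lf)).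
Notation tPi2 e := (Nd (tn 4) (Nd e Lf)).
Notation tidx t := (car (car (cdr t))).

(** The state is a worklist of pairs of a term and an expression, with the context. Only variables
    are assigned and only pairs are split; other terms are skipped. *)
Definition asg_step (s : tr) : tr :=
  If car s Then
    If car (car (car (car s))) Then
      If cdr (car (car (car (car s)))) Then
        If cdr (cdr (car (car (car (car s))))) Then Nd (cdr (car s)) (cdr s)
        Else
          Nd (Nd (Nd (car (cdr (car (car (car s))))) (tPi1 (cdr (car (car s)))))
             (Nd (Nd (car (cdr (cdr (car (car (car s)))))) (tPi2 (cdr (car (car s)))))
             (cdr (car s)))) (cdr s)
      Else Nd (cdr (car s)) (cdr s)
    Else Nd (cdr (car s)) (setif (Nd (cdr s) (Nd (tidx (car (car (car s)))) (cdr (car (car s))))))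
  Else s.
Definition ones (x : tr) : tr := tn (tsz x).
Lemma PT_ones' : PT anyt ones. Proof. exact: PT_ones. Qed.
Hint Resolve PT_ones' : pt.

(* [assign (Nd K (Nd t e))] makes the variables of the tuple [t] that are not
   yet common equal to the corresponding components of [e]. *)
Definition assign (z : tr) : tr :=
  cdr (iter (llen (ones (car (cdr z)))) asg_step (Nd (Nd (cdr z) Lf) (car z))).

Lemma PT_asg_step : PT anyt asg_step. Proof. by rewrite /asg_step; pt. Qed.

Lemma tsz_setif K i e : tsz (setif (Nd K (Nd i e))) <= tsz K + 4 * tsz i + tsz e + 10.
Proof.
rewrite /setif /tif; case: (isN _) => /=; first by lia.
rewrite /tset; set z := Nd i _.
have : tsz (car (tset_split z)) + tsz (cdr (tset_split z)) <= tsz K + 4 * tsz i + 2.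
  rewrite /tset_split /=.
  have H : forall i pre suf, let s := lfold (fun y => Nd (Nd (car (cdr (cdr y))) (car (cdr y))) (cdr (cdr (cdr y)))) i (Nd pre suf) in
     tsz (car s) + tsz (cdr s) <= tsz pre + tsz suf + 4 * tsz i.
    elim=> [|a _ b IH] pre suf //=; first by lia.
    by move: (IH (Nd (car suf) pre) (cdr suf)) (tsz_carcdr suf); rewrite /=; lia.
  by move: (H i Lf K) => /=; lia.
have := tsz_carcdr (cdr (tset_split z)).
have := tsz_revcat (car (tset_split z)) (Nd (cdr (cdr z)) (cdr (cdr (tset_split z)))).
rewrite /= ; lia.
Qed.

(** The expression is copied into both components of a pair, so growth is not additive. The weight
    [|t| * (|e| + 30 * |t|)] of a task pays for the copies with the size of the term [t], and the
    total potential never increases. *)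
Definition asg_w (p : tr) := tsz (car p) * (tsz (cdr p) + 30 * tsz (car p)) + 10.
Fixpoint asg_ws (l : tr) := if l is Nd p l' then asg_w p + asg_ws l' else 1.
Definition asg_pot (s : tr) := asg_ws (car s) + tsz (cdr s) + 1.

Lemma asg_pot_step s : asg_pot (asg_step s) <= asg_pot s.
Proof.
have hp p : tsz p <= asg_w p by rewrite /asg_w; case: p => //= a b; have := tsz_gt0 a; nia.
case: s => // -[//|p l] K; rewrite /asg_pot /asg_step /tif /=.
have pos := tsz_gt0 (car p).
case: ifP => E1; last first.
  rewrite /=; have := tsz_setif K (tidx (car p)) (cdr p).
  have : 4 * tsz (tidx (car p)) + tsz (cdr p) + 10 <= asg_w p.
    rewrite /asg_w; have := tsz_carcdr (car (cdr (car p))); have := tsz_carcdr (cdr (car p)).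
    have := tsz_carcdr (car p); have := tsz_gt0 (cdr (car (cdr (car p)))).
    have := tsz_gt0 (cdr (cdr (car p))); have := tsz_gt0 (car (car p)); nia.
  by lia.
case: ifP => E2; last by rewrite /=; lia.
case: ifP => E3; first by rewrite /=; lia.
rewrite /= /asg_w /=; set e := tsz (cdr p).
case: (car p) E2 {E1 E3 pos} => //= -[|x [|y y']] //= z _.
have := tsz_carcdr z; have := tsz_carcdr (cdr z).
have := tsz_gt0 (cdr (cdr z)); have := tsz_gt0 (car z); have := tsz_gt0 (car (cdr z)).
have := tsz_gt0 x; have := tsz_gt0 y; have := tsz_gt0 y'.
move: (tsz (car z)) (tsz (car (cdr z))) (tsz (cdr (cdr z))) (tsz (cdr z)) (tsz z) (tsz x) (tsz y) (tsz y').
move=> t1 t2 t3 t4 t5 a b c *.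
set T := (a + (b + c).+1 + t5).+1.
have HT : t1 + t2 + 2 <= T by rewrite /T; lia.
have : t1 * (e + 12 + 30 * t1) + t2 * (e + 12 + 30 * t2) + 10 <= T * (e + 30 * T).
  have : (t1 + t2) * (e + 12 + 30 * (t1 + t2)) + 10 <= T * (e + 30 * T) by nia.
  nia.
lia.
Qed.

Lemma PT_assign : PT anyt assign.
Proof.
rewrite /assign; pt_step.
apply: (@PT_it _ _ _ _ (PA (PM PX (PA PX (PM (PC 30) PX))) (PA PX (PC 30)))).
- by pt.
- by pt.
- exact: PT_asg_step.
move=> x i _ _.
have H s : tsz s <= asg_pot s.
  rewrite /asg_pot; case: s => //= l K.
  suff : tsz l <= asg_ws l by lia.
  elim: l => //= p _ l IH; suff : tsz p < asg_w p by lia.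
  by rewrite /asg_w; case: p => //= a b; have := tsz_gt0 a; nia.
apply: leq_trans (H _) _.
have : asg_pot (iter i asg_step (Nd (Nd (cdr x) Lf) (car x))) <= asg_pot (Nd (Nd (cdr x) Lf) (car x)).
  by elim: i => //= i; apply: leq_trans; exact: asg_pot_step.
move/leq_trans; apply; rewrite /asg_pot /= /asg_w.
case: x => //= K -[|t e] /=; have := tsz_gt0 K; first by nia.
by move: (tsz t) (tsz e) (tsz K); nia.
Qed.
Hint Resolve PT_assign : pt.

(* The arguments are the constructor codes and indices of [enc_nrc]. *)
Definition TOK (ws : seq nat) : word := flatten (map enc_nat ws).
(* Tasks: text to be output, a number, a type, a list of types, a term read
   through the context [K] (or, if [K] is [Lf], a term over levels), a list of
   terms, the difference [n - l - 1], and the output for a subderivation [d] in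
   mode [m] (an interpolant if [m] is [Lf], else a value), where [n] is the size
   of the context of the output. *)
Definition tE (w : word) : tr := Nd Lf (ltb w).
Definition tNat k := Nd (tn 1) k.
Definition tObj o := Nd (tn 2) o.
Definition tObjs l := Nd (tn 3) l.
Definition tTm t K n := Nd (tn 4) (Nd t (Nd K n)).
Definition tTms l K n := Nd (tn 5) (Nd l (Nd K n)).
Definition tSub n l := Nd (tn 6) (Nd n l).
Definition tGen m d K tT tG p n :=
  Nd (tn 7) (Nd m (Nd d (Nd K (Nd tT (Nd tG (Nd p n)))))).

Notation "'LS' a1 .. an" := (Nd a1 .. (Nd an Lf) ..) (at level 10, a1, an at level 8, only parsing).

Notation gm z := (car (cdr z)).
Notation gd z := (car (cdr (cdr z))).
Notation gK z := (car (cdr (cdr (cdr z)))).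
Notation gT z := (car (cdr (cdr (cdr (cdr z))))).
Notation gG z := (car (cdr (cdr (cdr (cdr (cdr z)))))).
Notation gp z := (car (cdr (cdr (cdr (cdr (cdr (cdr z))))))).
Notation gn z := (cdr (cdr (cdr (cdr (cdr (cdr (cdr z))))))).
Notation dsq d := (car (cdr d)).
Notation drl d := (car (cdr (cdr d))).
Notation dch d := (cdr (drl d)).
Notation d1_ z := (car (dch (gd z))).
Notation d2_ z := (car (cdr (dch (gd z)))).
Notation d4_ z := (car (cdr (cdr (cdr (dch (gd z)))))).
Notation dat d := (cdr (car (cdr (cdr (dsq d))))).
Notation dhy d := (cdr (car (cdr (cdr (cdr (dsq d)))))).
Notation dgo d := (car (cdr (cdr (cdr (cdr (dsq d)))))).
Notation at_t z := (car (cdr (cdr (car (dat (gd z)))))).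
Notation at_u z := (car (cdr (cdr (cdr (car (dat (gd z))))))).
Notation th := Lf.
Notation vl := (Nd Lf Lf).
Notation tVar n := (Nd Lf (Nd (Nd n Lf) Lf)).
Notation tS n := (Nd Lf n).

(** * The text contributed by each rule *)

Definition same_ z d := LS (tGen (gm z) d (gK z) (gT z) (gG z) (gp z) (gn z)).
Definition x_exch z :=
  LS (tGen (gm z) (d1_ z) (gK z)
       (retag (Nd (dat (d1_ z)) (Nd (dat (gd z)) (gT z))))
       (retag (Nd (dhy (d1_ z)) (Nd (dhy (gd z)) (gG z)))) (gp z) (gn z)).
Definition x_dup z := LS (tGen (gm z) (d1_ z) (gK z) (gT z) (Nd (car (gG z)) (gG z)) (gp z) (gn z)).
(** A membership on side [p] proves the conclusion from that side alone, so the interpolant is true.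
    Otherwise both terms are common and the interpolant says that [{t} \ ({t} \ u)] is nonempty. As
    a value, [{t}] serves if the membership is on side [p], where [t] is common, and [u]
    otherwise. *)
Definition x_inur z :=
  If gm z Then
    If txnor (Nd (car (gT z)) (gp z)) Then LS (tE (TOK [:: 5])) (tTm (at_t z) (gK z) (gn z))
    Else LS (tTm (at_u z) (gK z) (gn z))
  Else
    If txnor (Nd (car (gT z)) (gp z)) Then LS (tE (TOK [:: 5; 1]))
    Else LS (tE (TOK [:: 6; 9; 5])) (tTm (at_t z) (gK z) (gn z))
            (tE (TOK [:: 9; 5])) (tTm (at_t z) (gK z) (gn z)) (tTm (at_u z) (gK z) (gn z))
            (tE (TOK [:: 5; 1])).
Definition gen_ z d := tGen (gm z) d (gK z) (gT z) (gG z) (gp z) (gn z).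
(** [a \ ({()} \ b)] is the conjunction of the Booleans [a] and [b]. *)
Definition x_and2 z :=
  LS (tE (TOK [:: 9])) (gen_ z (d1_ z)) (tE (TOK [:: 9; 5; 1])) (gen_ z (d2_ z)).
(** One inclusion is enough for the value: under all hypotheses the two sets are equal by soundness,
    so a set between them is their common value. *)
Definition x_eqset z := If gm z Then LS (gen_ z (d1_ z)) Else x_and2 z.
Definition x_eqprod z :=
  If gm z Then LS (tE (TOK [:: 2])) (gen_ z (d1_ z)) (gen_ z (d2_ z)) Else x_and2 z.
Definition x_equnit z := If gm z Then LS (tE (TOK [:: 1])) Else LS (tE (TOK [:: 5; 1])).
Definition new_ z m K p n := tGen m (d1_ z) (Nd K (gK z)) (Nd (gp z) (gT z)) (gG z) p n.
(** With the value [v] and the interpolant [th] of the premise, this is the extraction from the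
    union, over [y] in [v] and [z] in [{{y}}], of [z] if [th] holds. The union over [{{y}}] only
    serves to bind [z], at level [n + 1], to [{y}]. *)
Definition x_equr z :=
  If gm z Then
    LS (tE (TOK [:: 10; 6])) (new_ z vl (gp z) (gp z) (gn z))
       (tE (TOK [:: 6; 5; 5; 0; 0; 6]))
       (new_ z th (Nd Lf (tVar (tS (gn z)))) (tnot (gp z)) (tS (tS (gn z))))
       (tE (TOK [:: 0; 1]))
  Else LS (new_ z th (gp z) (gp z) (gn z)).
(** The text collects the [{y}], for [y] in the value [v] of the premise, for which the interpolant
    [th] holds. The eigenvariable is private in [v]; in [th] it is the bound [y], at level [n]. *)
Definition x_sub z :=
  If gm z Then
    LS (tE (TOK [:: 6])) (new_ z vl (gp z) (tnot (gp z)) (gn z))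
       (tE (TOK [:: 6]))
       (new_ z th (Nd Lf (tVar (gn z))) (tnot (gp z)) (tS (gn z)))
       (tE (TOK [:: 5; 0; 1]))
  Else LS (new_ z th (gp z) (gp z) (gn z)).
Definition asg_ z := assign (Nd (gK z) (Nd (at_t z) (tVar (gn z)))).
(** The interpolant: some [z] in [u] satisfies [z = t] and the interpolant of the premise, the
    variables of [t] having become common as projections of [z]. *)
Definition ex_ z tG :=
  LS (tE (TOK [:: 6])) (tTm (at_u z) (gK z) (gn z))
     (tE (TOK [:: 9; 9; 5; 1; 6; 9; 5; 0; 0; 5])) (tTm (at_t z) (asg_ z) (tS (gn z)))
     (tE (TOK [:: 5; 1; 9; 5; 1])) (tGen th (d1_ z) (asg_ z) (gT z) tG (gp z) (tS (gn z))).
(** Dually, every [z] in [u] with [z = t] satisfies the interpolant of the premise: [{()}] minus the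
    union of the differences. *)
Definition all_ z tG :=
  LS (tE (TOK [:: 9; 5; 1; 6])) (tTm (at_u z) (gK z) (gn z))
     (tE (TOK [:: 9; 9; 5; 1; 6; 9; 5; 0; 0; 5])) (tTm (at_t z) (asg_ z) (tS (gn z)))
     (tE (TOK [:: 5; 1])) (tGen th (d1_ z) (asg_ z) (gT z) tG (gp z) (tS (gn z))).
Definition x_inset z :=
  If gm z Then
    If txnor (Nd (car (gT z)) (gp z)) Then LS (tE (TOK [:: 5])) (gen_ z (d1_ z))
    Else LS (tTm (at_u z) (gK z) (gn z))
  Else
    If txnor (Nd (car (gT z)) (gp z)) Then LS (gen_ z (d1_ z)) Else ex_ z (gG z).
(** Under contradictory hypotheses the empty set is a value. The interpolant is true if the
    contradiction is on side [p] and false otherwise. *)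
Definition x_bot z :=
  If gm z Then LS (tE (TOK [:: 7])) (tObj (car (cdr (dgo (gd z)))))
  Else If txnor (Nd (car (gG z)) (gp z)) Then LS (tE (TOK [:: 5; 1]))
  Else LS (tE (TOK [:: 7; 2])).
(** A value for a membership need only contain the element, so the union of both values works
    whichever disjunct holds. The interpolants are conjoined if the disjunction is on side [p],
    since either disjunct may hold there, and joined by union otherwise. *)
Definition x_or z :=
  If gm z Then LS (tE (TOK [:: 8])) (gen_ z (d1_ z)) (gen_ z (d2_ z))
  Else If txnor (Nd (car (gG z)) (gp z)) Then x_and2 z
  Else LS (tE (TOK [:: 8])) (gen_ z (d1_ z)) (gen_ z (d2_ z)).
(** If membership and formula are on the same side, the instance stays there. Otherwise the bound is
    common and the interpolant quantifies over it: existentially if the membership is on the side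
    opposite to [p], which supplies the element, and universally if it is on side [p]. *)
Definition x_all z :=
  If txnor (Nd (car (gT z)) (car (gG z))) Then LS (gen_ z (d1_ z))
  Else If gm z Then
    LS (tE (TOK [:: 6])) (tTm (at_u z) (gK z) (gn z))
       (tGen vl (d1_ z) (asg_ z) (gT z) (gG z) (gp z) (tS (gn z)))
  Else If txnor (Nd (car (gG z)) (gp z)) Then ex_ z (gG z) Else all_ z (gG z).
Definition x_ex z :=
  LS (tGen (gm z) (d1_ z) (Nd (car (gG z)) (gK z)) (Nd (car (gG z)) (gT z)) (gG z) (gp z) (gn z)).
Notation eq_x z := (car (cdr (car (dhy (gd z))))).
Notation eq_y z := (car (cdr (cdr (car (dhy (gd z)))))).
Definition eqv_ z := cdr (tnth_ (Nd (tidx (eq_x z)) (gK z))).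
Definition set_ z := setif (Nd (gK z) (Nd (tidx (eq_y z)) (eqv_ z))).
(** A private [x] simply disappears. If [x] is common, a private [y] becomes common with the same
    term; a [y] that is common already keeps its term, so the equation is tested, as a premise if
    the formula is on side [p] and as a conjunct otherwise. *)
Definition x_eqsubst z :=
  If eqv_ z Then
    If gm z Then LS (tGen (gm z) (d1_ z) (set_ z) (gT z) (cdr (gG z)) (gp z) (gn z))
    Else If txnor (Nd (car (gG z)) (gp z)) Then
      LS (tE (TOK [:: 9; 5; 1; 9; 9; 5; 1; 6; 9; 5])) (tTm (eq_x z) (gK z) (gn z)) (tE (TOK [:: 5]))
         (tTm (eq_y z) (set_ z) (gn z)) (tE (TOK [:: 5; 1]))
         (tGen (gm z) (d1_ z) (set_ z) (gT z) (cdr (gG z)) (gp z) (gn z))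
    Else
      LS (tE (TOK [:: 9; 9; 5; 1; 6; 9; 5])) (tTm (eq_x z) (gK z) (gn z)) (tE (TOK [:: 5]))
         (tTm (eq_y z) (set_ z) (gn z)) (tE (TOK [:: 5; 1; 9; 5; 1]))
         (tGen (gm z) (d1_ z) (set_ z) (gT z) (cdr (gG z)) (gp z) (gn z))
  Else LS (tGen (gm z) (d1_ z) (gK z) (gT z) (cdr (gG z)) (gp z) (gn z)).
Definition kpi2 k := If cdr k Then Nd Lf (tPi2 (cdr k)) Else k.
Definition kpi1 k := If cdr k Then Nd Lf (tPi1 (cdr k)) Else k.
Definition eta_k z := tnth_ (Nd (car (d1_ z)) (gK z)).
Definition x_eta z :=
  LS (tGen (gm z) (d2_ z) (Nd (kpi2 (eta_k z)) (Nd (kpi1 (eta_k z)) (gK z)))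
       (gT z) (gG z) (gp z) (gn z)).

Definition ex_gen z :=
  sw (car (drl (gd z)))
   [:: x_exch z; x_dup z; x_inur z; x_eqset z; x_eqprod z; x_equnit z; x_equr z; x_sub z;
       x_inset z; x_bot z; x_dup z; x_or z; x_all z; x_ex z; x_eqsubst z; x_bot z;
       same_ z (d4_ z); same_ z (d4_ z); x_eta z].

Definition x_nat z :=
  If cdr z Then LS (tE [:: true]) (tNat (cdr (cdr z))) Else LS (tE [:: false]).
Definition x_obj z := LS (tNat (car (cdr z))) (tObjs (cdr (cdr z))).
Definition x_objs z :=
  If cdr z Then LS (tObj (car (cdr z))) (tObjs (cdr (cdr z))) Else Lf.
Notation t_K z := (car (cdr (cdr z))).
Notation t_n z := (cdr (cdr (cdr z))).
Definition x_tm z :=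
  If car (car (cdr z)) Then LS (tNat (car (car (cdr z)))) (tTms (cdr (car (cdr z))) (t_K z) (t_n z))
  Else If t_K z Then LS (tTm (cdr (tnth_ (Nd (tidx (car (cdr z))) (t_K z)))) Lf (t_n z))
  Else LS (tE [:: false]) (tSub (t_n z) (tidx (car (cdr z)))).
Definition x_tms z :=
  If car (cdr z) Then LS (tTm (car (car (cdr z))) (t_K z) (t_n z))
                         (tTms (cdr (car (cdr z))) (t_K z) (t_n z))
  Else Lf.
Definition x_subn z :=
  If cdr (cdr z) Then LS (tSub (cdr (car (cdr z))) (cdr (cdr (cdr z))))
  Else LS (tNat (cdr (car (cdr z)))).

Definition ex z :=
  sw (car z) [:: Lf; x_nat z; x_obj z; x_objs z; x_tm z; x_tms z; x_subn z; ex_gen z].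

Ltac ptu d := unfold d, x_and2, gen_, new_, ex_, all_, same_; unfold tGen, tE, tNat, tObj, tObjs, tTm, tTms, tSub; pt2.
Lemma PT_x_exch : PT anyt x_exch. Proof. ptu x_exch. Qed.
Lemma PT_x_dup : PT anyt x_dup. Proof. ptu x_dup. Qed.
Lemma PT_x_inur : PT anyt x_inur. Proof. ptu x_inur. Qed.
Lemma PT_x_eqset : PT anyt x_eqset. Proof. ptu x_eqset. Qed.
Lemma PT_x_eqprod : PT anyt x_eqprod. Proof. ptu x_eqprod. Qed.
Lemma PT_x_equnit : PT anyt x_equnit. Proof. ptu x_equnit. Qed.
Lemma PT_x_equr : PT anyt x_equr. Proof. ptu x_equr. Qed.
Lemma PT_x_sub : PT anyt x_sub. Proof. ptu x_sub. Qed.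
Lemma PT_asg_ : PT anyt asg_. Proof. ptu asg_. Qed.
Hint Resolve PT_asg_ : pt.
Lemma PT_x_inset : PT anyt x_inset. Proof. ptu x_inset. Qed.
Lemma PT_x_bot : PT anyt x_bot. Proof. ptu x_bot. Qed.
Lemma PT_x_or : PT anyt x_or. Proof. ptu x_or. Qed.
Lemma PT_x_all : PT anyt x_all. Proof. ptu x_all. Qed.
Lemma PT_x_ex : PT anyt x_ex. Proof. ptu x_ex. Qed.
Lemma PT_eqv_ : PT anyt eqv_. Proof. ptu eqv_. Qed.
Hint Resolve PT_eqv_ : pt.
Lemma PT_set_ : PT anyt set_. Proof. ptu set_. Qed.
Hint Resolve PT_set_ : pt.
Lemma PT_x_eqsubst : PT anyt x_eqsubst. Proof. ptu x_eqsubst. Qed.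
Lemma PT_kpi1 : PT anyt kpi1. Proof. ptu kpi1. Qed.
Lemma PT_kpi2 : PT anyt kpi2. Proof. ptu kpi2. Qed.
Lemma PT_eta_k : PT anyt eta_k. Proof. ptu eta_k. Qed.
Hint Resolve PT_kpi1 PT_kpi2 PT_eta_k : pt.
Lemma PT_x_eta : PT anyt x_eta. Proof. ptu x_eta. Qed.
Hint Resolve PT_x_exch PT_x_dup PT_x_inur PT_x_eqset PT_x_eqprod PT_x_equnit PT_x_equr PT_x_sub
  PT_x_inset PT_x_bot PT_x_or PT_x_all PT_x_ex PT_x_eqsubst PT_x_eta : pt.
Lemma PT_ex_gen : PT anyt ex_gen. Proof. unfold ex_gen, same_, tGen; pt2. Qed.
Lemma PT_x_nat : PT anyt x_nat. Proof. ptu x_nat. Qed.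
Lemma PT_x_obj : PT anyt x_obj. Proof. ptu x_obj. Qed.
Lemma PT_x_objs : PT anyt x_objs. Proof. ptu x_objs. Qed.
Lemma PT_x_tm : PT anyt x_tm. Proof. ptu x_tm. Qed.
Lemma PT_x_tms : PT anyt x_tms. Proof. ptu x_tms. Qed.
Lemma PT_x_subn : PT anyt x_subn. Proof. ptu x_subn. Qed.
Hint Resolve PT_ex_gen PT_x_nat PT_x_obj PT_x_objs PT_x_tm PT_x_tms PT_x_subn : pt.
Lemma PT_ex : PT anyt ex. Proof. unfold ex; pt2. Qed.
Hint Resolve PT_ex : pt.

Arguments ex : simpl never.
Arguments tapp : simpl never.

(* The head task is either text to be copied to the (reversed) output [cdr z]
   or is expanded. *)
Definition mstep (z : tr) : tr :=
  If car z Then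
    If car (car (car z)) Then Nd (tapp (Nd (ex (car (car z))) (cdr (car z)))) (cdr z)
    Else If cdr (car (car z)) Then
      Nd (Nd (Nd Lf (cdr (cdr (car (car z))))) (cdr (car z))) (Nd (car (cdr (car (car z)))) (cdr z))
    Else Nd (cdr (car z)) (cdr z)
  Else z.
Lemma PT_mstep : PT anyt mstep. Proof. unfold mstep; pt2. Qed.

Definition hsz (z : tr) := tsz (car (car z)).

Lemma tsz_mstep : exists q, forall z, tsz (mstep z) <= tsz z + ev q (hsz z).
Proof.
have [q Hq] := PT_size PT_ex; exists (PA q (PC 5)) => -[|[|t r] acc] //; rewrite /hsz; try (rewrite /=; lia).
rewrite /mstep /tif /=; case: ifP => _.
  by have := Hq t I; have := tsz_tapp (ex t) r; rewrite /=; lia.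
case: ifP => _ /=; have := tsz_carcdr t; have := tsz_carcdr (cdr t); have := tsz_gt0 (car t);
  have := tsz_gt0 t; lia.
Qed.

(** [B] bounds every task that reaches the head. By [tsz_mstep] a step adds at most a polynomial in
    the size of the head task, so with this bound polynomially many steps keep the state
    polynomial. *)
Definition emits (B m : nat) (ts : seq tr) (w : word) : Prop :=
  exists2 k, k <= m & forall r acc,
    iter k mstep (Nd (ltr ts r) acc) = Nd r (lbits (rev w) acc) /\
    forall j, j < k -> hsz (iter j mstep (Nd (ltr ts r) acc)) <= B.

Lemma emits_nil B : emits B 0 [::] [::].
Proof. by exists 0. Qed.

Lemma emits_cat B m1 m2 ts1 ts2 w1 w2 :
  emits B m1 ts1 w1 -> emits B m2 ts2 w2 -> emits B (m1 + m2) (ts1 ++ ts2) (w1 ++ w2).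
Proof.
move=> [k1 L1 E1] [k2 L2 E2]; exists (k2 + k1); first by lia.
move=> r acc; have -> : ltr (ts1 ++ ts2) r = ltr ts1 (ltr ts2 r) by exact: foldr_cat.
have [E3 H3] := E1 (ltr ts2 r) acc; have [E4 H4] := E2 r (lbits (rev w1) acc).
rewrite iterD E3 E4 rev_cat lbits_cat; split=> // j Hj.
case: (ltnP j k1) => Hj1; first exact: H3.
by rewrite -(subnK Hj1) iterD E3; apply: H4; lia.
Qed.

Lemma emits_cons B m1 m2 t ts w1 w2 :
  emits B m1 [:: t] w1 -> emits B m2 ts w2 -> emits B (m1 + m2) (t :: ts) (w1 ++ w2).
Proof. exact: emits_cat. Qed.

Lemma emits_le B m m' ts w : m <= m' -> emits B m ts w -> emits B m' ts w.
Proof. by move=> H [k L E]; exists k => //; lia. Qed.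

Lemma emits_ex B m o args ts w : tsz (Nd (tn o.+1) args) <= B ->
  ex (Nd (tn o.+1) args) = ltr ts Lf -> emits B m ts w ->
  emits B m.+1 [:: Nd (tn o.+1) args] w.
Proof.
move=> Hs He [k L E]; exists k.+1 => // r acc.
have [E1 E2] := E r acc.
have S1 : mstep (Nd (ltr [:: Nd (tn o.+1) args] r) acc) = Nd (ltr ts r) acc.
  by rewrite -[mstep _]/(Nd (tapp (Nd (ex (Nd (tn o.+1) args)) r)) acc) He tapp_E.
by rewrite iterSr S1; split=> // -[|j] Hj //; rewrite iterSr S1; exact: E2.
Qed.

Lemma emits_text B w : 4 * size w + 3 <= B -> emits B (size w).+1 [:: tE w] w.
Proof.
elim: w => [|b w IH] Hs; first by exists 1 => // r acc; split=> // -[|j].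
have [|k L E] := IH; first by rewrite /= in Hs; lia.
exists k.+1 => // r acc; have [E1 E2] := E r (Nd (tb b) acc).
have S1 : mstep (Nd (ltr [:: tE (b :: w)] r) acc) = Nd (ltr [:: tE w] r) (Nd (tb b) acc) by [].
rewrite iterSr S1 E1 rev_cons -cats1 lbits_cat; split=> // -[|j] Hj; last by rewrite iterSr S1; exact: E2.
rewrite /hsz /=; have H : tsz (ltr [seq tb i | i <- w] Lf) <= 4 * size w + 1.
  by elim: (w) => //= -[] w' /=; lia.
rewrite /= in Hs; have {}H : tsz (ltr (map tb w) Lf) <= 4 * size w + 1 := H.
by case: (b) => /=; move: H; move: (tsz (ltr _ _)) => n; lia.
Qed.

(** * Environments and soundness *)

Section Vars.
Variable F : ty -> Type.

Definition vcons A G (a : F A) (K : forall T, var G T -> F T) : forall T, var (A :: G) T -> F T :=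
  fun T x => match x in var G' T return
      match G' with
      | [::] => unit
      | A' :: G1 => F A' -> (forall T, var G1 T -> F T) -> F T
      end with
    | VZ _ _ => fun a _ => a
    | VS _ _ _ y => fun _ K => K _ y
    end a K.

Definition vtail A G (K : forall T, var (A :: G) T -> F T) : forall T, var G T -> F T :=
  fun T x => K T (VS x).

Fixpoint vupd G A (x : var G A) : F A -> (forall T, var G T -> F T) -> forall T, var G T -> F T :=
  match x in var G A return F A -> (forall T, var G T -> F T) -> forall T, var G T -> F T with
  | VZ _ _ => fun a K => vcons a (vtail K)
  | VS _ _ _ x' => fun a K => vcons (K _ VZ) (vupd x' a (vtail K))
  end.
End Vars.

Lemma var_case A G (Q : forall T, var (A :: G) T -> Prop) :
  Q A VZ -> (forall T (x : var G T), Q T (VS x)) -> forall T (x : var (A :: G) T), Q T x.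
Proof.
move=> H0 HS T x.
refine (match x as x in var G' T return
  match G' return var G' T -> Prop with
  | [::] => fun _ => True
  | A' :: G1 => fun x => forall (Q : forall T, var (A' :: G1) T -> Prop),
      Q A' VZ -> (forall T (x : var G1 T), Q T (VS x)) -> Q T x
  end x with VZ _ _ => _ | VS _ _ _ y => _ end Q H0 HS) => //.
Qed.

(** Reasoning about an update through this principle avoids deciding whether two variables are
    equal. *)
Lemma vupd_ind F G A (x : var G A) (Q : forall T, var G T -> F T -> Prop) (a : F A)
    (K : forall T, var G T -> F T) :
  Q A x a -> (forall T (y : var G T), Q T y (K T y)) ->
  forall T (y : var G T), Q T y (vupd x a K y).
Proof.
elim: x Q a K => {G A} [G A|G T A x IH] Q a K H0 HK; apply: var_case => //=.
move=> B y; apply: (IH (fun T y => Q T (VS y))) => // T' y'; exact: HK.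
Qed.

Lemma vupd_same F G A (x : var G A) (a : F A) (K : forall T, var G T -> F T) : vupd x a K x = a.
Proof. by elim: x a K => //= G' T B x IH a K; rewrite IH. Qed.

Lemma upd_ind G D A (x : var G A) (Q : forall T, var G T -> term D T -> Prop) a (s : subst G D) :
  Q A x a -> (forall T (y : var G T), Q T y (s T y)) ->
  forall T (y : var G T), Q T y (upd x a s y).
Proof.
elim: x Q a s => {G A} [G A|G T A x IH] Q a s H0 Hs; apply: var_case => //=.
move=> B y; apply: (IH (fun T y => Q T (VS y))) => // T' y'; exact: Hs.
Qed.

(** * Free variables and substitution *)

Notation vpred G := (forall T, var G T -> Prop).

(** The free variables are constrained by a predicate instead of collected in a list, so that the
    condition pulls back along substitutions. *)
Fixpoint tv G (P : vpred G) T (t : term G T) : Prop :=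
  match t with
  | Var _ x => P _ x
  | Tt => True
  | Pair _ _ t1 t2 => tv P t1 /\ tv P t2
  | Proj1 _ _ t1 => tv P t1
  | Proj2 _ _ t1 => tv P t1
  end.

Notation pcons := (@vcons (fun _ => Prop) _ _).

Fixpoint fv G (f : form G) : vpred G -> Prop :=
  match f with
  | FEq t u => fun P => tv P t /\ tv P u
  | FNeq t u => fun P => tv P t /\ tv P u
  | FTop => fun _ => True
  | FBot => fun _ => True
  | FOr f1 f2 => fun P => fv f1 P /\ fv f2 P
  | FAnd f1 f2 => fun P => fv f1 P /\ fv f2 P
  | FAll T t f1 => fun P => tv P t /\ fv f1 (pcons True P)
  | FEx T t f1 => fun P => tv P t /\ fv f1 (pcons True P)
  end.

Definition av G (P : vpred G) (a : atom G) : Prop := let: Mem _ t u := a in tv P t /\ tv P u.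

Definition gv G (P : vpred G) (g : goal G) : Prop :=
  match g with
  | GIn _ t u => tv P t /\ tv P u
  | GEq _ t u => tv P t /\ tv P u
  | GSub _ t u => tv P t /\ tv P u
  end.

Lemma tv_impl G (P Q : vpred G) T (t : term G T) : (forall T x, P T x -> Q T x) -> tv P t -> tv Q t.
Proof. by move=> H; elim: t => //= A B t IH u IU [/IH ? /IU ?]. Qed.

Lemma fv_impl G (f : form G) (P Q : vpred G) : (forall T x, P T x -> Q T x) -> fv f P -> fv f Q.
Proof.
elim: f P Q => {G} /= [G t u|G t u|G|G|G f IF g IG|G f IF g IG|G T t f IF|G T t f IF] P Q H //;
  try (by case=> /(tv_impl H) ? /(tv_impl H) ?); try (by case=> /(IF _ _ H) ? /(IG _ _ H) ?);
  by case=> /(tv_impl H) ? H1; split=> //; apply: IF H1; apply: var_case.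
Qed.

Lemma av_impl G (P Q : vpred G) a : (forall T x, P T x -> Q T x) -> av P a -> av Q a.
Proof. by move=> H; case: a => T t u [/(tv_impl H) ? /(tv_impl H)]. Qed.

Lemma tv_subst G D (s : subst G D) (P : vpred D) T (t : term G T) :
  tv P (tsubst s t) <-> tv (fun T x => tv P (s T x)) t.
Proof. by elim: t => //= A B t IH u IU; rewrite IH IU. Qed.

Lemma fv_subst G (f : form G) D (s : subst G D) (P : vpred D) :
  fv (fsubst s f) P <-> fv f (fun T x => tv P (s T x)).
Proof.
have U A G' D' (s' : subst G' D') (P' : vpred D') T (x : var (A :: G') T) :
  tv (pcons True P') (up s' x) <-> pcons True (fun T x => tv P' (s' T x)) x.
  by move: T x; apply: var_case => // T x; rewrite /up /= tv_subst.
elim: f D s P => {G} /= [G t u|G t u|G|G|G f IF g IG|G f IF g IG|G T t f IF|G T t f IF] D s P;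
  rewrite ?tv_subst ?IF ?IG //;
  by split=> -[? H]; split=> //; apply: fv_impl H => T' x /U.
Qed.

Lemma av_subst G D (s : subst G D) (P : vpred D) a :
  av P (asubst s a) <-> av (fun T x => tv P (s T x)) a.
Proof. by case: a => T t u /=; rewrite !tv_subst. Qed.

Section Sem.
Variable Ur : Type.

Lemma mkenv G (v : forall T, var G T -> obj Ur T) :
  exists r : env Ur G, forall T x, lookup x r = v T x.
Proof.
elim: G v => [|A G IH] v.
  exists tt => T x; exact: (match x in var G T return match G with [::] => forall P : Prop, P | _ => True end with VZ _ _ => I | VS _ _ _ _ => I end).
have [r Hr] := IH (vtail v).
exists (v _ VZ, r); exact: var_case.
Qed.

Lemma teval_same G (r r' : env Ur G) (P : vpred G) T (t : term G T) :
  tv P t -> (forall T x, P T x -> lookup x r = lookup x r') -> teval r t = teval r' t.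
Proof.
move=> Ht H; elim: t Ht => //= [A B t IH u IU [/IH -> /IU ->]|A B t IH /IH ->|A B t IH /IH ->] //.
Qed.

Lemma holds_same G (f : form G) (r r' : env Ur G) (P : vpred G) :
  fv f P -> (forall T x, P T x -> lookup x r = lookup x r') -> holds f r <-> holds f r'.
Proof.
elim: f r r' P => {G} /= [G t u|G t u|G|G|G f IF g IG|G f IF g IG|G T t f IF|G T t f IF] r r' P //.
- by case=> Ht Hu H; rewrite (teval_same Ht H) (teval_same Hu H).
- by case=> Ht Hu H; rewrite (teval_same Ht H) (teval_same Hu H).
- by case=> Hf Hg H; rewrite (IF _ _ _ Hf H) (IG _ _ _ Hg H).
- by case=> Hf Hg H; rewrite (IF _ _ _ Hf H) (IG _ _ _ Hg H).
- case=> Ht Hf H; rewrite (teval_same Ht H).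
  have E x : holds f ((x, r) : env Ur (T :: G)) <-> holds f ((x, r') : env Ur (T :: G)).
    by apply: IF Hf _; apply: var_case.
  by split=> H1 x /H1 /E.
- case=> Ht Hf H; rewrite (teval_same Ht H).
  have E x : holds f ((x, r) : env Ur (T :: G)) <-> holds f ((x, r') : env Ur (T :: G)).
    by apply: IF Hf _; apply: var_case.
  by split=> -[x Hx /E]; exists x.
Qed.

Definition sub_ok G D (s : subst G D) (r : env Ur D) (r' : env Ur G) : Prop :=
  forall T (x : var G T), teval r (s T x) = lookup x r'.

Lemma teval_subst G D (s : subst G D) r r' T (t : term G T) :
  sub_ok s r r' -> teval r (tsubst s t) = teval r' t.
Proof. by move=> H; elim: t => //= [A B t -> u ->|A B t ->|A B t ->]. Qed.

Lemma sub_wk A G (r : env Ur G) (x : obj Ur A) : sub_ok (@wk A G) ((x, r) : env Ur (A :: G)) r.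
Proof. by []. Qed.

Lemma sub_up A G D (s : subst G D) r r' (x : obj Ur A) : sub_ok s r r' ->
  sub_ok (@up A _ _ s) ((x, r) : env Ur (A :: D)) ((x, r') : env Ur (A :: G)).
Proof.
move=> H; apply: var_case => // T y.
by rewrite /up /=  (teval_subst _ (sub_wk r x)) H.
Qed.

Lemma sub_scons A G D (s : subst G D) (t : term D A) r r' : sub_ok s r r' ->
  sub_ok (scons t s) r ((teval r t, r') : env Ur (A :: G)).
Proof. by move=> H; apply: var_case. Qed.

Lemma sub_ids G (r : env Ur G) : sub_ok (@ids G) r r.
Proof. by []. Qed.

Lemma sub_upd A G D (x : var G A) (t : term D A) (s : subst G D) r r' :
  teval r t = lookup x r' -> sub_ok s r r' -> sub_ok (upd x t s) r r'.
Proof. by move=> Ht H; apply: (@upd_ind _ _ _ _ (fun T y u => teval r u = lookup y r')). Qed.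

Lemma holds_subst G (f : form G) D (s : subst G D) r r' :
  sub_ok s r r' -> holds (fsubst s f) r <-> holds f r'.
Proof.
elim: f D s r r' => {G} /= [G t u|G t u|G|G|G f IF g IG|G f IF g IG|G T t f IF|G T t f IF] D s r r' H //;
  rewrite ?(teval_subst _ H) ?(IF _ _ _ _ H) ?(IG _ _ _ _ H) //.
- by split=> H1 x /H1 /(IF _ _ _ _ (sub_up x H)).
- by split=> -[x Hx /(IF _ _ _ _ (sub_up x H))]; exists x.
Qed.

Definition aholds G (a : atom G) (r : env Ur G) : Prop :=
  let: Mem T t u := a in (teval r u : set (obj Ur T)) (teval r t).

Definition gholds G (g : goal G) (r : env Ur G) : Prop :=
  match g with
  | GIn T t u => (teval r u : set (obj Ur T)) (teval r t)
  | GEq T t u => teval r t = teval r u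
  | GSub T t u => subset (teval r t : set (obj Ur T)) (teval r u)
  end.

Lemma aholds_subst G D (s : subst G D) a r r' : sub_ok s r r' -> aholds (asubst s a) r <-> aholds a r'.
Proof. by case: a => T t u H /=; rewrite !(teval_subst _ H). Qed.

Lemma aholds_same G (P : vpred G) a (r r' : env Ur G) :
  av P a -> (forall T x, P T x -> lookup x r = lookup x r') -> aholds a r <-> aholds a r'.
Proof. by case: a => T t u [Ht Hu] H /=; rewrite (teval_same Ht H) (teval_same Hu H). Qed.

Fixpoint alls X (P : X -> Prop) (s : seq X) : Prop := if s is x :: s' then P x /\ alls P s' else True.

Lemma allsP X (P : X -> Prop) s : alls P s <-> forall x, List.In x s -> P x.
Proof.
elim: s => [|x s IH] //=; split=> [[Hx /IH H] y [<-|/H]|H] //.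
by split; [apply: H; left|apply/IH => y Hy; apply: H; right].
Qed.

Lemma alls_map X Y (f : X -> Y) (P : Y -> Prop) s : alls P (map f s) <-> alls (fun x => P (f x)) s.
Proof. by elim: s => //= x s ->. Qed.

Lemma alls_impl X (P Q : X -> Prop) s : (forall x, P x -> Q x) -> alls P s -> alls Q s.
Proof. by move=> H; elim: s => //= x s IH [/H ? /IH]. Qed.

(** Interpolants never combine the hypotheses of both sides; values do, and there soundness
    identifies the two terms of an equality, or puts the element of a membership into its set. *)
Lemma sound G (q : sequent G) (d : deriv q) (r : env Ur G) :
  alls (fun a => aholds a r) (mems q) -> alls (fun f => holds f r) (hyps q) -> gholds (concl q) r.
Proof.
elim: d r => {G q} /=.
- move=> G Th Ga Th' Ga' g P1 P2 _ IH r /allsP H1 /allsP H2; apply: IH; apply/allsP => x Hx.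
    by apply: H1; apply: Permutation.Permutation_in Hx.
  by apply: H2; apply: Permutation.Permutation_in Hx.
- by move=> G Th Ga f T t u _ IH r H1 [H2 H3]; apply: IH.
- by move=> G Th Ga t u r [].
- move=> G Th Ga T t u _ IH1 _ IH2 r H1 H2.
  by rewrite eqEsubset; split; [exact: IH1|exact: IH2].
- move=> G Th Ga A B t u _ IH1 _ IH2 r H1 H2.
  by rewrite [LHS]surjective_pairing [RHS]surjective_pairing (IH1 r) ?(IH2 r).
- by move=> G Th Ga t u r; case: (teval r t); case: (teval r u).
- move=> G Th Ga t u _ IH r H1 H2.
  (* The eigenvariable is read as a singleton, in which membership is equality. *)
  set z : set Ur := [set teval r t]%classic.
  have W := sub_wk (A := TSet TUr) r z.
  symmetry; move: (IH ((z, r) : env Ur (TSet TUr :: G))); rewrite !(teval_subst _ W); apply.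
    split=> //.
    by apply/alls_map; apply: alls_impl H1 => a /(aholds_subst _ W).
  by apply/alls_map; apply: alls_impl H2 => a /(holds_subst _ W).
- move=> G Th Ga T t u _ IH r H1 H2 z Hz.
  have W := sub_wk (A := T) r z.
  move: (IH ((z, r) : env Ur (T :: G))); rewrite !(teval_subst _ W); apply.
    split=> //.
    by apply/alls_map; apply: alls_impl H1 => a /(aholds_subst _ W).
  by apply/alls_map; apply: alls_impl H2 => a /(holds_subst _ W).
- by move=> G Th Ga T t u v _ IH r H1 H2; rewrite -(IH r H1 H2); case: H1.
- by move=> G Th Ga T t u r _ [].
- by move=> G Th Ga f1 f2 T t u _ IH r H1 [[H2 H3] H4]; apply: IH.
- by move=> G Th Ga f1 f2 T t u _ IH1 _ IH2 r H1 [[H2|H2] H4]; [apply: IH1|apply: IH2].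
- move=> G Th Ga T t z f T' v w _ IH r H1 [H2 H3]; apply: IH => //; split=> //.
  by apply/(holds_subst _ (sub_scons t (sub_ids r))); apply: H2; case: H1.
- move=> G Th Ga T y f T' t v _ IH r H1 [[z Hz Hf] H2].
  have W := sub_wk (A := T) r z.
  move: (IH ((z, r) : env Ur (T :: G))); rewrite !(teval_subst _ W); apply.
    split=> //; by apply/alls_map; apply: alls_impl H1 => a /(aholds_subst _ W).
  by split=> //; apply/alls_map; apply: alls_impl H2 => a /(holds_subst _ W).
- move=> G Th Ga x y T v w _ IH r H1 [H2 H3].
  have W : sub_ok (upd x (Var y) (@ids G)) r r by apply: sub_upd => //; rewrite /= H2.
  move: (IH r); rewrite !(teval_subst _ W); apply.
    by apply/alls_map; apply: alls_impl H1 => a /(aholds_subst _ W).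
  by apply/alls_map; apply: alls_impl H3 => a /(holds_subst _ W).
- by move=> G Th Ga t T u v r _ [].
- move=> G A B t1 t2 Th Ga T t u _ IH r /alls_map H1 /alls_map H2.
  have W := sub_scons t1 (sub_ids r).
  have W' : sub_ok (scons (Proj1 (Pair t1 t2)) (@ids G)) r ((teval r t1, r) : env Ur (A :: G)).
    exact: (sub_scons (Proj1 (Pair t1 t2)) (sub_ids r)).
  move: (IH r); rewrite !(teval_subst _ W) !(teval_subst _ W'); apply.
    by apply/alls_map; apply: alls_impl H1 => a /(aholds_subst _ W') /(aholds_subst _ W).
  by apply/alls_map; apply: alls_impl H2 => a /(holds_subst _ W') /(holds_subst _ W).
- move=> G A B t1 t2 Th Ga T t u _ IH r /alls_map H1 /alls_map H2.
  have W := sub_scons t2 (sub_ids r).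
  have W' : sub_ok (scons (Proj2 (Pair t1 t2)) (@ids G)) r ((teval r t2, r) : env Ur (B :: G)).
    exact: (sub_scons (Proj2 (Pair t1 t2)) (sub_ids r)).
  move: (IH r); rewrite !(teval_subst _ W) !(teval_subst _ W'); apply.
    by apply/alls_map; apply: alls_impl H1 => a /(aholds_subst _ W') /(aholds_subst _ W).
  by apply/alls_map; apply: alls_impl H2 => a /(holds_subst _ W') /(holds_subst _ W).
- move=> G A B x Th Ga T t u _ IH r H1 H2.
  pose r' : env Ur (B :: A :: G) := ((lookup x r).2, ((lookup x r).1, r)).
  have W : sub_ok (upd x (Pair (Var (VS VZ)) (Var VZ)) (fun C y => Var (VS (VS y)) : term (B :: A :: G) C)) r' r.
    by apply: sub_upd => //=; rewrite -surjective_pairing.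
  move: (IH r'); rewrite !(teval_subst _ W); apply.
    by apply/alls_map; apply: alls_impl H1 => a /(aholds_subst _ W).
  by apply/alls_map; apply: alls_impl H2 => a /(holds_subst _ W).
Qed.
End Sem.

(** * Sides and common variables *)

(* Levels, as opposed to the indices of [enc_nrc], do not change when the NRC
   context is extended by a binder. *)
Fixpoint rlev C T (t : term C T) : tr :=
  match t with
  | Var _ x => node 0 [:: node (size C - (var_index x).+1) [::]]
  | Tt => node 1 [::]
  | Pair _ _ t1 t2 => node 2 [:: rlev t1; rlev t2]
  | Proj1 _ _ t1 => node 3 [:: rlev t1]
  | Proj2 _ _ t1 => node 4 [:: rlev t1]
  end.

Lemma rlev_wk A C T (t : term C T) : rlev (wkt A t) = rlev t.
Proof. by elim: t => //= [A' B t -> u ->|A' B t ->|A' B t ->]. Qed.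

Inductive kind (C : ctx) (T : ty) := KS of bool | KC of term C T.
Arguments KS {C T} _.
Notation kmap G C := (forall T, var G T -> kind C T).
Notation kcons := (@vcons (kind _) _ _).

Definition rk C T (k : kind C T) : tr := match k with KS b => tb b | KC e => Nd Lf (rlev e) end.

Fixpoint rK G C : kmap G C -> seq tr :=
  match G with
  | [::] => fun _ => [::]
  | A :: G' => fun K => rk (K _ VZ) :: rK (fun T x => K T (VS x))
  end.
Notation rKt K := (ltr (rK K) Lf).

Lemma size_rK G C (K : kmap G C) : size (rK K) = size G.
Proof. by elim: G K => //= A G IH K; rewrite IH. Qed.

Lemma nth_rK G C (K : kmap G C) T (x : var G T) : nth Lf (rK K) (var_index x) = rk (K T x).
Proof. by elim: x K => //= G' T' A x IH K; rewrite IH. Qed.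

Lemma rK_ext G C C' (K : kmap G C) (K' : kmap G C') :
  (forall T x, rk (K T x) = rk (K' T x)) -> rK K = rK K'.
Proof. by elim: G K K' => //= A G IH K K' H; rewrite H; congr (_ :: _); apply: IH. Qed.

Lemma var_index_lt G T (x : var G T) : var_index x < size G.
Proof. by elim: x. Qed.

Lemma rK_vupd G C (K : kmap G C) A (x : var G A) (k : kind C A) :
  rK (vupd x k K) = take (var_index x) (rK K) ++ rk k :: drop (var_index x).+1 (rK K).
Proof.
elim: x K k => {G A} [G A|G T A x IH] K k /=; first by rewrite drop0.
by congr (_ :: _); rewrite -IH; apply: rK_ext.
Qed.

Definition kwk A G C (K : kmap G C) : kmap G (A :: C) :=
  fun T x => match K T x with KS b => KS b | KC e => KC (wkt A e) end.

Lemma rK_kwk A G C (K : kmap G C) : rK (@kwk A G C K) = rK K.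
Proof. by apply: rK_ext => T x; rewrite /kwk; case: (K T x) => //= e; rewrite rlev_wk. Qed.

Definition ksetif G C A (x : var G A) (e : term C A) (K : kmap G C) : kmap G C :=
  match K _ x with KC _ => K | KS _ => vupd x (KC e) K end.

Lemma isN_cdr_rk C T (k : kind C T) : isN (cdr (rk k)) = if k is KC _ then true else false.
Proof. by case: k => [[]|e] //=; case: e. Qed.

Lemma setif_E G C A (x : var G A) (e : term C A) (K : kmap G C) :
  setif (Nd (rKt K) (Nd (tn (var_index x)) (rlev e))) = rKt (ksetif x e K).
Proof.
rewrite /setif /tif [car _]/= [cdr (Nd _ _)]/= tnth_E nth_rK isN_cdr_rk /ksetif.
case E: (K _ x) => [b|e'] //.
by rewrite [cdr _]/= tset_E ?rK_vupd // size_rK var_index_lt.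
Qed.

Fixpoint kasg G C T (t : term G T) : term C T -> kmap G C -> kmap G C :=
  match t with
  | Var _ x => fun e K => ksetif x e K
  | Pair _ _ t1 t2 => fun e K => kasg t2 (Proj2 e) (kasg t1 (Proj1 e) K)
  | _ => fun _ K => K
  end.

Lemma assign_E G C T (t : term G T) (e : term C T) (K : kmap G C) :
  assign (Nd (rKt K) (Nd (rawterm t) (rlev e))) = rKt (kasg t e K).
Proof.
have stab n K' : iter n asg_step (Nd Lf K') = Nd Lf K' by elim: n => //= n ->.
have H : exists2 k, k <= tsz (rawterm t) & forall wl,
    iter k asg_step (Nd (Nd (Nd (rawterm t) (rlev e)) wl) (rKt K)) = Nd wl (rKt (kasg t e K)).
  elim: t e K {stab} => /= [T' x||A B t IHt u IHu|A B t _|A B t _] e K; try by exists 1 => //; lia.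
  - exists 1 => [|wl]; first by lia.
    by rewrite /= -setif_E.
  - have [k1 L1 E1] := IHt (Proj1 e) K; have [k2 L2 E2] := IHu (Proj2 e) (kasg t (Proj1 e) K).
    exists (k2 + k1).+1 => [|wl]; first by lia.
    rewrite iterSr iterD -E2 -E1; congr (iter _ _ (iter _ _ _)).
case: H => k Hk E; rewrite /assign /= llen_tn -(subnK Hk) iterD E stab.
by [].
Qed.

(** [K'] is obtained from [K] by making some private variables of side [s] common. *)
Definition kincl (s : bool) G C (K K' : kmap G C) : Prop := forall T (x : var G T),
  match K T x, K' T x with
  | KC e, KC e' => e = e'
  | KC _, KS _ => False
  | KS b, KC _ => b = s
  | KS b, KS b' => b = b'
  end.

(** The variables that side [b] may use: its private ones and the common ones. [com] selects the
    common ones. *)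
Definition clean (b : bool) G C (K : kmap G C) : vpred G :=
  fun T x => match K T x with KS b' => b' = b | KC _ => True end.
Definition com G C (K : kmap G C) : vpred G :=
  fun T x => match K T x with KS b' => False | KC _ => True end.

Lemma kincl_refl s G C (K : kmap G C) : kincl s K K.
Proof. by move=> T x; case: (K T x). Qed.

Lemma kincl_trans s G C (K K' K'' : kmap G C) : kincl s K K' -> kincl s K' K'' -> kincl s K K''.
Proof.
move=> H1 H2 T x; move: (H1 T x) (H2 T x).
by case: (K T x) => [b|e]; case: (K' T x) => [b'|e'] //; case: (K'' T x) => [b''|e''] //; congruence.
Qed.

Lemma kincl_clean s b G C (K K' : kmap G C) T (x : var G T) :
  kincl s K K' -> clean b K x -> clean b K' x.
Proof.
move=> H; move: (H T x); rewrite /clean.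
by case: (K T x) => [b1|e]; case: (K' T x) => [b'|e'] // ->.
Qed.

Lemma ksetif_incl s G C A (x : var G A) (e : term C A) (K : kmap G C) :
  clean s K x -> kincl s K (ksetif x e K).
Proof.
rewrite /clean /ksetif; case E: (K A x) => [b|e'] H; last exact: kincl_refl.
apply: (@vupd_ind _ _ _ _ (fun T y k => match K T y, k with
  | KC e, KC e' => e = e' | KC _, KS _ => False | KS b, KC _ => b = s | KS b, KS b' => b = b' end)).
  by rewrite E.
exact: kincl_refl.
Qed.

Lemma kasg_incl s G C T (t : term G T) (e : term C T) (K : kmap G C) :
  tv (clean s K) t -> kincl s K (kasg t e K).
Proof.
elim: t e K => /= [T' x||A B t IHt u IHu|A B t _|A B t _] e K;
  try by move=> _; exact: kincl_refl.
- exact: ksetif_incl.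
- case=> Ht Hu; have H := IHt (Proj1 e) K Ht; apply: (kincl_trans H); apply: IHu.
  by apply: tv_impl Hu => T' x; exact: (kincl_clean H).
Qed.

Fixpoint tup G T (t : term G T) : bool :=
  match t with
  | Var _ _ | Tt => true
  | Pair _ _ t1 t2 => tup t1 && tup t2
  | _ => false
  end.

Lemma kincl_com s G C (K K' : kmap G C) T (x : var G T) :
  kincl s K K' -> com K x -> com K' x.
Proof.
by move=> H; move: (H T x); rewrite /com; case: (K T x) => [b1|e]; case: (K' T x).
Qed.

Lemma ksetif_com G C A (x : var G A) (e : term C A) (K : kmap G C) : com (ksetif x e K) x.
Proof. by rewrite /com /ksetif; case E: (K A x) => [b|e']; rewrite ?vupd_same ?E. Qed.

Lemma kasg_com s G C T (t : term G T) (e : term C T) (K : kmap G C) :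
  tup t -> tv (clean s K) t -> tv (com (kasg t e K)) t.
Proof.
elim: t e K => //= [T' x|A B t IHt u IHu] e K.
  by move=> _ _; exact: ksetif_com.
case/andP=> Tt Tu [Ht Hu].
have I1 := kasg_incl (Proj1 e) Ht.
have Hu' : tv (clean s (kasg t (Proj1 e) K)) u by apply: tv_impl Hu => T' x; exact: (kincl_clean I1).
split; last exact: IHu.
by apply: tv_impl (IHt _ _ Tt Ht) => T' x; exact: (kincl_com (kasg_incl _ Hu')).
Qed.

Section Agree.
Variable Ur : Type.

Definition agree G C (K : kmap G C) (r : env Ur G) (c : env Ur C) : Prop :=
  forall T x, match K T x with KC e => lookup x r = teval c e | KS _ => True end.

Lemma agree_kwk A G C (K : kmap G C) r c (y : obj Ur A) :
  agree (@kwk A G C K) r ((y, c) : env Ur (A :: C)) <-> agree K r c.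
Proof.
split=> H T x; move: (H T x); rewrite /kwk; case: (K T x) => // e;
  by rewrite (teval_subst _ (sub_wk c y)).
Qed.

Lemma agree_ksetif G C A (x : var G A) (e : term C A) (K : kmap G C) r c :
  agree K r c -> lookup x r = teval c e -> agree (ksetif x e K) r c.
Proof.
rewrite /ksetif; case: (K A x) => // b H E.
by apply: (@vupd_ind _ _ _ _ (fun T y k => match k with KC e => lookup y r = teval c e | KS _ => True end)).
Qed.

Lemma agree_kasg G C T (t : term G T) (e : term C T) (K : kmap G C) r c :
  agree K r c -> teval r t = teval c e -> agree (kasg t e K) r c.
Proof.
elim: t e K => //= [T' x|A B t IHt u IHu] e K.
  exact: agree_ksetif.
by move=> H E; apply: IHu; [apply: IHt|]; rewrite //= -E.
Qed.

(* Interpolation glues a left and a right environment along the common part;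
   here [r] is modified on the side [s] only. *)
Lemma override s G C (K K' : kmap G C) (r : env Ur G) c : kincl s K K' -> agree K r c ->
  exists2 r' : env Ur G, agree K' r' c & forall T x, clean (~~ s) K x -> lookup x r' = lookup x (G := G) (T := T) r.
Proof.
move=> HI HA.
have [r' Hr'] := mkenv (fun T (x : var G T) => match K' T x with KC e => teval c e | KS _ => lookup x r end).
exists r' => T x; rewrite ?Hr'; first by case: (K' T x).
move: (HI T x) (HA T x); rewrite /clean; case: (K T x) => [b|e]; case: (K' T x) => [b'|e'] //.
  by move=> -> _; case: (s).
by move=> -> ->.
Qed.
End Agree.

Definition kbound G C (K : kmap G C) (w : nat) := forall T x, tsz (rk (K T x)) <= w.

(** 12 is the number of nodes that [Proj2] adds to a raw term, the larger of the two projections;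
    each level of a tuple adds one projection. *)
Lemma kbound_kasg G C T (t : term G T) (e : term C T) (K : kmap G C) w :
  kbound K w -> tsz (rlev e) + 12 * tsz (rawterm t) + 2 <= w -> kbound (kasg t e K) w.
Proof.
elim: t e K => //= [T' x|A B t IHt u IHu] e K HK Hw.
  rewrite /ksetif; case: (K T' x) => [b|] //.
  by apply: (@vupd_ind _ _ _ _ (fun T y k => tsz (rk k) <= w)) => //=; lia.
by apply: IHu => /=; [apply: IHt => //=; lia|lia].
Qed.

Lemma kbound_size G C (K : kmap G C) w : kbound K w -> tsz (rKt K) <= size G * w.+1 + 1.
Proof.
elim: G K => //= A G IH K H.
have := IH (fun T x => K T (VS x)) (fun T x => H T (VS x)); have := H _ (@VZ G A).
by rewrite /=; nia.
Qed.

Lemma tsz_rlev_pos C T (e : term C T) : 3 <= tsz (rlev e).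
Proof. by case: e => /=; intros; lia. Qed.

Fixpoint nrc_of get C T (t : term C T) : nrc get C T :=
  match t with
  | Var _ x => NVar get x
  | Tt => NUnit get C
  | Pair _ _ t1 t2 => NPair (nrc_of get t1) (nrc_of get t2)
  | Proj1 _ _ t1 => NProj1 (nrc_of get t1)
  | Proj2 _ _ t1 => NProj2 (nrc_of get t1)
  end.

(** A task holds one entry of size at most [B] for each of at most [B] variables, whence the square;
    the linear part covers the derivation, the tags and the numbers. *)
Definition TB B := B * B + 20 * B + 300.

Lemma TBge B : B * B + 20 * B + 300 <= TB B /\ 20 * B + 300 <= TB B.
Proof. by rewrite /TB; nia. Qed.
Opaque TB.

Ltac sz := first [lia | by rewrite /= ?tsz_tn; lia | by rewrite ?tsz_tn; lia].

(** * Emission of numbers, terms and types *)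

Section Emit.
Variables (get : bool) (B : nat).
Let TBge2 : 20 * B + 300 <= TB B := (TBge B).2.

Lemma emits_eq m ts w w' : emits (TB B) m ts w -> w = w' -> emits (TB B) m ts w'.
Proof. by move=> H <-. Qed.

Lemma emits_nat k : k <= B -> emits (TB B) (3 * k + 5) [:: tNat (tn k)] (enc_nat k).
Proof.
elim: k => [|k IH] Hk.
  apply: (@emits_le _ 3) => //; apply: (@emits_ex _ _ 0 _ [:: tE [:: false]]) => //=; first by rewrite /=; lia.
  by apply: (@emits_text _ [:: false]); rewrite /=; lia.
apply: (@emits_le _ (2 + (3 * k + 5)).+1); first by lia.
apply: (@emits_ex _ _ 0 _ [:: tE [:: true]; tNat (tn k)]) => //.
  by rewrite /= tsz_tn; lia.
apply: (@emits_cons _ _ _ _ _ [:: true]); last by apply: IH; lia.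
by apply: (@emits_text _ [:: true]); rewrite /=; lia.
Qed.

Lemma emits_subn n k : n <= B -> k < n -> emits (TB B) (3 * n + 10) [:: tSub (tn n) (tn k)] (enc_nat (n - k.+1)).
Proof.
elim: n k => // n IH [|k] Hn Hk.
  apply: (@emits_le _ (3 * n + 5).+1); first by lia.
  apply: (@emits_ex _ _ 5 _ [:: tNat (tn n)]) => //; first by rewrite /= tsz_tn; lia.
  by rewrite subSS subn0; apply: emits_nat; lia.
apply: (@emits_le _ (3 * n + 10).+1); first by lia.
apply: (@emits_ex _ _ 5 _ [:: tSub (tn n) (tn k)]) => //.
  by rewrite /= !tsz_tn; lia.
by rewrite subSS; apply: IH; lia.
Qed.

Lemma emits_tms1 t K n m w : tsz t + tsz K + tsz n + 20 <= 3 * B + tsz K ->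
  tsz K + 10 * B + 200 <= TB B -> emits (TB B) m [:: tTm t K n] w ->
  emits (TB B) (m + 2) [:: tTms (Nd t Lf) K n] w.
Proof.
move=> H1 H2 H; apply: (@emits_le _ (m + 1).+1); first by lia.
apply: (@emits_ex _ _ 4 _ [:: tTm t K n; tTms Lf K n]) => //; first by rewrite /=; lia.
rewrite -[w]cats0; apply: emits_cons => //.
apply: (@emits_ex _ _ 4 _ [::]) => //; first by rewrite /=; lia.
exact: emits_nil.
Qed.

Lemma emits_tms2 t u K n m1 m2 w1 w2 : tsz t + tsz u + tsz n + 20 <= 3 * B ->
  tsz K + 10 * B + 200 <= TB B -> emits (TB B) m1 [:: tTm t K n] w1 ->
  emits (TB B) m2 [:: tTm u K n] w2 ->
  emits (TB B) (m1 + m2 + 3) [:: tTms (Nd t (Nd u Lf)) K n] (w1 ++ w2).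
Proof.
move=> H1 H2 Ht Hu; apply: (@emits_le _ (m1 + (m2 + 2)).+1); first by lia.
apply: (@emits_ex _ _ 4 _ [:: tTm t K n; tTms (Nd u Lf) K n]) => //; first by rewrite /=; lia.
by apply: emits_cons => //; apply: emits_tms1 => //; lia.
Qed.

Lemma emits_tmnode k l K n m w : 0 < k <= 4 -> tsz l + tsz n + 20 <= 3 * B ->
  tsz K + 10 * B + 200 <= TB B -> emits (TB B) m [:: tTms l K n] w ->
  emits (TB B) (m + 20) [:: tTm (Nd (tn k) l) K n] (enc_nat k ++ w).
Proof.
move=> /andP [k0 k4] H1 H2 H; apply: (@emits_le _ ((3 * k + 5) + m).+1); first by lia.
apply: (@emits_ex _ _ 3 _ [:: tNat (tn k); tTms l K n]).
- by rewrite /= tsz_tn; lia.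
- by case: k k0 {k4} => // k.
- by apply: emits_cons => //; apply: emits_nat; lia.
Qed.

Lemma emits_lev C T (e : term C T) : 2 * size C + 20 <= B -> tsz (rlev e) + 20 <= B ->
  emits (TB B) ((3 * size C + 40) * tsz (rlev e)) [:: tTm (rlev e) Lf (tn (size C))] (enc_nrc (nrc_of get e)).
Proof.
have [H0 H1] := TBge B.
move=> HC; elim: e => [T' x|Hs|A A' t IHt u IHu Hs|A A' t IHt Hs|A A' t IHt Hs].
- have Hx := var_index_lt x => Hs.
  rewrite [rlev _]/=; set k := size C - _; have Ek : var_index x = size C - k.+1 by rewrite /k; lia.
  apply: (@emits_le _ (2 + (3 * size C + 10)).+1); first by rewrite /=; nia.
  apply: (@emits_ex _ _ 3 _ [:: tE [:: false]; tSub (tn (size C)) (tn k)]) => //.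
    by rewrite /= !tsz_tn; rewrite /= tsz_tn -/k in Hs; lia.
  rewrite /= /enc_var Ek; apply: (@emits_cons _ _ _ _ _ [:: false]).
    by apply: (@emits_text _ [:: false]); rewrite /=; lia.
  by apply: emits_subn; rewrite /k; lia.
- rewrite /= -[enc_nat 1]cats0; apply: (@emits_le _ (1 + 20)); first by nia.
  apply: (@emits_tmnode 1 (ltr [::] Lf)) => //; try sz.
  apply: (@emits_ex _ _ 4 _ [::]) => //; last exact: emits_nil.
  by rewrite /= tsz_tn; lia.
- rewrite /= in Hs; have Pt := tsz_rlev_pos t; have Pu := tsz_rlev_pos u.
  apply: (@emits_le _ ((3 * size C + 40) * tsz (rlev t) + (3 * size C + 40) * tsz (rlev u) + 3 + 20)).
    by rewrite /=; nia.
  apply: (@emits_tmnode 2 (ltr [:: rlev t; rlev u] Lf)) => //; try sz.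
  by apply: emits_tms2; [sz|sz|apply: IHt; lia|apply: IHu; lia].
- rewrite /= in Hs; have Pt := tsz_rlev_pos t.
  apply: (@emits_le _ ((3 * size C + 40) * tsz (rlev t) + 2 + 20)); first by rewrite /=; nia.
  apply: (@emits_tmnode 3 (ltr [:: rlev t] Lf)) => //; try sz.
  by apply: emits_tms1; [sz|sz|apply: IHt; lia].
- rewrite /= in Hs; have Pt := tsz_rlev_pos t.
  apply: (@emits_le _ ((3 * size C + 40) * tsz (rlev t) + 2 + 20)); first by rewrite /=; nia.
  apply: (@emits_tmnode 4 (ltr [:: rlev t] Lf)) => //; try sz.
  by apply: emits_tms1; [sz|sz|apply: IHt; lia].
Qed.

(** A variable of a term is expanded to its expression, in at most [(3 * B + 40) * B] steps by
    [emits_lev]; the other 40 pay for the tasks of one node. *)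
Definition Q1 := (3 * B + 40) * B + 40.

Lemma emits_tm G C (K : kmap G C) T (t : term G T) :
  kbound K B -> tsz (rKt K) + 10 * B + 200 <= TB B ->
  2 * size C + 20 <= B -> (forall T x, tsz (rk (K T x)) + 20 <= B) -> tsz (rawterm t) + 20 <= B ->
  tv (com K) t ->
  exists e : nrc get C T,
    (forall Ur dflt r c, agree (Ur := Ur) K r c -> neval dflt e c = teval r t) /\
    emits (TB B) (Q1 * tsz (rawterm t)) [:: tTm (rawterm t) (rKt K) (tn (size C))] (enc_nrc e).
Proof.
have [H0 H1] := TBge B.
move=> HK Hk HC HK'; elim: t => [T' x|Hs|A A' t IHt u IHu Hs|A A' t IHt Hs|A A' t IHt Hs].
- move=> Hs; rewrite /= /com; case E: (K T' x) => [//|e] _.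
  exists (nrc_of get e); split.
    move=> Ur dflt r c /(_ _ x); rewrite E => /= ->.
    by elim: e {E} => //= [A A' t -> u ->|A A' t ->|A A' t ->].
  have He := HK' _ x; rewrite E /= in He.
  apply: (@emits_le _ ((3 * size C + 40) * tsz (rlev e)).+1); first by rewrite /Q1; nia.
  apply: (@emits_ex _ _ 3 _ [:: tTm (rlev e) Lf (tn (size C))]) => //.
  + by move: Hs; rewrite /= !tsz_tn; lia.
  + rewrite /ex /= /x_tm /tif /=.
    have -> : isN (rKt K) by move: (var_index_lt x); rewrite -(size_rK K); case: (rK K).
    by rewrite tnth_E nth_rK E.
  + by apply: emits_lev; lia.
- rewrite /= => _; exists (NUnit get C); split=> //.
  rewrite -[enc_nrc _]cats0; apply: (@emits_le _ (1 + 20)); first by rewrite /Q1; nia.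
  apply: (@emits_tmnode 1 (ltr [::] Lf)) => //; try sz.
  apply: (@emits_ex _ _ 4 _ [::]) => //; last exact: emits_nil.
  by rewrite /= tsz_tn; lia.
- rewrite /= in Hs => -[Ct Cu].
  have [|et [St Et]] := IHt _ Ct; first by lia.
  have [|eu [Su Eu]] := IHu _ Cu; first by lia.
  exists (NPair et eu); split.
    by move=> Ur dflt r c Ha /=; rewrite (St _ _ _ _ Ha) (Su _ _ _ _ Ha).
  apply: (@emits_le _ (Q1 * tsz (rawterm t) + Q1 * tsz (rawterm u) + 3 + 20)).
    by rewrite /= /Q1; nia.
  apply: (@emits_tmnode 2 (ltr [:: rawterm t; rawterm u] Lf)) => //; try sz.
  by apply: emits_tms2 => //; try sz.
- rewrite /= in Hs => Ct.
  have [|et [St Et]] := IHt _ Ct; first by lia.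
  exists (NProj1 et); split; first by move=> Ur dflt r c Ha /=; rewrite (St _ _ _ _ Ha).
  apply: (@emits_le _ (Q1 * tsz (rawterm t) + 2 + 20)); first by rewrite /= /Q1; nia.
  apply: (@emits_tmnode 3 (ltr [:: rawterm t] Lf)) => //; try sz.
  by apply: emits_tms1 => //; try sz.
- rewrite /= in Hs => Ct.
  have [|et [St Et]] := IHt _ Ct; first by lia.
  exists (NProj2 et); split; first by move=> Ur dflt r c Ha /=; rewrite (St _ _ _ _ Ha).
  apply: (@emits_le _ (Q1 * tsz (rawterm t) + 2 + 20)); first by rewrite /= /Q1; nia.
  apply: (@emits_tmnode 4 (ltr [:: rawterm t] Lf)) => //; try sz.
  by apply: emits_tms1 => //; try sz.
Qed.

Lemma emits_objs2 a b m1 m2 w1 w2 : tsz a + tsz b + 20 <= 2 * B ->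
  emits (TB B) m1 [:: tObj a] w1 -> emits (TB B) m2 [:: tObj b] w2 ->
  emits (TB B) (m1 + m2 + 3) [:: tObjs (Nd a (Nd b Lf))] (w1 ++ w2).
Proof.
move=> H1 Ha Hb; apply: (@emits_le _ (m1 + (m2 + 1).+1).+1); first by lia.
apply: (@emits_ex _ _ 2 _ [:: tObj a; tObjs (Nd b Lf)]) => //; first by rewrite /=; lia.
apply: emits_cons => //.
apply: (@emits_ex _ _ 2 _ [:: tObj b; tObjs Lf]) => //; first by rewrite /=; lia.
rewrite -[w2]cats0; apply: emits_cons => //.
by apply: (@emits_ex _ _ 2 _ [::]) => //; [rewrite /=; lia|exact: emits_nil].
Qed.

Lemma emits_objs1 a m1 w1 : tsz a + 20 <= 2 * B ->
  emits (TB B) m1 [:: tObj a] w1 -> emits (TB B) (m1 + 2) [:: tObjs (Nd a Lf)] w1.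
Proof.
move=> H1 Ha; apply: (@emits_le _ (m1 + 1).+1); first by lia.
apply: (@emits_ex _ _ 2 _ [:: tObj a; tObjs Lf]) => //; first by rewrite /=; lia.
rewrite -[w1]cats0; apply: emits_cons => //.
by apply: (@emits_ex _ _ 2 _ [::]) => //; [rewrite /=; lia|exact: emits_nil].
Qed.

Lemma emits_obj k l m w : k <= 3 -> tsz l + 20 <= 2 * B ->
  emits (TB B) m [:: tObjs l] w ->
  emits (TB B) (m + 20) [:: tObj (Nd (tn k) l)] (enc_nat k ++ w).
Proof.
move=> k3 H1 H; apply: (@emits_le _ ((3 * k + 5) + m).+1); first by lia.
apply: (@emits_ex _ _ 1 _ [:: tNat (tn k); tObjs l]) => //.
  by rewrite /= tsz_tn; lia.
by apply: emits_cons => //; apply: emits_nat; lia.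
Qed.

Lemma emits_ty T : tsz (rawty T) + 20 <= B ->
  emits (TB B) (30 * tsz (rawty T)) [:: tObj (rawty T)] (enc_ty T).
Proof.
elim: T => [|A IA A' IB||A IA] Hs; rewrite /= in Hs.
- rewrite -[enc_ty _]cats0; apply: (@emits_le _ (1 + 20)) => //.
  apply: (@emits_obj 0 Lf) => //; first by rewrite /=; lia.
  by apply: (@emits_ex _ _ 2 _ [::]) => //; [rewrite /=; lia|exact: emits_nil].
- apply: (@emits_le _ (30 * tsz (rawty A) + 30 * tsz (rawty A') + 3 + 20)); first by rewrite /=; lia.
  apply: (@emits_obj 1 (ltr [:: rawty A; rawty A'] Lf)) => //; first by rewrite /=; lia.
  by apply: emits_objs2; [lia|apply: IA; lia|apply: IB; lia].
- rewrite -[enc_ty _]cats0; apply: (@emits_le _ (1 + 20)) => //.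
  apply: (@emits_obj 2 Lf) => //; first by rewrite /=; lia.
  by apply: (@emits_ex _ _ 2 _ [::]) => //; [rewrite /=; lia|exact: emits_nil].
- apply: (@emits_le _ (30 * tsz (rawty A) + 2 + 20)); first by rewrite /=; lia.
  apply: (@emits_obj 3 (ltr [:: rawty A] Lf)) => //; first by rewrite /=; lia.
  by apply: emits_objs1; [lia|apply: IA; lia].
Qed.
End Emit.

(** * Interpolants and values *)

(* [J] marks the variables introduced by the rule for equality of Ur-elements:
   a membership whose left-hand side is not a tuple of variables has such a
   variable on the right, and these do not occur in the hypotheses. *)
Definition aJ G (J : vpred G) (a : atom G) : Prop :=
  let: Mem T t u := a in (tup t /\ tv (fun T x => ~ J T x) t) \/ (T = TUr /\ tv J u).

Definition rty G (g : goal G) : ty :=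
  match g with GIn T _ _ => TSet T | GEq T _ _ => T | GSub T _ _ => TSet T end.

(** In a membership it is the set that is on side [p], elsewhere the left term. Hence an inclusion
    [t \subseteq u] passes [~~ p] to its premise about membership in [u], while an equality of
    Ur-elements passes [p], its premise being about membership in the eigenvariable. *)
Definition vclean p G C (K : kmap G C) (g : goal G) : Prop :=
  match g with
  | GIn _ t u => tv (clean (~~ p) K) t /\ tv (clean p K) u
  | GEq _ t u => tv (clean p K) t /\ tv (clean (~~ p) K) u
  | GSub _ t u => tv (clean p K) t /\ tv (clean (~~ p) K) u
  end.

Definition vok Ur G (g : goal G) (r : env Ur G) : obj Ur (rty g) -> Prop :=
  match g return obj Ur (rty g) -> Prop with
  | GIn T t u => fun v => (v : set (obj Ur T)) (teval r t)
  | GEq T t u => fun v => v = teval r t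
  | GSub T t u => fun v => subset (teval r t : set (obj Ur T)) v /\
                           subset (v : set (obj Ur T)) (teval r u)
  end.

(** [P] selects the sides whose hypotheses are assumed: one of them for interpolants, both for
    values. *)
Definition sat (P : bool -> Prop) Ur G (q : sequent G) (tT tG : seq bool) (r : env Ur G) : Prop :=
  alls (fun ab => P ab.2 -> aholds ab.1 r) (zip (mems q) tT) /\
  alls (fun fb => P fb.2 -> holds fb.1 r) (zip (hyps q) tG).

Lemma bool_neq (a b : bool) : a <> b -> a = ~~ b.
Proof. by case: a; case: b. Qed.

Lemma tsz_rawlist X (f : X -> tr) s : size s <= tsz (rawlist f s).
Proof. by rewrite /rawlist /=; elim: s => //= x s IH; lia. Qed.

Lemma rawderiv_sq G (q : sequent G) (d : deriv q) : dsq (rawderiv d) = rawsequent q.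
Proof. by case: d. Qed.

Lemma tsz_deriv G (q : sequent G) (d : deriv q) : tsz (rawsequent q) + 5 <= tsz (rawderiv d).
Proof. by rewrite -(rawderiv_sq d); case: d => /=; intros; lia. Qed.

Lemma tsz_sequent G (q : sequent G) :
  size G + size (mems q) + size (hyps q) + tsz (rawgoal (concl q)) + 5 <= tsz (rawsequent q).
Proof.
have := tsz_rawlist rawty G; have := tsz_rawlist (@rawatom G) (mems q).
by have := tsz_rawlist (@rawform G) (hyps q); rewrite /=; lia.
Qed.

Lemma tsz_ltb l : tsz (ltb l) <= 4 * size l + 1.
Proof. by rewrite /ltb; elim: l => //= b l IH; case: b => /=; lia. Qed.

Lemma tsz_tb b : tsz (tb b) <= 3.
Proof. by case: b. Qed.

Lemma alls_zip X Y (f : X -> Y) (Q : Y -> bool -> Prop) s t :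
  alls (fun ab => Q ab.1 ab.2) (zip (map f s) t) <-> alls (fun ab => Q (f ab.1) ab.2) (zip s t).
Proof. by elim: s t => [|a s IH] [|b t] //=; rewrite IH. Qed.

Lemma alls_and X (P Q : X -> Prop) s : alls (fun x => P x /\ Q x) s <-> alls P s /\ alls Q s.
Proof. by elim: s => //= x s ->; tauto. Qed.

Lemma tup_subst G D (s s' : subst G D) T (t : term G T) :
  (forall T x, tup (s T x) -> tup (s' T x)) -> tup (tsubst s t) -> tup (tsubst s' t).
Proof. by move=> H; elim: t => //= A A' t IHt u IHu /andP [/IHt -> /IHu ->]. Qed.

Lemma tup_subst1 G D (s : subst G D) (P : vpred G) T (t : term G T) :
  (forall T x, P T x -> tup (s T x)) -> tv P t -> tup t -> tup (tsubst s t).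
Proof.
by move=> H; elim: t => //= [T' x /H|A A' t IHt u IHu [Pt Pu] /andP [/IHt -> // /IHu ->]].
Qed.

Lemma aJ_subst G D (s : subst G D) (J : vpred G) (J1 : vpred D) a :
  (forall T x, ~ J T x -> tup (s T x) /\ tv (fun T x => ~ J1 T x) (s T x)) ->
  (forall T x, J T x -> tv J1 (s T x)) -> aJ J a -> aJ J1 (asubst s a).
Proof.
move=> H0 H1; case: a => T t u [[Ht Hj]|[E Hu]] /=; [left|right]; split=> //.
- by apply: tup_subst1 Hj Ht => T' x /H0 [].
- by apply/tv_subst; apply: tv_impl Hj => T' x /H0 [].
- by apply/tv_subst; apply: tv_impl Hu.
Qed.

Section SubstOn.
Variables (Ur : Type) (G D : ctx) (s : subst G D) (r1 : env Ur D) (r : env Ur G) (P : vpred G).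
Hypothesis H : forall T x, @P T x -> teval r1 (s x) = lookup x r.

Lemma teval_subst_on T (t : term G T) : tv P t -> teval r1 (tsubst s t) = teval r t.
Proof.
have [r2 H2] := mkenv (fun T (x : var G T) => teval r1 (s x)).
have S : sub_ok s r1 r2 by move=> T' x; rewrite H2.
move=> Pt; rewrite (teval_subst _ S); apply: teval_same Pt _ => T' x Px.
by rewrite H2 H.
Qed.

Lemma holds_subst_on f : fv f P -> holds (fsubst s f) r1 <-> holds f r.
Proof.
have [r2 H2] := mkenv (fun T (x : var G T) => teval r1 (s x)).
have S : sub_ok s r1 r2 by move=> T' x; rewrite H2.
move=> Pf; rewrite (holds_subst _ S); apply: holds_same Pf _ => T' x Px.
by rewrite H2 H.
Qed.

Lemma aholds_subst_on a : av P a -> aholds (asubst s a) r1 <-> aholds a r.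
Proof. by case: a => T t u [Ht Hu] /=; rewrite !teval_subst_on. Qed.
End SubstOn.

(** An eigenvariable still needs a value when the hypothesis that would supply it belongs to a side
    not assumed; this is why [sem_th] and [sem_v] ask for an Ur-element. *)
Definition obj0 : forall Ur (u0 : Ur) T, obj Ur T :=
  fun Ur u0 => fix F T := match T return obj Ur T with
    | TUr => u0 | TProd A B => (F A, F B) | TUnit => tt | TSet A => set0 end.

Lemma clean_com p G C (K : kmap G C) T (t : term G T) :
  tv (clean p K) t -> tv (clean (~~ p) K) t -> tv (com K) t.
Proof.
elim: t => //= [T' x|A A' t IHt u IHu [? ?] [? ?]]; last by split; [apply: IHt|apply: IHu].
by rewrite /clean /com; case: (K T' x) => // b -> ; case: p.
Qed.

Lemma com_clean p G C (K : kmap G C) T (t : term G T) : tv (com K) t -> tv (clean p K) t.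
Proof. by apply: tv_impl => T' x; rewrite /clean /com; case: (K T' x). Qed.

Definition kproj1 C A A' (k : kind C (TProd A A')) : kind C A :=
  match k with KS b => KS b | KC e => KC (Proj1 e) end.
Definition kproj2 C A A' (k : kind C (TProd A A')) : kind C A' :=
  match k with KS b => KS b | KC e => KC (Proj2 e) end.

Lemma kpi1_E C A A' (k : kind C (TProd A A')) : kpi1 (rk k) = rk (kproj1 k).
Proof. by case: k => [[]|e] //=; rewrite /kpi1 /tif /=; case: (e). Qed.
Lemma kpi2_E C A A' (k : kind C (TProd A A')) : kpi2 (rk k) = rk (kproj2 k).
Proof. by case: k => [[]|e] //=; rewrite /kpi2 /tif /=; case: (e). Qed.

(** * The specification, and rules that emit no text of their own *)

Section Gen.
Variables (get : bool) (B : nat).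

(** [QQ] pays for a node in interpolant mode: a few pieces of fixed text, printed terms at
    [Q1 B * B] each, and a type. In value mode a node may also request an interpolant of its
    premise, at most [B * QQ], whence [RR]. *)
Definition QQ := 1000 + 10 * (Q1 B * B + 40 * B).
Definition RR := (B + 1) * QQ.
Lemma QQ_ge : 1000 + 10 * (Q1 B * B) + 400 * B <= QQ.
Proof. by rewrite /QQ; move: (Q1 B * B) => x; lia. Qed.
Lemma RR_ge : B * QQ + QQ <= RR.
Proof. by rewrite /RR; move: QQ => x; lia. Qed.
Opaque QQ RR.
Let QQ_pos : 1000 <= QQ. Proof. by have := QQ_ge; move: (Q1 B * B) => x; lia. Qed.
Let RR_pos : 1000 <= RR. Proof. by have := RR_ge; have := QQ_pos; move: (B * QQ) => x; lia. Qed.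

(* The factor 12 pays for the growth of the entries of [K] when the variables of
   a tuple become common. *)
Record inv G (q : sequent G) C (K : kmap G C) (J : vpred G) (tT tG : seq bool) (N : nat) : Prop := Inv {
  iT : size tT = size (mems q);
  iG : size tG = size (hyps q);
  iTc : alls (fun ab => av (clean ab.2 K) ab.1 /\ aJ J ab.1) (zip (mems q) tT);
  iGc : alls (fun fb => fv fb.1 (clean fb.2 K) /\ fv fb.1 (fun T x => ~ J T x)) (zip (hyps q) tG);
  iK : forall T x, tsz (rk (K T x)) + 12 * N <= B;
  iC : 2 * size C + 12 * N + 20 <= B }.

Definition tru Ur (dflt : get -> Ur) C (th : nrc get C (TSet TUnit)) (c : env Ur C) : Prop :=
  (neval dflt th c : set unit) tt.

Definition sem_th G (q : sequent G) C (K : kmap G C) tT tG p (th : nrc get C (TSet TUnit)) : Prop :=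
  forall (Ur : Type) (u0 : Ur) (dflt : get -> Ur) c r, agree K r c ->
    (sat (fun b => b = ~~ p) q tT tG r -> tru dflt th c) /\
    (sat (fun b => b = p) q tT tG r -> tru dflt th c -> gholds (concl q) r).

Definition sem_v G (q : sequent G) C (K : kmap G C) tT tG (e : nrc get C (rty (concl q))) : Prop :=
  forall (Ur : Type) (u0 : Ur) (dflt : get -> Ur) c r, agree K r c ->
    sat (fun _ => True) q tT tG r -> vok (g := concl q) r (neval dflt e c).

Definition gtask m G (q : sequent G) (d : deriv q) C (K : kmap G C) tT tG p : tr :=
  tGen m (rawderiv d) (rKt K) (ltb tT) (ltb tG) (tb p) (tn (size C)).

Definition th_at G (q : sequent G) (d : deriv q) C (K : kmap G C) tT tG p : Prop :=
  exists2 th, sem_th q K tT tG p th &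
    emits (TB B) (tsz (rawderiv d) * QQ) [:: gtask Lf d K tT tG p] (enc_nrc th).

Definition v_at G (q : sequent G) (d : deriv q) C (K : kmap G C) tT tG p : Prop :=
  exists2 e, sem_v (q := q) K tT tG e &
    emits (TB B) (tsz (rawderiv d) * RR) [:: gtask (Nd Lf Lf) d K tT tG p] (enc_nrc e).

(** Memberships and inclusions never need extraction: an equality whose value they request is at a
    set type, for which [bare_ur] is false. *)
Definition bget G (g : goal G) : Prop := if g is GEq T _ _ then bare_ur T -> get else True.

Definition th_spec G (q : sequent G) (d : deriv q) : Prop :=
  forall C (K : kmap G C) J tT tG p, inv q K J tT tG (tsz (rawderiv d)) ->
    gv (clean p K) (concl q) -> th_at d K tT tG p.

Definition v_spec G (q : sequent G) (d : deriv q) : Prop :=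
  forall C (K : kmap G C) J tT tG p, inv q K J tT tG (tsz (rawderiv d)) ->
    vclean p K (concl q) -> bget (concl q) -> v_at d K tT tG p.

Lemma gtask_size m G (q : sequent G) (d : deriv q) C (K : kmap G C) J tT tG p :
  tsz m <= 3 -> inv q K J tT tG (tsz (rawderiv d)) -> tsz (gtask m d K tT tG p) <= TB B.
Proof.
move=> Hm [H1 H2 _ _ HK HC]; have Hd := tsz_deriv d; have Hq := tsz_sequent q.
have [hB _] := TBge B.
have HK' : kbound K (B - 12 * tsz (rawderiv d)) by move=> T x; move: (HK T x); lia.
have := kbound_size HK'; have := tsz_ltb tT; have := tsz_ltb tG.
have hp : tsz (tb p) <= 3 by case: p.
have h0 : size G * (B - 12 * tsz (rawderiv d)).+1 <= B * B.
  apply: leq_mul; lia.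
rewrite /gtask /= tsz_tn; lia.
Qed.

Lemma K_size G (q : sequent G) (d : deriv q) C (K : kmap G C) J tT tG :
  inv q K J tT tG (tsz (rawderiv d)) -> tsz (rKt K) + 10 * B + 200 <= TB B.
Proof.
move=> [H1 H2 _ _ HK HC]; have Hd := tsz_deriv d; have Hq := tsz_sequent q.
have [hB _] := TBge B.
have HK' : kbound K (B - 12 * tsz (rawderiv d)) by move=> T x; move: (HK T x); lia.
have := kbound_size HK'.
have h0 : size G * (B - 12 * tsz (rawderiv d)).+1 <= B * B.
  apply: leq_mul; lia.
lia.
Qed.

Lemma emits_gen m G (q : sequent G) (d : deriv q) C (K : kmap G C) J tT tG p k ts w :
  tsz m <= 3 -> inv q K J tT tG (tsz (rawderiv d)) ->
  ex (gtask m d K tT tG p) = ltr ts Lf -> emits (TB B) k ts w ->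
  emits (TB B) k.+1 [:: gtask m d K tT tG p] w.
Proof. by move=> Hm Hi; apply: emits_ex; exact: gtask_size Hm Hi. Qed.

Lemma emits_word w : size w <= 70 -> emits (TB B) 71 [:: tE w] w.
Proof.
move=> H; have [_ h] := TBge B; apply: (@emits_le _ (size w).+1); first by [].
by apply: emits_text; lia.
Qed.

Section Same.
Variables (G1 G : ctx) (q1 : sequent G1) (q : sequent G) (d1 : deriv q1) (d : deriv q).
Variables (C : ctx) (K1 : kmap G1 C) (K : kmap G C) (J : vpred G) (tT1 tG1 tT tG : seq bool) (p : bool).
Hypothesis Hinv : inv q K J tT tG (tsz (rawderiv d)).
Hypothesis Hsz : tsz (rawderiv d1) < tsz (rawderiv d).

(** The interpolant of the premise is reused. The two transfers of environments are separate because
    each may use the hypotheses of one side only. *)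
Lemma same_th :
  ex (gtask Lf d K tT tG p) = ltr [:: gtask Lf d1 K1 tT1 tG1 p] Lf ->
  (forall (Ur : Type) (u0 : Ur) (r : env Ur G) (c : env Ur C), agree K r c ->
     sat (fun b => b = ~~ p) q tT tG r ->
     exists2 r1, agree K1 r1 c & sat (fun b => b = ~~ p) q1 tT1 tG1 r1) ->
  (forall (Ur : Type) (u0 : Ur) (r : env Ur G) (c : env Ur C), agree K r c ->
     sat (fun b => b = p) q tT tG r ->
     (forall r1 : env Ur G1, agree K1 r1 c -> sat (fun b => b = p) q1 tT1 tG1 r1 ->
        gholds (concl q1) r1) -> gholds (concl q) r) ->
  th_at d1 K1 tT1 tG1 p -> th_at d K tT tG p.
Proof.
move=> He H1 H2 [th Hth Eth]; exists th.
  move=> Ur u0 dflt c r Ha; split=> [Hs|Hs Ht].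
    by have [r1 Ha1 Hs1] := H1 _ u0 _ _ Ha Hs; exact: (Hth _ u0 dflt c r1 Ha1).1.
  by apply: (H2 _ u0 _ _ Ha Hs) => r1 Ha1 Hs1; exact: (Hth _ u0 dflt c r1 Ha1).2.
apply: (@emits_le _ (tsz (rawderiv d1) * QQ).+1); first by nia.
by apply: emits_gen Hinv He Eth.
Qed.
End Same.

Section SameIn.
Variables (G1 G : ctx) (Th1 : seq (atom G1)) (Ga1 : seq (form G1)) (Th : seq (atom G)) (Ga : seq (form G)).
Variables (T : ty) (t1 : term G1 T) (u1 : term G1 (TSet T)) (t : term G T) (u : term G (TSet T)).
Let q1 := Sequent Th1 Ga1 (GIn t1 u1).
Let q := Sequent Th Ga (GIn t u).
Variables (d1 : deriv q1) (d : deriv q).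
Variables (C : ctx) (K1 : kmap G1 C) (K : kmap G C) (J1 : vpred G1) (J : vpred G)
  (tT1 tG1 tT tG : seq bool) (p : bool).
Hypothesis Hinv : inv q K J tT tG (tsz (rawderiv d)).
Hypothesis Hsz : tsz (rawderiv d1) < tsz (rawderiv d).
Hypothesis Hinv1 : inv q1 K1 J1 tT1 tG1 (tsz (rawderiv d1)).
Hypothesis Hc : forall b, (tv (clean b K) t -> tv (clean b K1) t1) /\
   (tv (clean b K) u -> tv (clean b K1) u1).
(** [P] is everything for values, and a single side for interpolants, where the conclusion is on
    side [p]. The terms of the conclusion must keep their values only if side [p] is assumed. *)
Hypothesis Hs : forall (Ur : Type) (u0 : Ur) (P : bool -> Prop) (r : env Ur G) (c : env Ur C),
    (forall b, P b) \/ gv (clean p K) (concl q) -> agree K r c -> sat P q tT tG r ->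
    exists r1 : env Ur G1, [/\ agree K1 r1 c, sat P q1 tT1 tG1 r1 &
      P p -> teval r1 t1 = teval r t /\ teval r1 u1 = teval r u].

Lemma same_th_in : ex (gtask Lf d K tT tG p) = ltr [:: gtask Lf d1 K1 tT1 tG1 p] Lf ->
  gv (clean p K) (concl q) -> th_spec d1 -> th_at d K tT tG p.
Proof.
move=> He Hg H1; apply: (same_th Hinv Hsz He) => [Ur u0 r c Ha Hsat|Ur u0 r c Ha Hsat Hr1|].
- by have [r1 [? ? _]] := Hs u0 (or_intror Hg) Ha Hsat; exists r1.
- have [r1 [Ha1 Hs1 E]] := Hs u0 (or_intror Hg) Ha Hsat.
  by have [E1 E2] := E erefl; move: (Hr1 r1 Ha1 Hs1) => /=; rewrite E1 E2.
- by apply: H1 Hinv1 _; case: Hg => /(Hc p).1 ? /(Hc p).2.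
Qed.

Lemma same_v_in : ex (gtask (Nd Lf Lf) d K tT tG p) = ltr [:: gtask (Nd Lf Lf) d1 K1 tT1 tG1 p] Lf ->
  vclean p K (concl q) -> v_spec d1 -> v_at d K tT tG p.
Proof.
move=> He Hg H1.
have [|//|e He1 Ee] := H1 _ _ _ _ _ p Hinv1; first by case: Hg => /(Hc (~~ p)).1 ? /(Hc p).2.
exists e.
  move=> Ur u0 dflt c r Ha Hsat.
  have [r1 [Ha1 Hs1 E]] := Hs u0 (or_introl (fun _ => I)) Ha Hsat.
  by have [E1 E2] := E I; move: (He1 _ u0 dflt _ _ Ha1 Hs1) => /=; rewrite E1.
apply: (@emits_le _ (tsz (rawderiv d1) * RR).+1); first by nia.
by apply: emits_gen Hinv He Ee.
Qed.

Lemma same_at : (forall m, ex (gtask m d K tT tG p) = ltr [:: gtask m d1 K1 tT1 tG1 p] Lf) ->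
  th_spec d1 -> v_spec d1 ->
  (gv (clean p K) (concl q) -> th_at d K tT tG p) /\ (vclean p K (concl q) -> v_at d K tT tG p).
Proof. by move=> He H1 H2; split=> Hg; [apply: same_th_in|apply: same_v_in]. Qed.
End SameIn.

Lemma spec_at G Th Ga T (t : term G T) u (d : deriv (Sequent Th Ga (GIn t u))) :
  (forall C (K : kmap G C) J tT tG p, inv (Sequent Th Ga (GIn t u)) K J tT tG (tsz (rawderiv d)) ->
    (gv (clean p K) (GIn t u) -> th_at d K tT tG p) /\ (vclean p K (GIn t u) -> v_at d K tT tG p)) ->
  th_spec d /\ v_spec d.
Proof. by move=> H; split=> C K J tT tG p /H H1 Hg *; apply H1. Qed.

Lemma inv_sz G (q : sequent G) C (K : kmap G C) J tT tG N N' : N' <= N ->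
  inv q K J tT tG N -> inv q K J tT tG N'.
Proof.
by move=> H [? ? ? ? HK HC]; split=> // [T x|]; [move: (HK T x); lia|lia].
Qed.

Lemma gen_contr G Th Ga f T (t : term G T) u (d1 : deriv (Sequent Th (f :: f :: Ga) (GIn t u))) :
  th_spec d1 -> v_spec d1 -> th_spec (DContr d1) /\ v_spec (DContr d1).
Proof.
move=> H1 H2; apply: spec_at => C K J tT [|b tG] p Hi; first by have := iG Hi.
have Hsz : tsz (rawderiv d1) < tsz (rawderiv (DContr d1)) by rewrite /=; lia.
apply: (same_at (d1 := d1) (K1 := K) (J1 := J) (tT1 := tT) (tG1 := b :: b :: tG) Hi Hsz) => //.
- by have /= [? /= ? ? [? ?] ? ?] := inv_sz (ltnW Hsz) Hi; split=> //=; lia.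
- by move=> Ur u0 P r c _ Ha [Hs1 [Hs2 Hs3]]; exists r.
Qed.

Lemma inv_subst G D (s : subst G D) Th Ga g g1 C (K : kmap G C) (K1 : kmap D C) J J1 tT tG N N1 :
  inv (Sequent Th Ga g) K J tT tG N -> N1 <= N ->
  (forall b T x, clean b K (T := T) x -> tv (clean b K1) (s T x)) ->
  (forall T x, ~ J T x -> tup (s T x) /\ tv (fun T x => ~ J1 T x) (s T x)) ->
  (forall T x, J T x -> tv J1 (s T x)) ->
  (forall T x, tsz (rk (K1 T x)) + 12 * N1 <= B) ->
  inv (Sequent (map (asubst s) Th) (map (fsubst s) Ga) g1) K1 J1 tT tG N1.
Proof.
move=> [H1 H2 H3 H4 H5 H6] HN Hc Hj0 Hj1 HK; split=> //=; rewrite ?size_map //; last by lia.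
- apply/(@alls_zip _ _ _ (fun a b => av (clean b K1) a /\ aJ J1 a)); apply: alls_impl H3 => -[a b] /= [Ha Hj].
  split; first by apply/av_subst; apply: av_impl Ha => T x; apply: Hc.
  exact: aJ_subst Hj.
- apply/(@alls_zip _ _ _ (fun f b => fv f (clean b K1) /\ fv f _)); apply: alls_impl H4 => -[f b] /= [Ha Hj].
  split; first by apply/fv_subst; apply: fv_impl Ha => T x; apply: Hc.
  by apply/fv_subst; apply: fv_impl Hj => T x /Hj0 [].
Qed.

(** The environments have to correspond only on variables that an assumed side may use; the private
    variables of the other side may have been given other values. *)
Lemma sat_subst P Ur G D (s : subst G D) Th Ga g g1 C (K : kmap G C) J tT tG N (r1 : env Ur D) (r : env Ur G) :
  inv (Sequent Th Ga g) K J tT tG N ->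
  (forall b T x, P b -> clean b K x -> teval r1 (s T x) = lookup x r) ->
  sat P (Sequent Th Ga g) tT tG r ->
  sat P (Sequent (map (asubst s) Th) (map (fsubst s) Ga) g1) tT tG r1.
Proof.
move=> [_ _ H3 H4 _ _] Hs [S1 S2]; split=> /=.
- apply/(@alls_zip _ _ _ (fun a b => P b -> aholds a r1)).
  have := proj2 (alls_and _ _ _) (conj H3 S1); apply: alls_impl => -[a b] /= [[Ha _] S] Pb.
  by apply/(aholds_subst_on (r := r) _ Ha); [move=> T x; apply: Hs|exact: S].
- apply/(@alls_zip _ _ _ (fun f b => P b -> holds f r1)).
  have := proj2 (alls_and _ _ _) (conj H4 S2); apply: alls_impl => -[f b] /= [[Ha _] S] Pb.
  by apply/(holds_subst_on (r := r) _ Ha); [move=> T x; apply: Hs|exact: S].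
Qed.

Lemma gen_ex G Th Ga T (y : var G (TSet T)) f T' (t : term G T') v (d1 : deriv
    (Sequent (Mem (Var VZ) (wkt T (Var y)) :: wka T Th) (f :: wkf T Ga) (GIn (wkt T t) (wkt T v)))) :
  th_spec d1 -> v_spec d1 -> th_spec (DExL d1) /\ v_spec (DExL d1).
Proof.
move=> H1 H2; apply: spec_at => C K J tT [|b tG] p Hi; first by have := iG Hi.
have Hsz : tsz (rawderiv d1) < tsz (rawderiv (DExL d1)) by rewrite /=; lia.
have Hi0 : inv (Sequent Th Ga (GIn t v)) K J tT tG (tsz (rawderiv (DExL d1))).
  by have /= [? /= ? ? [? ?] ? ?] := Hi; split=> //=; lia.
have [Hy [Hfy Hfc]] : clean b K y /\ fv f (pcons True (clean b K)) /\ 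
   (~ J _ y /\ fv f (pcons True (fun T x => ~ J T x))) by case: Hi => _ _ _ /= [[[? ?] [? ?]] _] _ _.
have Hi1 := @inv_subst _ _ (@wk T G) _ _ _ (GIn (wkt T t) (wkt T v)) _ _ (kcons (KS b) K) _ (pcons False J)
   _ _ _ (tsz (rawderiv d1)) Hi0 (ltnW Hsz).
apply: (same_at (d1 := d1) (K1 := kcons (KS b) K) (J1 := pcons False J) (tT1 := b :: tT) (tG1 := b :: tG) Hi Hsz) => //.
- have [|||| h1 h2 h3 h4 h5 h6] := Hi1 => //.
    apply: var_case => [|T0 x]; first by rewrite [rk _]/=; have := tsz_tb b; have := iC Hi; lia.
    by have := iK Hi x; rewrite [kcons _ _ _]/=; lia.
  split=> //=; first by rewrite h1. by rewrite h2.
  + by split=> //; split=> //; left; split=> // -[].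
  + split=> //; split; first by apply: fv_impl Hfy; apply: var_case.
    by apply: fv_impl Hfc.2; apply: var_case => //= _ [].
- by move=> b'; split=> H; apply/tv_subst; exact: H.
- move=> Ur u0 P r c _ Ha [S1 [S2 S3]] /=.
  (* The witness is private to the side of the formula, so an arbitrary object serves when that side
     is not assumed. *)
  have [z Hz] : exists z : obj Ur T, P b -> (lookup y r : set (obj Ur T)) z /\ holds f ((z, r) : env Ur (T :: G)).
    have [Pb|NP] := EM (P b); last by exists (obj0 u0 T).
    by have [z Hz Hf] := S2 Pb; exists z.
  exists (z, r); split.
  + by apply: var_case.
  + have [|S4 S5] := @sat_subst P _ _ _ (@wk T G) _ _ _ (GIn (wkt T t) (wkt T v)) _ _ _ _ _ _ ((z, r) : env Ur (T :: G)) r Hi0 _ (conj S1 S3) => //.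
    by split=> /=; split=> // /Hz [].
  + by move=> _; rewrite !(teval_subst _ (sub_wk r z)).
Qed.

(** The Booleans are the two subsets of [{()}]; the connectives and the equality test are all
    obtained from difference and big union. *)
Definition ntop C : nrc get C (TSet TUnit) := NSing (NUnit get C).
Definition nand C (a b : nrc get C (TSet TUnit)) := NDiff a (NDiff (ntop C) b).
Definition nimp C (a b : nrc get C (TSet TUnit)) := NDiff (ntop C) (NDiff a b).
Definition neq C T (a b : nrc get C T) : nrc get C (TSet TUnit) :=
  NDiff (ntop C) (NBigU (NDiff (NSing a) (NSing b)) (ntop (T :: C))).

Section Truth.
Variables (Ur : Type) (dflt : get -> Ur).

Lemma tru_and C (a b : nrc get C _) c : tru dflt (nand a b) c <-> tru dflt a c /\ tru dflt b c.
Proof.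
rewrite /tru /=; split=> [[Ha Hb]|[Ha Hb]]; split=> //; last by case.
by apply: contrapT => H; apply: Hb.
Qed.

Lemma tru_imp C (a b : nrc get C _) c : tru dflt (nimp a b) c <-> (tru dflt a c -> tru dflt b c).
Proof.
rewrite /tru /=; split=> [[_ H] Ha|H]; first by apply: contrapT => Hb; apply: H.
by split=> // -[/H].
Qed.

Lemma tru_bigU C T (a : nrc get C (TSet T)) (b : nrc get (T :: C) _) c :
  tru dflt (NBigU a b) c <-> exists2 x, (neval dflt a c : set (obj Ur T)) x &
     tru dflt b ((x, c) : env Ur (T :: C)).
Proof. by rewrite /tru /=; split=> -[x]; exists x. Qed.

Lemma tru_eq C T (a b : nrc get C T) c : tru dflt (neq a b) c <-> neval dflt a c = neval dflt b c.
Proof.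
rewrite /tru /=; split=> [[_ H]|E].
  by apply: contrapT => D; apply: H; exists (neval dflt a c).
by split=> // -[x] [/= -> []].
Qed.
End Truth.

Lemma tm_at G (q : sequent G) (d : deriv q) C (K : kmap G C) J tT tG T (t : term G T) :
  inv q K J tT tG (tsz (rawderiv d)) -> tsz (rawterm t) <= tsz (rawsequent q) -> tv (com K) t ->
  exists2 e : nrc get C T,
    (forall Ur (dflt : get -> Ur) r c, agree K r c -> neval dflt e c = teval r t) &
    emits (TB B) (Q1 B * B) [:: tTm (rawterm t) (rKt K) (tn (size C))] (enc_nrc e).
Proof.
move=> Hi Ht Hc; have Hd := tsz_deriv d; have hC := iC Hi.
have [||||| e [H1 H2]] := @emits_tm get B _ _ K _ t _ _ _ _ _ Hc.
- by move=> T' x; have := iK Hi x; lia.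
- exact: K_size Hi.
- by lia.
- by move=> T' x; have := iK Hi x; lia.
- by lia.
- by exists e => //; apply: emits_le H2; apply: leq_mul => //; lia.
Qed.

Lemma gen_and G Th Ga f1 f2 T (t : term G T) u (d1 : deriv (Sequent Th (f1 :: f2 :: Ga) (GIn t u))) :
  th_spec d1 -> v_spec d1 -> th_spec (DAndL d1) /\ v_spec (DAndL d1).
Proof.
move=> H1 H2; apply: spec_at => C K J tT [|b tG] p Hi; first by have := iG Hi.
have Hsz : tsz (rawderiv d1) < tsz (rawderiv (DAndL d1)) by rewrite /=; lia.
apply: (same_at (d1 := d1) (K1 := K) (J1 := J) (tT1 := tT) (tG1 := b :: b :: tG) Hi Hsz) => //.
- by have /= [? /= ? ? [[[? ?] [? ?]] ?] ? ?] := inv_sz (ltnW Hsz) Hi; split=> //=; lia.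
- move=> Ur u0 P r c _ Ha [Hs1 [Hs2 Hs3]]; exists r; split=> //; split=> //=.
  by split=> [/Hs2 []|] //; split=> [/Hs2 []|].
Qed.

Lemma inv_beta G A Th Ga g g' (s s' : subst (A :: G) G) C (K : kmap G C) J tT tG N N' :
  (forall T x, tup (s T x) -> tup (s' T x)) ->
  (forall P T x, tv P (s T x) -> tv P (s' T x)) -> N' <= N ->
  inv (Sequent (map (asubst s) Th) (map (fsubst s) Ga) g) K J tT tG N ->
  inv (Sequent (map (asubst s') Th) (map (fsubst s') Ga) g') K J tT tG N' /\
  (forall T (t : term (A :: G) T) P, tv P (tsubst s t) -> tv P (tsubst s' t)).
Proof.
move=> Ht Hv HN [H1 H2 H3 H4 H5 H6].
have Hvt T (t : term (A :: G) T) P : tv P (tsubst s t) -> tv P (tsubst s' t).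
  by move/tv_subst => H; apply/tv_subst; apply: tv_impl H => T' x; apply: Hv.
split=> //; split=> //=; rewrite ?size_map; try by rewrite ?size_map in H1 H2.
- apply/(@alls_zip _ _ _ (fun a b => av (clean b K) a /\ aJ J a)).
  move/(@alls_zip _ _ _ (fun a b => av (clean b K) a /\ aJ J a)): H3; apply: alls_impl => -[[T t u] b] /=.
  move=> [[h1 h2] h3]; split; first by split; apply: Hvt.
  by case: h3 => [[h3 h4]|[h3 h4]]; [left|right]; split=> //; try exact: Hvt; exact: tup_subst h3.
- apply/(@alls_zip _ _ _ (fun f b => fv f (clean b K) /\ fv f _)).
  move/(@alls_zip _ _ _ (fun f b => fv f (clean b K) /\ fv f _)): H4; apply: alls_impl => -[f b] /= [h1 h2].
  by split; apply/fv_subst; [move/fv_subst: h1|move/fv_subst: h2]; apply: fv_impl => T x; apply: Hv.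
- by move=> T x; move: (H5 T x); lia.
- by lia.
Qed.

Lemma sat_beta P Ur G A Th Ga (t t' : term G A) g g' tT tG (r : env Ur G) : teval r t = teval r t' ->
  let s := scons t (@ids G) in let s' := scons t' (@ids G) in
  sat P (Sequent (map (asubst s) Th) (map (fsubst s) Ga) g) tT tG r ->
  sat P (Sequent (map (asubst s') Th) (map (fsubst s') Ga) g') tT tG r.
Proof.
move=> E s s' [S1 S2].
have W := sub_scons t (sub_ids r); have W' := sub_scons t' (sub_ids r); rewrite -E in W'.
split=> /=.
  apply/(@alls_zip _ _ _ (fun a b => P b -> aholds a r)).
  move/(@alls_zip _ _ _ (fun a b => P b -> aholds a r)): S1; apply: alls_impl => -[a b] /= H /H.
  by move/(aholds_subst _ W)/(aholds_subst _ W').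
apply/(@alls_zip _ _ _ (fun a b => P b -> holds a r)).
move/(@alls_zip _ _ _ (fun a b => P b -> holds a r)): S2; apply: alls_impl => -[a b] /= H /H.
by move/(holds_subst _ W)/(holds_subst _ W').
Qed.

Lemma gen_beta1 G A A' (t1 : term G A) (t2 : term G A') Th Ga T (t : term (A :: G) T) u
    (d1 : deriv (ssubst (scons t1 (@ids G)) (Sequent Th Ga (GIn t u)))) :
  th_spec d1 -> v_spec d1 -> th_spec (DProdBeta1 t2 d1) /\ v_spec (DProdBeta1 t2 d1).
Proof.
move=> H1 H2; apply: spec_at => C K J tT tG p Hi.
have Hsz : tsz (rawderiv d1) < tsz (rawderiv (DProdBeta1 t2 d1)) by rewrite /=; lia.
have [|| Hi1 Hv] := @inv_beta _ _ _ _ _ (gsubst (scons t1 (@ids G)) (GIn t u)) _ (scons t1 (@ids G)) _ _ _ _ _ _ _ _ _ (ltnW Hsz) Hi.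
- exact: var_case.
- by move=> P; apply: var_case => //= -[].
apply: (same_at (d1 := d1) (K1 := K) (J1 := J) (tT1 := tT) (tG1 := tG) Hi Hsz) => //.
- by move=> b; split; apply: Hv.
- move=> Ur u0 P r c _ Ha Hs; exists r; split=> //; first exact: sat_beta Hs.
  have W := sub_scons t1 (sub_ids r); have W' := sub_scons (Proj1 (Pair t1 t2)) (sub_ids r).
  by rewrite !(teval_subst _ W) !(teval_subst _ W').
Qed.

Lemma gen_beta2 G A A' (t1 : term G A) (t2 : term G A') Th Ga T (t : term (A' :: G) T) u
    (d1 : deriv (ssubst (scons t2 (@ids G)) (Sequent Th Ga (GIn t u)))) :
  th_spec d1 -> v_spec d1 -> th_spec (DProdBeta2 t1 d1) /\ v_spec (DProdBeta2 t1 d1).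
Proof.
move=> H1 H2; apply: spec_at => C K J tT tG p Hi.
have Hsz : tsz (rawderiv d1) < tsz (rawderiv (DProdBeta2 t1 d1)) by rewrite /=; lia.
have [|| Hi1 Hv] := @inv_beta _ _ _ _ _ (gsubst (scons t2 (@ids G)) (GIn t u)) _ (scons t2 (@ids G)) _ _ _ _ _ _ _ _ _ (ltnW Hsz) Hi.
- exact: var_case.
- by move=> P; apply: var_case => //= -[].
apply: (same_at (d1 := d1) (K1 := K) (J1 := J) (tT1 := tT) (tG1 := tG) Hi Hsz) => //.
- by move=> b; split; apply: Hv.
- move=> Ur u0 P r c _ Ha Hs; exists r; split=> //; first exact: sat_beta Hs.
  have W := sub_scons t2 (sub_ids r); have W' := sub_scons (Proj2 (Pair t1 t2)) (sub_ids r).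
  by rewrite !(teval_subst _ W) !(teval_subst _ W').
Qed.

Lemma gen_eta G A A' (x : var G (TProd A A')) Th Ga T (t : term G T) u
    (d1 : deriv (ssubst (upd x (Pair (Var (VS VZ)) (Var VZ))
                         (fun C y => Var (VS (VS y)) : term (A' :: A :: G) C))
                  (Sequent Th Ga (GIn t u)))) :
  th_spec d1 -> v_spec d1 -> th_spec (DProdEta d1) /\ v_spec (DProdEta d1).
Proof.
move=> H1 H2; apply: spec_at => C K J tT tG p Hi.
have Hsz : 12 * tsz (rawderiv d1) + 20 <= 12 * tsz (rawderiv (DProdEta d1)) by rewrite /=; lia.
have Hsz' : tsz (rawderiv d1) < tsz (rawderiv (DProdEta d1)) by lia.
pose s := upd x (Pair (Var (VS VZ)) (Var VZ)) (fun C y => Var (VS (VS y)) : term (A' :: A :: G) C).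
pose K1 : kmap (A' :: A :: G) C := kcons (kproj2 (K _ x)) (kcons (kproj1 (K _ x)) K).
pose J1 : vpred (A' :: A :: G) := pcons (J _ x) (pcons (J _ x) J).
have Hs b : forall T y, clean b K (T := T) y -> tv (clean b K1) (s T y).
  apply: (@upd_ind _ _ _ _ (fun T y v => clean b K y -> tv (clean b K1) v)) => //=.
  by rewrite /clean /K1 /=; case: (K _ x).
have Hi1 : inv (ssubst s (Sequent Th Ga (GIn t u))) K1 J1 tT tG (tsz (rawderiv d1)).
  apply: (inv_subst _ Hi (ltnW Hsz')) => //.
  - apply: (@upd_ind _ _ _ _ (fun T y v => ~ J T y -> tup v /\ tv (fun T0 x0 => ~ J1 T0 x0) v)) => //=.
  - apply: (@upd_ind _ _ _ _ (fun T y v => J T y -> tv J1 v)) => //=.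
  - apply: var_case; last apply: var_case.
    + have := iK Hi x; rewrite /K1 /=; case: (K _ x) => [b|e] /=; lia.
    + have := iK Hi x; rewrite /K1 /=; case: (K _ x) => [b|e] /=; lia.
    + by move=> T0 y; have := iK Hi y; rewrite /K1 [kcons _ _ _]/=; lia.
apply: (same_at (d1 := d1) (K1 := K1) (J1 := J1) (tT1 := tT) (tG1 := tG) Hi Hsz') => //.
- by move=> b; split=> H; apply/tv_subst; apply: tv_impl H => T' y; exact: Hs.
- move=> Ur u0 P r c _ Ha HS.
  pose r1 : env Ur (A' :: A :: G) := ((lookup x r).2, ((lookup x r).1, r)).
  exists r1; have W : sub_ok s r1 r.
    by apply: sub_upd => //=; rewrite -surjective_pairing.
  split.
  + have := Ha _ x; rewrite /K1 /agree; case E: (K _ x) => [b|e] /= Hx;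
      apply: var_case => //=; rewrite ?Hx //; apply: var_case => //=; rewrite ?Hx //.
  + by apply: (sat_subst _ Hi) HS => b T0 y _ _; exact: W.
  + by move=> _ /=; rewrite !(teval_subst _ W).
- move=> m; rewrite -[ex _]/(LS (tGen m (rawderiv d1) (Nd (kpi2 (tnth_ (Nd (tn (var_index x)) (rKt K))))
     (Nd (kpi1 (tnth_ (Nd (tn (var_index x)) (rKt K)))) (rKt K))) (ltb tT) (ltb tG) (tb p) (tn (size C)))).
  by rewrite tnth_E nth_rK kpi1_E kpi2_E.
Qed.
End Gen.

(* The exchange rule finds the tag of a formula by comparing raw trees. *)
Lemma rawty_inj T T' : rawty T = rawty T' -> T = T'.
Proof.
elim: T T' => [|A IA A' IA'||A IA] [|C C'||C] //=; first by case=> /IA -> /IA' ->.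
by case=> /IA ->.
Qed.

Lemma ty_dec (T T' : ty) : {T = T'} + {T <> T'}.
Proof. by decide equality. Qed.

Lemma existT_ty_inj (F : ty -> Type) T (x y : F T) : existT F T x = existT F T y -> x = y.
Proof. exact: (Eqdep_dec.inj_pair2_eq_dec _ ty_dec). Qed.

Lemma tn_inj m n : tn m = tn n -> m = n.
Proof. by move/(congr1 llen); rewrite !llen_tn. Qed.

Lemma var_inj G T T' (x : var G T) (x' : var G T') : var_index x = var_index x' ->
  existT (var G) T x = existT (var G) T' x'.
Proof.
elim: x T' x' => {G T} [G T|G T A x IH] T' x'.
  by move: T' x'; apply: (@var_case T G (fun T' x' => 0 = var_index x' -> existT (var (T :: G)) T VZ = existT _ T' x')).
move: T' x'; apply: (@var_case A G (fun T' x' => (var_index x).+1 = var_index x' -> existT (var (A :: G)) T (VS x) = existT _ T' x')) => //= T' x' [/IH E].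
exact: (congr1 (fun a : {T & var G T} => existT (var (A :: G)) (projT1 a) (VS (projT2 a))) E).
Qed.

(** Acting on terms packed with their types lets one rewrite with an equation between packed terms
    before their types are known to agree. *)
Definition sPair G (a b : {T & term G T}) : {T & term G T} := existT _ _ (Pair (projT2 a) (projT2 b)).
Definition sProj1 G (a : {T & term G T}) : {T & term G T} :=
  let: existT T t := a in
  match T return term G T -> {T & term G T} with
  | TProd A B => fun t => existT _ A (Proj1 t) | T => fun t => existT _ T t end t.
Definition sProj2 G (a : {T & term G T}) : {T & term G T} :=
  let: existT T t := a in
  match T return term G T -> {T & term G T} with
  | TProd A B => fun t => existT _ B (Proj2 t) | T => fun t => existT _ T t end t.

Lemma rawterm_inj_ex G T (t : term G T) T' (t' : term G T') : rawterm t = rawterm t' ->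
  existT (term G) T t = existT (term G) T' t'.
Proof.
elim: t T' t' => [T0 x||A A' t IHt u IHu|A A' t IHt|A A' t IHt] T' [T1 x'||C C' t' u'|C C' t'|C C' t'] //= [].
- by move/tn_inj/var_inj => E; exact: (congr1 (fun a : {T & var G T} => existT (term G) (projT1 a) (Var (projT2 a))) E).
- by move=> /IHt E1 /IHu E2; rewrite -[LHS]/(sPair (existT _ _ t) (existT _ _ u)) E1 E2.
- by move=> /IHt E1; rewrite -[LHS]/(sProj1 (existT _ _ t)) E1.
- by move=> /IHt E1; rewrite -[LHS]/(sProj2 (existT _ _ t)) E1.
Qed.

Lemma rawterm_inj G T (t t' : term G T) : rawterm t = rawterm t' -> t = t'.
Proof. by move/rawterm_inj_ex => E; exact: (@existT_ty_inj (term G) T t t' E). Qed.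

Lemma rawform_inj G (f f' : form G) : rawform f = rawform f' -> f = f'.
Proof.
elim: f f' => {G} [G t u|G t u|G|G|G f IHf g IHg|G f IHf g IHg|G T t f IHf|G T t f IHf]
  [t' u'|t' u'|||f' g'|f' g'|T' t' f'|T' t' f'] //= [].
- by move=> /rawterm_inj -> /rawterm_inj ->.
- by move=> /rawterm_inj -> /rawterm_inj ->.
- by move=> /IHf -> /IHg ->.
- by move=> /IHf -> /IHg ->.
- move/rawty_inj => E; move: t' f'; case: _ / E => t' f' /rawterm_inj -> /IHf ->. by [].
- move/rawty_inj => E; move: t' f'; case: _ / E => t' f' /rawterm_inj -> /IHf ->. by [].
Qed.

Lemma rawatom_inj G (a a' : atom G) : rawatom a = rawatom a' -> a = a'.
Proof.
case: a a' => T t u [T' t' u'] [] /rawty_inj E; move: t' u'; case: _ / E => t' u'.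
by move=> /rawterm_inj -> /rawterm_inj ->.
Qed.

Lemma sassoc_In X (raw : X -> tr) (s : seq X) (ts : seq bool) x :
  (forall x y, raw x = raw y -> x = y) -> size ts = size s -> List.In x s ->
  List.In (x, sassoc (raw x) (map raw s) ts) (zip s ts).
Proof.
move=> Hinj; elim: s ts => //= y s IH [|b ts] //= [/IH {}IH] Hin.
case: teqbP => [/Hinj ->|N]; first by left.
by right; apply: IH; case: Hin => // E; rewrite E in N.
Qed.

(** Copies of one formula may carry different tags, and all of them now get the tag of the first.
    This is harmless, since [Q] holds for every pair in the old list. *)
Lemma alls_retag X (raw : X -> tr) (s s' : seq X) (ts : seq bool) (Q : X * bool -> Prop) :
  (forall x y, raw x = raw y -> x = y) -> size ts = size s' ->
  (forall x, List.In x s -> List.In x s') -> alls Q (zip s' ts) ->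
  alls Q (zip s [seq sassoc a (map raw s') ts | a <- map raw s]).
Proof.
move=> Hinj Hsz Hin /allsP H.
have : forall x, List.In x s -> Q (x, sassoc (raw x) (map raw s') ts).
  by move=> x /Hin Hx; apply: H; exact: sassoc_In.
elim: s {Hin} => //= x s IH Hx; split; first by apply: Hx; left.
by apply: IH => y Hy; apply: Hx; right.
Qed.

Lemma tif_Lf a b : tif Lf a b = b. Proof. by []. Qed.
Lemma tif_Nd a b x y : tif (Nd a b) x y = x. Proof. by []. Qed.
Lemma tif_txnor b p x y : tif (txnor (Nd (tb b) (tb p))) x y = if b == p then x else y.
Proof. by rewrite /tif txnor_E isN_tb. Qed.

Lemma alls_zip1 X (Q : X -> Prop) s (t : seq bool) : size t = size s ->
  alls (fun ab => True -> Q ab.1) (zip s t) -> alls Q s.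
Proof. by elim: s t => //= x s IH [|b t] //= [/IH H] [Hx /H]; split=> //; exact: Hx. Qed.

Lemma sat_sound B Ur G (q : sequent G) (d : deriv q) C (K : kmap G C) J tT tG N (r : env Ur G) :
  inv B q K J tT tG N -> sat (fun _ => True) q tT tG r -> gholds (concl q) r.
Proof.
by move=> Hi [S1 S2]; apply: (sound d); [exact: (alls_zip1 (iT Hi))|exact: (alls_zip1 (Q := fun f => holds f r) (iG Hi))].
Qed.

Lemma sat_impl P Q Ur G (q : sequent G) tT tG (r : env Ur G) : (forall b, Q b -> P b) ->
  sat P q tT tG r -> sat Q q tT tG r.
Proof. by move=> H [S1 S2]; split; [apply: alls_impl S1|apply: alls_impl S2] => -[a b] /= S /H. Qed.

Lemma negb_neq p (A : Prop) : p = ~~ p -> A.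
Proof. by case: p. Qed.

Lemma rlevVZ A C : rlev (Var VZ : term (A :: C) A) = tVar (tn (size C)).
Proof. by rewrite /= subSS subn0. Qed.

Lemma unique_elt1 X (x d : X) : unique_elt [set x]%classic d = x.
Proof.
rewrite /unique_elt; case: pselect => [h|]; last by case; exists x.
by case: (cid h) => y /= E; have : [set x]%classic y by rewrite E.
Qed.

Ltac weq := rewrite /TOK /= -?catA /= -?catA /= -?catA.

Section NewVar.
Variables (B : nat) (G : ctx) (Th : seq (atom G)) (Ga : seq (form G)) (g : goal G) (A : ty).
Variables (a1 : atom (A :: G)) (g1 : goal (A :: G)).
Let q := Sequent Th Ga g.
Let q1 := Sequent (a1 :: wka A Th) (wkf A Ga) g1.

Lemma inv_new C (K : kmap G C) J C1 (K' : kmap G C1) k j tT tG s N N1 :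
  inv B q K J tT tG N -> N1 < N ->
  (forall T x, rk (K' T x) = rk (K T x)) ->
  (forall b T x, clean b K (T := T) x -> clean b K' x) ->
  2 * size C1 + 12 * N1 + 20 <= B ->
  av (clean s (kcons k K')) a1 -> aJ (pcons j J) a1 -> tsz (rk k) + 12 * N1 <= B ->
  inv B q1 (kcons k K') (pcons j J) (s :: tT) tG N1.
Proof.
move=> Hi Hsz HK Hc HC Ha1 Hj1 Hk.
have Hi' : inv B q K' J tT tG N1.
  case: Hi => h1 h2 h3 h4 h5 h6; split=> //.
  - by apply: alls_impl h3 => -[a b] /= [h ?]; split=> //; apply: av_impl h => T x; apply: Hc.
  - by apply: alls_impl h4 => -[a b] /= [h ?]; split=> //; apply: fv_impl h => T x; apply: Hc.
  - by move=> T x; rewrite HK; move: (h5 T x); lia.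
have [|||| h1 h2 h3 h4 h5 h6] := @inv_subst _ _ _ (@wk A G) _ _ _ g1 _ _ (kcons k K') _ (pcons j J) _ _ _ _ Hi' (leqnn N1) => //.
  by apply: var_case => // T x; exact: (iK Hi').
by split=> //=; rewrite h1.
Qed.

Lemma sat_new P Ur C (K : kmap G C) J tT tG s N (r : env Ur G) (z : obj Ur A) :
  inv B q K J tT tG N -> sat P q tT tG r -> (P s -> aholds a1 ((z, r) : env Ur (A :: G))) ->
  sat P q1 (s :: tT) tG ((z, r) : env Ur (A :: G)).
Proof.
move=> Hi S Ha.
have [|S1 S2] := @sat_subst B P _ _ _ (@wk A G) _ _ _ g1 _ _ _ _ _ _ ((z, r) : env Ur (A :: G)) r Hi _ S => //.
Qed.
End NewVar.

Lemma clean_kwk b A G C (K : kmap G C) T (x : var G T) : clean b (@kwk A G C K) x <-> clean b K x.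
Proof. by rewrite /clean /kwk; case: (K T x). Qed.
Lemma rk_kwk A G C (K : kmap G C) T (x : var G T) : rk (@kwk A G C K T x) = rk (K T x).
Proof. by rewrite /kwk; case: (K T x) => //= e; rewrite rlev_wk. Qed.

Lemma deriv_gt20 G (q : sequent G) (d : deriv q) : 20 < tsz (rawderiv d).
Proof.
have := tsz_deriv d; have : 15 < tsz (rawsequent q); last by lia.
by case: q d => m h [T t u|T t u|T t u] d; rewrite /=; have := tsz_gt0 (rawty T); lia.
Qed.

Lemma sat_same B s Ur G (q : sequent G) C (K : kmap G C) J tT tG N (r r' : env Ur G) :
  inv B q K J tT tG N -> sat (fun b => b = s) q tT tG r ->
  (forall T (x : var G T), clean s K x -> lookup x r' = lookup x r) ->
  sat (fun b => b = s) q tT tG r'.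
Proof.
move=> [_ _ h3 h4 _ _] [S1 S2] Hr; split.
  have := proj2 (alls_and _ _ _) (conj h3 S1); apply: alls_impl => -[a b] /= [[h _] h'] E.
  by apply/(aholds_same h _); [move=> T' x hx; apply: Hr; rewrite -E|exact: h'].
have := proj2 (alls_and _ _ _) (conj h4 S2); apply: alls_impl => -[a b] /= [[h _] h'] E.
by apply/(holds_same h _); [move=> T' x hx; apply: Hr; rewrite -E|exact: h'].
Qed.

Lemma isN_rlev C T (t : term C T) : isN (rlev t).
Proof. by case: t. Qed.

(** * Exchange and the rules that emit text *)

Section Gen2.
Variables (get : bool) (B : nat).
Notation thS := (th_spec get B).
Notation vS := (v_spec get B).
Notation thA := (th_at get B).
Notation vA := (v_at get B).
Let QQ_pos : 1000 <= QQ B. Proof. by have := QQ_ge B; move: (Q1 B * B) => x; lia. Qed.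
Let RR_pos : 1000 <= RR B. Proof. by have := RR_ge B; have := QQ_pos; move: (B * QQ B) => x; lia. Qed.
Notation W ws := (@emits_word B (TOK ws) isT).

Lemma spec_at' G (q : sequent G) (d : deriv q) :
  (forall C (K : kmap G C) J tT tG p, inv B q K J tT tG (tsz (rawderiv d)) ->
    (gv (clean p K) (concl q) -> thA d K tT tG p) /\ (vclean p K (concl q) -> bget get (concl q) -> vA d K tT tG p)) ->
  thS d /\ vS d.
Proof. by move=> H; split=> C K J tT tG p /H H1 Hg *; apply H1. Qed.

Lemma gen_exch (G : ctx) (Th Th' : seq (atom G)) (Ga Ga' : seq (form G)) g (P1 : Permutation.Permutation Th Th')
    (P2 : Permutation.Permutation Ga Ga') (d1 : deriv (Sequent Th Ga g)) :
  thS d1 -> vS d1 -> thS (DExch P1 P2 d1) /\ vS (DExch P1 P2 d1).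
Proof.
move=> H1 H2; apply: spec_at' => C K J tT tG p Hi.
have Hsz : tsz (rawderiv d1) < tsz (rawderiv (DExch P1 P2 d1)) by rewrite /=; lia.
have I1 x : List.In x Th -> List.In x Th' by apply: Permutation.Permutation_in.
have I2 x : List.In x Ga -> List.In x Ga' by apply: Permutation.Permutation_in.
set tT1 := [seq sassoc a (map (@rawatom G) Th') tT | a <- map (@rawatom G) Th].
set tG1 := [seq sassoc a (map (@rawform G) Ga') tG | a <- map (@rawform G) Ga].
have Hi1 : inv B (Sequent Th Ga g) K J tT1 tG1 (tsz (rawderiv d1)).
  have [/= h1 h2 h3 h4 h5 h6] := inv_sz (ltnW Hsz) Hi; split=> //=; rewrite ?size_map //.
    by apply: (alls_retag (@rawatom_inj G) h1 I1).
  by apply: (alls_retag (@rawform_inj G) h2 I2).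
have Hs Q Ur (r : env Ur G) : sat Q (Sequent Th' Ga' g) tT tG r -> sat Q (Sequent Th Ga g) tT1 tG1 r.
  case=> /= S1 S2; have [/= h1 h2 _ _ _ _] := Hi; split=> /=.
    by apply: (alls_retag (@rawatom_inj G) h1 I1).
  by apply: (alls_retag (@rawform_inj G) h2 I2).
have He m : ex (gtask m (DExch P1 P2 d1) K tT tG p) = ltr [:: gtask m d1 K tT1 tG1 p] Lf.
  rewrite -[ex _]/(LS (tGen m (rawderiv d1) (rKt K)
       (retag (Nd (dat (rawderiv d1)) (Nd (ltr (map (@rawatom G) Th') Lf) (ltb tT))))
       (retag (Nd (dhy (rawderiv d1)) (Nd (ltr (map (@rawform G) Ga') Lf) (ltb tG)))) (tb p) (tn (size C)))).
  rewrite (rawderiv_sq d1) /= !retag_E //; by [case: Hi => h1 h2 *; rewrite ?size_map].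
split=> [Hg|Hg Hb].
  apply: (same_th (d1 := d1) Hi Hsz (He Lf)); last exact: H1 Hi1 Hg.
    by move=> Ur u0 r c Ha /Hs S; exists r.
  by move=> Ur u0 r c Ha /Hs S; apply.
have [e Se Ee] := H2 _ _ _ _ _ _ Hi1 Hg Hb.
exists e; first by move=> Ur u0 dflt c r Ha /Hs S; exact: Se.
apply: (@emits_le _ (tsz (rawderiv d1) * RR B).+1); first by nia.
by apply: (emits_gen (d := DExch P1 P2 d1) _ Hi (He _) Ee).
Qed.

Lemma and2_th G (q1 q2 q : sequent G) (d1 : deriv q1) (d2 : deriv q2) (d : deriv q)
    C (K : kmap G C) J tT tG tG1 tG2 p :
  inv B q K J tT tG (tsz (rawderiv d)) ->
  tsz (rawderiv d1) + tsz (rawderiv d2) < tsz (rawderiv d) ->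
  ex (gtask Lf d K tT tG p) = ltr [:: tE (TOK [:: 9]); gtask Lf d1 K tT tG1 p;
     tE (TOK [:: 9; 5; 1]); gtask Lf d2 K tT tG2 p] Lf ->
  (forall Ur (r : env Ur G), sat (fun b => b = ~~ p) q tT tG r ->
    sat (fun b => b = ~~ p) q1 tT tG1 r /\ sat (fun b => b = ~~ p) q2 tT tG2 r) ->
  (forall Ur (r : env Ur G), sat (fun b => b = p) q tT tG r ->
    (sat (fun b => b = p) q1 tT tG1 r -> gholds (concl q1) r) ->
    (sat (fun b => b = p) q2 tT tG2 r -> gholds (concl q2) r) -> gholds (concl q) r) ->
  thA d1 K tT tG1 p -> thA d2 K tT tG2 p -> thA d K tT tG p.
Proof.
move=> Hi Hsz He Hs1 Hs2 [th1 St1 E1] [th2 St2 E2].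
exists (nand th1 th2).
  move=> Ur u0 dflt c r Ha.
  have [A1 A2] := St1 _ u0 dflt _ _ Ha; have [B1 B2] := St2 _ u0 dflt _ _ Ha.
  split; first by move=> /Hs1 [/A1 ? /B1 ?]; apply/tru_and.
  by move=> S /tru_and [T1 T2]; apply: (Hs2 _ _ S) => S'; [exact: A2|exact: B2].
have E := emits_cons (W [:: 9]) (emits_cons E1 (emits_cons (W [:: 9; 5; 1]) E2)).
by apply: (emits_le _ (emits_gen _ Hi He (emits_eq E _))) => //; nia.
Qed.

Lemma gen_or G Th Ga f1 f2 T (t : term G T) u (d1 : deriv (Sequent Th (f1 :: Ga) (GIn t u)))
    (d2 : deriv (Sequent Th (f2 :: Ga) (GIn t u))) :
  thS d1 -> vS d1 -> thS d2 -> vS d2 -> thS (DOrL d1 d2) /\ vS (DOrL d1 d2).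
Proof.
move=> H1 H1' H2 H2'; apply: spec_at => C K J tT [|b tG] p Hi; first by have := iG Hi.
have Hsz : tsz (rawderiv d1) + tsz (rawderiv d2) < tsz (rawderiv (DOrL d1 d2)) by rewrite /=; lia.
have Hi1 : inv B (Sequent Th (f1 :: Ga) (GIn t u)) K J tT (b :: tG) (tsz (rawderiv d1)).
  have [|h1 h2 h3 /= h4 h5 h6] := @inv_sz _ _ _ _ _ _ _ _ _ (tsz (rawderiv d1)) _ Hi; first by lia.
  by split=> //=; case: h4 => [[[? ?] [? ?]] ?].
have Hi2 : inv B (Sequent Th (f2 :: Ga) (GIn t u)) K J tT (b :: tG) (tsz (rawderiv d2)).
  have [|h1 h2 h3 /= h4 h5 h6] := @inv_sz _ _ _ _ _ _ _ _ _ (tsz (rawderiv d2)) _ Hi; first by lia.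
  by split=> //=; case: h4 => [[[? ?] [? ?]] ?].
have He m : ex (gtask m (DOrL d1 d2) K tT (b :: tG) p) =
   tif m (ltr [:: tE (TOK [:: 8]); gtask m d1 K tT (b :: tG) p; gtask m d2 K tT (b :: tG) p] Lf)
     (tif (txnor (Nd (tb b) (tb p)))
       (ltr [:: tE (TOK [:: 9]); gtask m d1 K tT (b :: tG) p;
                tE (TOK [:: 9; 5; 1]); gtask m d2 K tT (b :: tG) p] Lf)
       (ltr [:: tE (TOK [:: 8]); gtask m d1 K tT (b :: tG) p; gtask m d2 K tT (b :: tG) p] Lf)) by [].
split=> Hg.
- have A1 := H1 _ _ _ _ _ _ Hi1 Hg; have A2 := H2 _ _ _ _ _ _ Hi2 Hg.
  move: (He Lf); rewrite tif_Lf tif_txnor; case: eqP => [Eb|Nb] {}He.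
    apply: (and2_th Hi Hsz He _ _ A1 A2).
      by move=> Ur r [S1 /= [S2 S3]]; split; split=> //=; split=> // E; move: E; rewrite Eb; case: (p).
    move=> Ur r [S1 /= [S2 S3]] G1 G2.
    by case: (S2 Eb) => Hf; [apply: G1|apply: G2]; split.
  case: A1 A2 => th1 St1 E1 [th2 St2 E2]; exists (NUnion th1 th2).
    move=> Ur u0 dflt c r Ha.
    have [A1 A2] := St1 _ u0 dflt _ _ Ha; have [B1 B2] := St2 _ u0 dflt _ _ Ha.
    split=> [[S1 /= [S2 S3]]|[S1 /= [S2 S3]] [] T1].
    + case: (S2 (bool_neq Nb)) => Hf; [left; apply: A1|right; apply: B1]; by split.
    + by apply: A2 => //; split=> //=; split=> // /Nb.
    + by apply: B2 => //; split=> //=; split=> // /Nb.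
  have E := emits_cons (W [:: 8]) (emits_cons E1 E2).
  by apply: (emits_le _ (emits_gen _ Hi He (emits_eq E _))) => //; nia.
- have [e1 S1 E1] := H1' _ _ _ _ _ _ Hi1 Hg I; have [e2 S2 E2] := H2' _ _ _ _ _ _ Hi2 Hg I.
  exists (NUnion (T := T) e1 e2).
    move=> Ur u0 dflt c r Ha [/= Sa [[] // Hf Sb]]; [left|right].
      by apply: (S1 Ur u0 dflt c r Ha); split.
    by apply: (S2 Ur u0 dflt c r Ha); split.
  have E := emits_cons (W [:: 8]) (emits_cons E1 E2).
  move: (He (Nd Lf Lf)); rewrite tif_Nd => {}He.
  by apply: (emits_le _ (emits_gen _ Hi He (emits_eq E _))) => //; nia.
Qed.

Definition nbot C : nrc get C (TSet TUnit) := NEmpty get C TUnit.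

Lemma gen_false G Th f Ga T (t : term G T) u (d : deriv (Sequent Th (f :: Ga) (GIn t u))) :
  (forall Ur (r : env Ur G), ~ holds f r) ->
  (forall m C (K : kmap G C) tT b tG p, ex (gtask m d K tT (b :: tG) p) =
    tif m (ltr [:: tE (TOK [:: 7]); tObj (rawty T)] Lf)
     (tif (txnor (Nd (tb b) (tb p))) (ltr [:: tE (TOK [:: 5; 1])] Lf) (ltr [:: tE (TOK [:: 7; 2])] Lf))) ->
  thS d /\ vS d.
Proof.
move=> Hf He; apply: spec_at => C K J tT [|b tG] p Hi; first by have := iG Hi.
have Hd := tsz_deriv d; have hC := iC Hi.
split=> Hg.
- move: (He Lf _ K tT b tG p); rewrite tif_Lf tif_txnor; case: eqP => [Eb|Nb] {}He.
    exists (ntop get C).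
      by move=> Ur u0 dflt c r Ha; split=> // -[_ /= [/(_ Eb) /Hf]].
    apply: (@emits_le _ 72); first by nia.
    by apply: (emits_gen (d := d) _ Hi He) => //; exact: emits_word.
  exists (nbot C).
    move=> Ur u0 dflt c r Ha; split; last by move=> _ [].
    by case=> _ /= [/(_ (bool_neq Nb)) /Hf].
  apply: (@emits_le _ 72); first by nia.
  by apply: (emits_gen (d := d) _ Hi He) => //; exact: emits_word.
- exists (NEmpty get C T).
    by move=> Ur u0 dflt c r Ha [_ /= [/(_ I) /Hf]].
  have Ht : tsz (rawty T) + 20 <= B by move: Hd; rewrite /=; lia.
  apply: (@emits_le _ (71 + 30 * tsz (rawty T)).+1).
    by move: (tsz (rawderiv d)) hC Hd => n; rewrite /=; nia.
  move: (He (Nd Lf Lf) _ K tT b tG p); rewrite tif_Nd => {}He.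
  have E := emits_cons (W [:: 7]) (emits_ty Ht).
  by apply: (emits_gen _ Hi He (emits_eq E _)).
Qed.

Definition nmem C T (a : nrc get C T) (s : nrc get C (TSet T)) : nrc get C (TSet TUnit) :=
  NBigU (NDiff (NSing a) (NDiff (NSing a) s)) (ntop get (T :: C)).

Lemma tru_mem Ur (dflt : get -> Ur) C T (a : nrc get C T) s c :
  tru dflt (nmem a s) c <-> (neval dflt s c : set (obj Ur T)) (neval dflt a c).
Proof.
rewrite /nmem tru_bigU; split=> [[x /= [-> H] _]|H].
  by apply: contrapT => D; apply: H.
by exists (neval dflt a c) => //=; split=> // -[].
Qed.

Lemma cost_th (n : nat) k : 20 < n -> k <= 10 * QQ B -> k <= n * QQ B.
Proof. by nia. Qed.
Lemma cost_v (n : nat) k : 20 < n -> k <= 10 * QQ B -> 0 < B -> k <= n * RR B.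
Proof. by move=> H1 H2 H3; have := RR_ge B; nia. Qed.

Lemma gen_inur G Th Ga (t : term G TUr) u :
  thS (DInUrR Th Ga t u) /\ vS (DInUrR Th Ga t u).
Proof.
apply: spec_at => C K J [|b tT] tG p Hi; first by have := iT Hi.
have hq := QQ_ge B; have hd := deriv_gt20 (DInUrR Th Ga t u); have hC := iC Hi.
have He m : ex (gtask m (DInUrR Th Ga t u) K (b :: tT) tG p) =
  tif m (tif (txnor (Nd (tb b) (tb p)))
           (ltr [:: tE (TOK [:: 5]); tTm (rawterm t) (rKt K) (tn (size C))] Lf)
           (ltr [:: tTm (rawterm u) (rKt K) (tn (size C))] Lf))
        (tif (txnor (Nd (tb b) (tb p))) (ltr [:: tE (TOK [:: 5; 1])] Lf)
           (ltr [:: tE (TOK [:: 6; 9; 5]); tTm (rawterm t) (rKt K) (tn (size C));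
               tE (TOK [:: 9; 5]); tTm (rawterm t) (rKt K) (tn (size C));
               tTm (rawterm u) (rKt K) (tn (size C)); tE (TOK [:: 5; 1])] Lf)) by [].
have [ct cu] : tv (clean b K) t /\ tv (clean b K) u by case: Hi => _ _ [[]].
have st : tsz (rawterm t) <= tsz (rawsequent (Sequent (Mem t u :: Th) Ga (GIn t u))) by rewrite /=; lia.
have su : tsz (rawterm u) <= tsz (rawsequent (Sequent (Mem t u :: Th) Ga (GIn t u))) by rewrite /=; lia.
split=> -[gt gu].
- move: (He Lf); rewrite tif_Lf tif_txnor; case: eqP => [Eb|Nb] {}He.
    exists (ntop get C); first by move=> Ur u0 dflt c r Ha; split=> // -[[/(_ Eb)]].
    apply: (emits_le _ (emits_gen _ Hi He (W [:: 5; 1]))) => //; by apply: cost_th => //; lia.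
  have Eb := bool_neq Nb; rewrite Eb in ct cu.
  have [et Set_ Eet] := @tm_at get _ _ _ _ _ _ _ _ _ _ _ Hi st (clean_com gt ct).
  have [eu Seu Eeu] := @tm_at get _ _ _ _ _ _ _ _ _ _ _ Hi su (clean_com gu cu).
  exists (nmem et eu).
    move=> Ur u0 dflt c r Ha; rewrite tru_mem (Set_ _ _ _ _ Ha) (Seu _ _ _ _ Ha).
    by split=> // -[[/(_ Eb)]].
  have E := emits_cons (W [:: 6; 9; 5]) (emits_cons Eet (emits_cons (W [:: 9; 5])
    (emits_cons Eet (emits_cons Eeu (W [:: 5; 1]))))).
  apply: (emits_le _ (emits_gen _ Hi He (emits_eq E _))) => //.
    by apply: cost_th => //; move: (Q1 B * B) hq => x; lia.
  by weq.
- move: (He (Nd Lf Lf)); rewrite tif_Nd tif_txnor; case: eqP => [Eb|Nb] {}He.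
    rewrite Eb in ct cu; have [et Set_ Eet] := @tm_at get _ _ _ _ _ _ _ _ _ _ _ Hi st (clean_com ct gt).
    exists (NSing et); first by move=> Ur u0 dflt c r Ha _ /=; rewrite (Set_ _ _ _ _ Ha).
    have E := emits_cons (W [:: 5]) Eet.
    apply: (emits_le _ (emits_gen _ Hi He (emits_eq E _))) => //.
    by apply: cost_v => //; move: (Q1 B * B) hq => x; lia.
  have Eb := bool_neq Nb; rewrite Eb in ct cu.
  have [eu Seu Eeu] := @tm_at get _ _ _ _ _ _ _ _ _ _ _ Hi su (clean_com gu cu).
  exists eu; first by move=> Ur u0 dflt c r Ha [[/(_ I) H _] _]; rewrite /= (Seu _ _ _ _ Ha).
  apply: (emits_le _ (emits_gen _ Hi He Eeu)) => //.
  by apply: cost_v => //; move: (Q1 B * B) hq => x; lia.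
Qed.

Lemma gen_eqset G Th Ga T (t u : term G (TSet T)) (d1 : deriv (Sequent Th Ga (GSub t u)))
    (d2 : deriv (Sequent Th Ga (GSub u t))) :
  thS d1 -> vS d1 -> thS d2 -> thS (DEqSetR d1 d2) /\ vS (DEqSetR d1 d2).
Proof.
move=> H1 H1' H2; apply: spec_at' => C K J tT tG p Hi.
have Hsz : tsz (rawderiv d1) + tsz (rawderiv d2) < tsz (rawderiv (DEqSetR d1 d2)) by rewrite /=; lia.
have Hi1 : inv B (Sequent Th Ga (GSub t u)) K J tT tG (tsz (rawderiv d1)).
  by have [|? ? ? ? ? ?] := @inv_sz _ _ _ _ _ _ _ _ _ (tsz (rawderiv d1)) _ Hi; first by lia.
have Hi2 : inv B (Sequent Th Ga (GSub u t)) K J tT tG (tsz (rawderiv d2)).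
  by have [|? ? ? ? ? ?] := @inv_sz _ _ _ _ _ _ _ _ _ (tsz (rawderiv d2)) _ Hi; first by lia.
split=> [[gt gu]|[gt gu] _].
- apply: (and2_th (d1 := d1) (d2 := d2) Hi Hsz) => //; try by [exact: H1 Hi1 _|exact: H2 Hi2 _].
  by move=> Ur r S G1 G2 /=; rewrite eqEsubset; split; [exact: G1|exact: G2].
- have [e Se Ee] := H1' _ _ _ _ _ _ Hi1 (conj gt gu) I.
  exists e.
    move=> Ur u0 dflt c r Ha S; have [S1 S2] := Se Ur u0 dflt c r Ha S.
    have /= E := sat_sound (DEqSetR d1 d2) Hi S.
    by rewrite /= eqEsubset; split=> //; rewrite E.
  apply: (@emits_le _ (tsz (rawderiv d1) * RR B).+1); first by nia.
  by apply: (emits_gen (d := DEqSetR d1 d2) (ts := [:: gtask (Nd Lf Lf) d1 K tT tG p]) _ Hi _ Ee).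
Qed.

Lemma gen_eqprod G Th Ga A A' (t u : term G (TProd A A')) (d1 : deriv (Sequent Th Ga (GEq (Proj1 t) (Proj1 u))))
    (d2 : deriv (Sequent Th Ga (GEq (Proj2 t) (Proj2 u)))) :
  thS d1 -> vS d1 -> thS d2 -> vS d2 -> thS (DEqProdR d1 d2) /\ vS (DEqProdR d1 d2).
Proof.
move=> H1 H1' H2 H2'; apply: spec_at' => C K J tT tG p Hi.
have Hsz : tsz (rawderiv d1) + tsz (rawderiv d2) < tsz (rawderiv (DEqProdR d1 d2)) by rewrite /=; lia.
have Hi1 : inv B (Sequent Th Ga (GEq (Proj1 t) (Proj1 u))) K J tT tG (tsz (rawderiv d1)).
  by have [|? ? ? ? ? ?] := @inv_sz _ _ _ _ _ _ _ _ _ (tsz (rawderiv d1)) _ Hi; first by lia.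
have Hi2 : inv B (Sequent Th Ga (GEq (Proj2 t) (Proj2 u))) K J tT tG (tsz (rawderiv d2)).
  by have [|? ? ? ? ? ?] := @inv_sz _ _ _ _ _ _ _ _ _ (tsz (rawderiv d2)) _ Hi; first by lia.
split=> [[gt gu]|[gt gu] Hb].
- apply: (and2_th (d1 := d1) (d2 := d2) Hi Hsz) => //; try by [exact: H1 Hi1 _|exact: H2 Hi2 _].
  move=> Ur r S G1 G2 /=; rewrite [LHS]surjective_pairing [RHS]surjective_pairing.
  by move: (G1 S) (G2 S) => /= -> ->.
- have [|e1 S1 E1] := H1' _ _ _ _ _ _ Hi1 (conj gt gu) _.
    by move=> /= h; apply: Hb; rewrite /= h.
  have [|e2 S2 E2] := H2' _ _ _ _ _ _ Hi2 (conj gt gu) _.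
    by move=> /= h; apply: Hb; rewrite /= h orbT.
  exists (NPair e1 e2).
    move=> Ur u0 dflt c r Ha S /=; rewrite [RHS]surjective_pairing.
    by move: (S1 Ur u0 dflt c r Ha S) (S2 Ur u0 dflt c r Ha S) => /= -> ->.
  have E := emits_cons (W [:: 2]) (emits_cons E1 E2).
  have He : ex (gtask (Nd Lf Lf) (DEqProdR d1 d2) K tT tG p) = ltr [:: tE (TOK [:: 2]);
    gtask (Nd Lf Lf) d1 K tT tG p; gtask (Nd Lf Lf) d2 K tT tG p] Lf by [].
  by apply: (emits_le _ (emits_gen _ Hi He (emits_eq E _))) => //; nia.
Qed.

Lemma gen_equnit G Th Ga (t u : term G TUnit) : thS (DEqUnitR Th Ga t u) /\ vS (DEqUnitR Th Ga t u).
Proof.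
apply: spec_at' => C K J tT tG p Hi; have hd := deriv_gt20 (DEqUnitR Th Ga t u); have hC := iC Hi.
split=> Hg *.
- exists (ntop get C).
    by move=> Ur u0 dflt c r Ha; split=> // _ _ /=; case: (teval r t); case: (teval r u).
  apply: (emits_le _ (emits_gen (d := DEqUnitR Th Ga t u) (ts := [:: tE (TOK [:: 5; 1])]) _ Hi _ (W [:: 5; 1]))) => //.
- exists (NUnit get C : nrc get C (rty (GEq t u))).
    by move=> Ur u0 dflt c r Ha _ /=; case: (teval r t).
  apply: (emits_le _ (emits_gen (d := DEqUnitR Th Ga t u) (ts := [:: tE (TOK [:: 1])]) _ Hi _ (W [:: 1]))) => //.
  by apply: cost_v => //; lia.
Qed.

Lemma gen_sub G Th Ga T (t u : term G (TSet T)) (d1 : deriv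
    (Sequent (Mem (Var VZ) (wkt T t) :: wka T Th) (wkf T Ga) (GIn (Var VZ) (wkt T u)))) :
  thS d1 -> vS d1 -> thS (DSubR d1) /\ vS (DSubR d1).
Proof.
move=> H1 H1'; apply: spec_at' => C K J tT tG p Hi.
have Hsz : tsz (rawderiv d1) < tsz (rawderiv (DSubR d1)) by rewrite /=; lia.
have hC := iC Hi.
split=> [[/= gt gu]|[/= gt gu] _].
- have Hi1 : inv B (Sequent (Mem (Var VZ) (wkt T t) :: wka T Th) (wkf T Ga) (GIn (Var VZ) (wkt T u)))
      (kcons (KS p) K) (pcons False J) (p :: tT) tG (tsz (rawderiv d1)).
    apply: (inv_new _ Hi) => //; first by lia.
    + by split=> //; apply/tv_subst.
    + by left; split=> // -[].
    + by rewrite [rk _]/=; have := tsz_tb p; lia.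
  apply: (same_th (d1 := d1) (K1 := kcons (KS p) K) (tT1 := p :: tT) (tG1 := tG) Hi Hsz) => //; last first.
  + by apply: H1 Hi1 _; split=> //; apply/tv_subst.
  + move=> Ur u0 r c Ha S Hr z Hz /=.
    have := Hr ((z, r) : env Ur (T :: G)); rewrite /= !(teval_subst _ (sub_wk r z)); apply.
      by apply: var_case.
    by apply: (sat_new _ Hi) => //= _; rewrite (teval_subst _ (sub_wk r z)).
  + move=> Ur u0 r c Ha S; exists ((obj0 u0 T, r) : env Ur (T :: G)); first exact: var_case.
    by apply: (sat_new _ Hi) => // /negb_neq; apply.
- have Hi1 : inv B (Sequent (Mem (Var VZ) (wkt T t) :: wka T Th) (wkf T Ga) (GIn (Var VZ) (wkt T u)))
      (kcons (KS p) K) (pcons False J) (p :: tT) tG (tsz (rawderiv d1)).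
    apply: (inv_new _ Hi) => //; first by lia.
    + by split=> //; apply/tv_subst.
    + by left; split=> // -[].
    + by rewrite [rk _]/=; have := tsz_tb p; lia.
  (* For the filter, the same premise is read with the eigenvariable common, as the element bound in
     the expression. *)
  pose K2 : kmap (T :: G) (T :: C) := kcons (KC (Var VZ)) (@kwk T G C K).
  have Hi2 : inv B (Sequent (Mem (Var VZ) (wkt T t) :: wka T Th) (wkf T Ga) (GIn (Var VZ) (wkt T u)))
      K2 (pcons False J) (p :: tT) tG (tsz (rawderiv d1)).
    apply: (inv_new _ Hi) => //.
    + by move=> T' x; rewrite rk_kwk.
    + by move=> b T' x /clean_kwk.
    + by rewrite /=; lia.
    + by split=> //; apply/tv_subst; apply: tv_impl gt => T' x; exact: (clean_kwk p T K x).2.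
    + by left; split=> // -[].
    + by rewrite -[rk _]/(Nd Lf (rlev (Var VZ : term (T :: C) T))) rlevVZ /= tsz_tn; lia.
  have [||e Se Ee] := H1' _ _ _ _ _ (~~ p) Hi1 _ _ => //.
    by split; [rewrite /= /clean /= negbK|apply/tv_subst].
  have [|th Sth Eth] := H1 _ _ _ _ _ (~~ p) Hi2.
    by split=> //; apply/tv_subst; apply: tv_impl gu => T' x; exact: (clean_kwk (~~ p) T K x).2.
  exists (NBigU (A := T) (B := T) e (NBigU th (NSing (NVar get (VS VZ))))).
    move=> Ur u0 dflt c r Ha S /=.
    have Ha1 z : agree (kcons (KS p) K) ((z, r) : env Ur (T :: G)) c by apply: var_case.
    have Ha2 z : agree K2 ((z, r) : env Ur (T :: G)) ((z, c) : env Ur (T :: C)).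
      by apply: var_case => //; exact: (agree_kwk K r c z).2.
    split=> [z Hz|z [y Hy [x Hx /= ->]]].
      have Sz : sat (fun _ => True) (Sequent (Mem (Var VZ) (wkt T t) :: wka T Th) (wkf T Ga) (GIn (Var VZ) (wkt T u)))
          (p :: tT) tG ((z, r) : env Ur (T :: G)).
        by apply: (sat_new _ Hi) => //= _; rewrite (teval_subst _ (sub_wk r z)).
      exists z; first exact: (Se Ur u0 dflt c _ (Ha1 z) Sz).
      exists tt => //; apply: (Sth Ur u0 dflt _ _ (Ha2 z)).1.
      exact: sat_impl Sz.
    rewrite -(teval_subst _ (sub_wk r y)).
    (* The hypothesis that [y] is in [t] carries the tag [p]; the interpolant, taken for side
       [~~ p], yields [y] in [u] without it. *)
    case: x Hx => Hx; apply: ((Sth Ur u0 dflt _ _ (Ha2 y)).2 _ Hx).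
    by apply: (sat_new _ Hi) => [|/negb_neq] //; [exact: sat_impl S|apply].
  have E := emits_cons (W [:: 6]) (emits_cons Ee (emits_cons (W [:: 6]) (emits_cons Eth (W [:: 5; 0; 1])))).
  have He : ex (gtask (Nd Lf Lf) (DSubR d1) K tT tG p) = ltr [:: tE (TOK [:: 6]);
      gtask (Nd Lf Lf) d1 (kcons (KS p) K) (p :: tT) tG (~~ p); tE (TOK [:: 6]);
      gtask Lf d1 K2 (p :: tT) tG (~~ p); tE (TOK [:: 5; 0; 1])] Lf.
    have E2 : rK K2 = Nd Lf (tVar (tn (size C))) :: rK K.
      by rewrite -(rlevVZ T C) -(@rK_kwk T G C K).
    by rewrite /gtask E2 -(tnot_E p).
  apply: (emits_le _ (emits_gen _ Hi He (emits_eq E _))) => //.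
  have hR := RR_ge B; move: QQ_pos RR_pos hR; have : tsz (rawderiv d1) <= B by lia.
  move: (tsz (rawderiv (DSubR d1))) (tsz (rawderiv d1)) Hsz => n n1 Hsz h1 h2 h3 h4.
  nia.
Qed.

Lemma gen_equr G Th Ga (t u : term G TUr) (d1 : deriv
    (Sequent (Mem (wkt (TSet TUr) t) (Var VZ) :: wka (TSet TUr) Th) (wkf (TSet TUr) Ga)
             (GIn (wkt (TSet TUr) u) (Var VZ)))) :
  thS d1 -> vS d1 -> thS (DEqUrR d1) /\ vS (DEqUrR d1).
Proof.
set q1 := Sequent _ _ _ in d1 *.
move=> H1 H1'; apply: spec_at' => C K J tT tG p Hi.
have Hsz2 : tsz (rawderiv d1) + 20 <= tsz (rawderiv (DEqUrR d1)) by rewrite /= /q1; lia.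
have Hsz : tsz (rawderiv d1) < tsz (rawderiv (DEqUrR d1)) by lia.
have hC : 2 * size C + 12 * tsz (rawderiv d1) + 260 <= B by have := iC Hi; lia.
split=> [[/= gt gu]|[/= gt gu] /= Hb].
- have Hi1 : inv B q1 (kcons (KS p) K) (pcons True J) (p :: tT) tG (tsz (rawderiv d1)).
    apply: (inv_new _ Hi) => //; first by lia.
    + by split=> //; apply/tv_subst.
    + by right.
    + by rewrite [rk _]/=; have := tsz_tb p; lia.
  apply: (same_th (d1 := d1) (K1 := kcons (KS p) K) (tT1 := p :: tT) (tG1 := tG) Hi Hsz) => //; last first.
  + by apply: H1 Hi1 _; split=> //; apply/tv_subst.
  + move=> Ur u0 r c Ha S Hr /=.
    pose z : obj Ur (TSet TUr) := [set teval r t]%classic.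
    have := Hr ((z, r) : env Ur (TSet TUr :: G)); rewrite /= !(teval_subst _ (sub_wk (A := TSet TUr) r z)) => H.
    symmetry; apply: H; first by apply: var_case.
    by apply: (sat_new _ Hi) => //= _; rewrite (teval_subst _ (sub_wk (A := TSet TUr) r z)).
  (* Any set serves here, as the new membership is on side [p] and only the other side is
     assumed. *)
  + move=> Ur u0 r c Ha S; exists ((set0, r) : env Ur (TSet TUr :: G)); first exact: var_case.
    by apply: (sat_new _ Hi) => // /negb_neq; apply.
- have Hi1 : inv B q1 (kcons (KS p) K) (pcons True J) (p :: tT) tG (tsz (rawderiv d1)).
    apply: (inv_new _ Hi) => //; first by lia.
    + by split=> //; apply/tv_subst.
    + by right.
    + by rewrite [rk _]/=; have := tsz_tb p; lia.
  pose C2 := TSet TUr :: TUr :: C.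
  pose KK := @kwk (TSet TUr) G _ (@kwk TUr G C K).
  pose K2 : kmap (TSet TUr :: G) C2 := kcons (KC (Var VZ)) KK.
  have clKK b T' (x : var G T') : clean b K x -> clean b KK x.
    by move=> h; apply: (clean_kwk _ _ _ _).2; apply: (clean_kwk _ _ _ _).2.
  have Hi2 : inv B q1 K2 (pcons True J) (p :: tT) tG (tsz (rawderiv d1)).
    apply: (inv_new _ Hi) => //.
    + by move=> T' x; rewrite /KK !rk_kwk.
    + by rewrite [size C2]/=; lia.
    + by split=> //; apply/tv_subst; apply: tv_impl gt => T' x; exact: clKK.
    + by right.
    + by rewrite -[rk _]/(Nd Lf (rlev (Var VZ : term C2 (TSet TUr)))) rlevVZ [size _]/= ; move: hC; move: (rawderiv d1) => n hC; rewrite /= tsz_tn; lia.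
  have [||e Se Ee] := H1' _ _ _ _ _ p Hi1 _ _ => //.
    by split=> //; apply/tv_subst.
  have [|th Sth Eth] := H1 _ _ _ _ _ (~~ p) Hi2.
    by split=> //; apply/tv_subst; apply: tv_impl gu => T' x; exact: clKK.
  exists (NGet (Hb isT) (NBigU (A := TUr) (B := TUr) e
     (NBigU (NSing (NSing (NVar get VZ))) (NBigU th (NVar get (VS VZ)))))).
    move=> Ur u0 dflt c r Ha S.
    have Etu : teval r t = teval r u := sat_sound (DEqUrR d1) Hi S.
    have Ha1 z : agree (kcons (KS p) K) ((z, r) : env Ur (TSet TUr :: G)) c by apply: var_case.
    have Ha2 (z : obj Ur (TSet TUr)) (f : Ur) : agree K2 ((z, r) : env Ur (TSet TUr :: G)) ((z, (f, c)) : env Ur C2).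
      apply: var_case => // T' x; rewrite /K2 /=.
      by apply: (proj2 (@agree_kwk Ur _ _ _ (@kwk TUr G C K) r (f, c) z)); apply: (proj2 (@agree_kwk Ur TUr _ _ K r c f)).
    have Sz : sat (fun _ => True) q1 (p :: tT) tG (([set teval r t]%classic, r) : env Ur (TSet TUr :: G)).
      apply: (sat_new _ Hi) => //= _.
      by rewrite (teval_subst _ (sub_wk (A := TSet TUr) r [set teval r t]%classic)).
    rewrite /= [X in unique_elt X _](_ : _ = [set teval r t]%classic) ?unique_elt1 //.
    rewrite eqEsubset; split=> [f [y Hy [z /= -> [x Hx /= ->]]]|f /= ->].
      (* A candidate [y] that passes the test equals [u]: with the eigenvariable read as [{y}], the
         interpolant proves that [u] is in [{y}]. *)
      rewrite /= Etu -(teval_subst _ (sub_wk (A := TSet TUr) r [set y]%classic)).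
      symmetry; case: x Hx => Hx; apply: ((Sth Ur u0 dflt _ _ (Ha2 [set y]%classic y)).2 _ Hx).
      by apply: (sat_new _ Hi) => [|/negb_neq] //; [exact: sat_impl S|apply].
    exists (teval r t).
      have := Se Ur u0 dflt c _ (Ha1 _) Sz.
      by rewrite /= (teval_subst _ (sub_wk (A := TSet TUr) r [set teval r t]%classic)) Etu.
    exists [set teval r t]%classic => //; exists tt => //.
    apply: (Sth Ur u0 dflt _ _ (Ha2 [set teval r t]%classic (teval r t))).1.
    exact: sat_impl Sz.
  have E := emits_cons (W [:: 10; 6]) (emits_cons Ee (emits_cons (W [:: 6; 5; 5; 0; 0; 6]) (emits_cons Eth (W [:: 0; 1])))).
  have He : ex (gtask (Nd Lf Lf) (DEqUrR d1) K tT tG p) = ltr [:: tE (TOK [:: 10; 6]);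
      gtask (Nd Lf Lf) d1 (kcons (KS p) K) (p :: tT) tG p; tE (TOK [:: 6; 5; 5; 0; 0; 6]);
      gtask Lf d1 K2 (p :: tT) tG (~~ p); tE (TOK [:: 0; 1])] Lf.
    have E2 : rK K2 = Nd Lf (tVar (tn (size C).+1)) :: rK K.
      by rewrite -(rlevVZ (TSet TUr) (TUr :: C)) -(@rK_kwk TUr G C K) -(@rK_kwk (TSet TUr) G _ (@kwk TUr G C K)).
    by rewrite /gtask E2 -(tnot_E p).
  apply: (emits_le _ (emits_gen _ Hi He (emits_eq E _))) => //.
  have hR := RR_ge B; move: QQ_pos RR_pos hR; have : tsz (rawderiv d1) <= B by lia.
  move: (tsz (rawderiv (DEqUrR d1))) (tsz (rawderiv d1)) Hsz => n n1 Hsz h1 h2 h3 h4.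
  nia.
Qed.

Lemma tru_all Ur (dflt : get -> Ur) C T (s : nrc get C (TSet T)) (a b : nrc get (T :: C) _) c :
  tru dflt (NDiff (ntop get C) (NBigU s (NDiff a b))) c <->
  forall z, (neval dflt s c : set (obj Ur T)) z ->
    tru dflt a ((z, c) : env Ur (T :: C)) -> tru dflt b ((z, c) : env Ur (T :: C)).
Proof.
rewrite /tru /=; split=> [[_ H] z Hz Ha|H].
  by apply: contrapT => D; apply: H; exists z.
by split=> // -[z Hz [Ha D]]; apply: D; apply: H.
Qed.

Section Bind.
Variables (G : ctx) (T : ty) (t : term G T) (u : term G (TSet T)) (Th : seq (atom G)) (Ga : seq (form G)) (g : goal G).
Let q := Sequent (Mem t u :: Th) Ga g.
Variables (C : ctx) (K : kmap G C) (J : vpred G) (bT : bool) (tT tG : seq bool) (p : bool) (N : nat).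
Hypothesis Hi : inv B q K J (bT :: tT) tG N.
Hypothesis Ht : tup t.

(** The private variables of [t] become projections of the newly bound element, represented by
    [Var VZ]. *)
Definition kbind : kmap G (T :: C) := kasg t (Var VZ) (@kwk T G C K).

Lemma head_clean : tv (clean bT K) t /\ tv (clean bT K) u.
Proof. by case: Hi => _ _ /= [[[? ?] _] _]. Qed.

Let Hct : tv (clean bT (@kwk T G C K)) t.
Proof. by apply: tv_impl head_clean.1 => T' x; exact: (clean_kwk bT T K x).2. Qed.

Lemma kbind_incl : kincl bT (@kwk T G C K) kbind.
Proof. exact: kasg_incl. Qed.

Lemma kbind_com : tv (com kbind) t.
Proof. exact: kasg_com Ht Hct. Qed.

Lemma kbind_clean b T' (x : var G T') : clean b K x -> clean b kbind x.
Proof. by move=> h; apply: (kincl_clean kbind_incl); exact: (clean_kwk b T K x).2. Qed.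

Lemma kbind_inv N1 : N1 + tsz (rawterm t) < N -> inv B q kbind J (bT :: tT) tG N1.
Proof.
move=> HN; case: Hi => h1 h2 h3 h4 h5 h6; split=> //.
- by apply: alls_impl h3 => -[a b] /= [h ?]; split=> //; apply: av_impl h => T' x; apply: kbind_clean.
- by apply: alls_impl h4 => -[a b] /= [h ?]; split=> //; apply: fv_impl h => T' x; apply: kbind_clean.
- have : kbound kbind (B - 12 * N1).
    apply: kbound_kasg; first by move=> T' x; rewrite rk_kwk; have := h5 T' x; lia.
    by rewrite rlevVZ /= tsz_tn; lia.
  by move=> hb T' x; have := hb T' x; lia.
- by rewrite /=; lia.
Qed.

Lemma kbind_E : rKt kbind = assign (Nd (rKt K) (Nd (rawterm t) (tVar (tn (size C))))).
Proof. by rewrite -(rlevVZ T C) -(@rK_kwk T G C K) assign_E. Qed.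

Lemma kbind_agree Ur (r : env Ur G) c (z : obj Ur T) : agree K r c -> teval r t = z ->
  agree kbind r ((z, c) : env Ur (T :: C)).
Proof. by move=> Ha Hz; apply: agree_kasg => //; apply/agree_kwk. Qed.

(** The bound element need not be the value of [t] in [r]; the private variables of side [bT] are
    reset to fit it, which the other side does not notice. *)
Lemma kbind_env Ur (r : env Ur G) c (z : obj Ur T) : agree K r c ->
  exists2 r' : env Ur G, agree kbind r' ((z, c) : env Ur (T :: C)) &
    forall T' (x : var G T'), clean (~~ bT) K x -> lookup x r' = lookup x r.
Proof.
move=> Ha; have [r' A' H'] := override kbind_incl ((agree_kwk K r c z).2 Ha).
by exists r' => // T' x h; apply: H'; exact: (clean_kwk (~~ bT) T K x).2.
Qed.
End Bind.

Section BindTh.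
Variables (G : ctx) (T : ty) (t : term G T) (u : term G (TSet T)) (Th : seq (atom G)) (Ga Ga1 : seq (form G)).
Variables (g g1 : goal G).
Let q := Sequent (Mem t u :: Th) Ga g.
Let q1 := Sequent (Mem t u :: Th) Ga1 g1.
Variables (d : deriv q) (d1 : deriv q1).
Variables (C : ctx) (K : kmap G C) (J : vpred G) (bT : bool) (tT tG : seq bool) (p : bool).
Hypothesis Hi : inv B q K J (bT :: tT) tG (tsz (rawderiv d)).
Hypothesis Ht : tup t.
Hypothesis Hu : tv (com K) u.
Hypothesis Hsz : tsz (rawderiv d1) + tsz (rawterm t) + tsz (rawterm u) + 20 < tsz (rawderiv d).
Let K1 := kbind t K.
Hypothesis Hi1 : inv B q1 K1 J (bT :: tT) tG (tsz (rawderiv d1)).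
Hypothesis H1 : thA d1 K1 (bT :: tT) tG p.

Let su : tsz (rawterm u) <= tsz (rawsequent q).
Proof. by rewrite /q /=; lia. Qed.
Let st1 : tsz (rawterm t) <= tsz (rawsequent q1).
Proof. by rewrite /q /=; lia. Qed.

(** The side opposite to [p] supplies the value of [t] as the witness. Conversely, a witness fixes
    new values for the private variables of that side in [t], and the conclusion, being on side [p],
    is unaffected by the change. *)
Lemma bind_ex : bT = ~~ p ->
  ex (gtask Lf d K (bT :: tT) tG p) = ltr
    [:: tE (TOK [:: 6]); tTm (rawterm u) (rKt K) (tn (size C));
        tE (TOK [:: 9; 9; 5; 1; 6; 9; 5; 0; 0; 5]); tTm (rawterm t) (rKt K1) (tn (size C).+1);
        tE (TOK [:: 5; 1; 9; 5; 1]); gtask Lf d1 K1 (bT :: tT) tG p] Lf ->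
  (forall Ur (r : env Ur G), sat (fun b => b = ~~ p) q (bT :: tT) tG r ->
     sat (fun b => b = ~~ p) q1 (bT :: tT) tG r) ->
  (forall Ur (r r' : env Ur G), sat (fun b => b = p) q (bT :: tT) tG r ->
     (forall T' (x : var G T'), clean p K x -> lookup x r' = lookup x r) ->
     (teval r u : set (obj Ur T)) (teval r' t) ->
     sat (fun b => b = p) q1 (bT :: tT) tG r' /\ (gholds g1 r' -> gholds g r)) ->
  thA d K (bT :: tT) tG p.
Proof.
move=> Eb He Hs1 Hs2.
have [eu Seu Eeu] := @tm_at get _ _ _ _ _ _ _ _ _ _ _ Hi su Hu.
have [et Set_ Eet] := @tm_at get _ _ _ _ _ _ _ _ _ _ _ Hi1 st1 (kbind_com Hi Ht).
have [th Sth Eth] := H1.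
exists (NBigU eu (nand (neq (NVar get VZ) et) th)).
  move=> Ur u0 dflt c r Ha; rewrite tru_bigU (Seu _ _ _ _ Ha); split=> [S|S [z Hz /tru_and [/tru_eq Ez Tz]]].
    exists (teval r t); first by case: S => /= -[/(_ Eb)].
    have Ha1 := kbind_agree (t := t) Ha erefl.
    apply/tru_and; split; first by apply/tru_eq; rewrite (Set_ _ _ _ _ Ha1).
    by apply: (Sth _ u0 _ _ _ Ha1).1; exact: Hs1.
  have [r' Ha' Hr'] := kbind_env Hi z Ha.
  rewrite (Set_ _ _ _ _ Ha') /= in Ez.
  have [||S' G'] := Hs2 _ _ r' S; first by move=> T' x h; apply: Hr'; rewrite Eb negbK.
    by rewrite -Ez.
  by apply: G'; exact: (Sth _ u0 _ _ _ Ha').2 S' Tz.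
have E := emits_cons (W [:: 6]) (emits_cons Eeu (emits_cons (W [:: 9; 9; 5; 1; 6; 9; 5; 0; 0; 5])
   (emits_cons Eet (emits_cons (W [:: 5; 1; 9; 5; 1]) Eth)))).
apply: (emits_le _ (emits_gen _ Hi He (emits_eq E _))) => //; last by weq.
have hq := QQ_ge B; move: QQ_pos hq Hsz; move: (Q1 B * B) (tsz (rawderiv d)) (tsz (rawderiv d1)) => x n n1.
by nia.
Qed.

(** The roles are exchanged: the side opposite to [p] proves the interpolant for every reading of
    [t], and side [p], which owns the membership, applies it to the actual value of [t]. *)
Lemma bind_all : bT = p ->
  ex (gtask Lf d K (bT :: tT) tG p) = ltr
    [:: tE (TOK [:: 9; 5; 1; 6]); tTm (rawterm u) (rKt K) (tn (size C));
        tE (TOK [:: 9; 9; 5; 1; 6; 9; 5; 0; 0; 5]); tTm (rawterm t) (rKt K1) (tn (size C).+1);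
        tE (TOK [:: 5; 1]); gtask Lf d1 K1 (bT :: tT) tG p] Lf ->
  (forall Ur (r r' : env Ur G), sat (fun b => b = ~~ p) q (bT :: tT) tG r ->
     (forall T' (x : var G T'), clean (~~ p) K x -> lookup x r' = lookup x r) ->
     (teval r u : set (obj Ur T)) (teval r' t) ->
     sat (fun b => b = ~~ p) q1 (bT :: tT) tG r') ->
  (forall Ur (r : env Ur G), sat (fun b => b = p) q (bT :: tT) tG r ->
     sat (fun b => b = p) q1 (bT :: tT) tG r /\ (gholds g1 r -> gholds g r)) ->
  thA d K (bT :: tT) tG p.
Proof.
move=> Eb He Hs1 Hs2.
have [eu Seu Eeu] := @tm_at get _ _ _ _ _ _ _ _ _ _ _ Hi su Hu.
have [et Set_ Eet] := @tm_at get _ _ _ _ _ _ _ _ _ _ _ Hi1 st1 (kbind_com Hi Ht).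
have [th Sth Eth] := H1.
exists (NDiff (ntop get C) (NBigU eu (NDiff (neq (NVar get VZ) et) th))).
  move=> Ur u0 dflt c r Ha.
  rewrite tru_all (Seu _ _ _ _ Ha).
  split=> [S z Hz /tru_eq Ez|S Tz].
    have [r' Ha' Hr'] := kbind_env Hi z Ha.
    rewrite (Set_ _ _ _ _ Ha') /= in Ez.
    apply: (Sth _ u0 _ _ _ Ha').1; apply: (Hs1 _ _ _ S); last by rewrite -Ez.
    by move=> T' x h; apply: Hr'; rewrite Eb.
  have Ha1 := kbind_agree (t := t) Ha erefl.
  have [S' G'] := Hs2 _ _ S; apply: G'; apply: ((Sth _ u0 _ _ _ Ha1).2 S').
  by apply: Tz; [case: S => /= -[/(_ Eb)]|apply/tru_eq; rewrite (Set_ _ _ _ _ Ha1)].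
have E := emits_cons (W [:: 9; 5; 1; 6]) (emits_cons Eeu (emits_cons (W [:: 9; 9; 5; 1; 6; 9; 5; 0; 0; 5])
   (emits_cons Eet (emits_cons (W [:: 5; 1]) Eth)))).
apply: (emits_le _ (emits_gen _ Hi He (emits_eq E _))) => //; last by weq.
have hq := QQ_ge B; move: QQ_pos hq Hsz; move: (Q1 B * B) (tsz (rawderiv d)) (tsz (rawderiv d1)) => x n n1.
by nia.
Qed.
End BindTh.

Lemma gen_inset G Th Ga T (t u : term G (TSet T)) v (d1 : deriv (Sequent (Mem t v :: Th) Ga (GEq t u))) :
  thS d1 -> vS d1 -> thS (DInSetR d1) /\ vS (DInSetR d1).
Proof.
move=> H1 H1'; apply: spec_at => C K J [|b tT] tG p Hi; first by have := iT Hi.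
have Hsz : tsz (rawderiv d1) + tsz (rawterm t) + tsz (rawterm v) + 20 < tsz (rawderiv (DInSetR d1)).
  by rewrite /=; lia.
have [ct cv] : tv (clean b K) t /\ tv (clean b K) v by case: Hi => _ _ [[]].
(* The other alternative of [aJ] concerns elements of type [TUr], whereas [t] is a set. *)
have Tt : tup t by case: Hi => _ _ [[_ [[]|[]]]].
have Hi0 : inv B (Sequent (Mem t v :: Th) Ga (GEq t u)) K J (b :: tT) tG (tsz (rawderiv d1)).
  by have [|? ? ? ? ? ?] := @inv_sz _ _ _ _ _ _ _ _ _ (tsz (rawderiv d1)) _ Hi; first by lia.
have He m : ex (gtask m (DInSetR d1) K (b :: tT) tG p) =
  tif m (tif (txnor (Nd (tb b) (tb p)))
           (ltr [:: tE (TOK [:: 5]); gtask m d1 K (b :: tT) tG p] Lf)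
           (ltr [:: tTm (rawterm v) (rKt K) (tn (size C))] Lf))
        (tif (txnor (Nd (tb b) (tb p))) (ltr [:: gtask m d1 K (b :: tT) tG p] Lf)
           (ltr [:: tE (TOK [:: 6]); tTm (rawterm v) (rKt K) (tn (size C));
             tE (TOK [:: 9; 9; 5; 1; 6; 9; 5; 0; 0; 5]); tTm (rawterm t) (rKt (kbind t K)) (tn (size C).+1);
             tE (TOK [:: 5; 1; 9; 5; 1]); gtask Lf d1 (kbind t K) (b :: tT) tG p] Lf)).
  by rewrite /gtask !kbind_E.
split=> -[gu gv].
- move: (He Lf); rewrite tif_Lf tif_txnor; case: eqP => [Eb|Nb] {}He.
    apply: (same_th (d1 := d1) Hi _ He); first by lia.
    + by move=> Ur u0 r c Ha S; exists r.
    + by move=> Ur u0 r c Ha S /(_ r Ha S) /= <-; case: S => /= -[/(_ Eb)].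
    + by apply: H1 Hi0 _; split=> //; rewrite -Eb.
  have Eb := bool_neq Nb.
  have Hi1 : inv B (Sequent (Mem t v :: Th) Ga (GEq t u)) (kbind t K) J (b :: tT) tG (tsz (rawderiv d1)).
    have Hk : tsz (rawderiv d1) + tsz (rawterm t) < tsz (rawderiv (DInSetR d1)) by lia.
    have [? ? ? ? ? ?] := kbind_inv Hi Tt Hk. by split.
  have A1 : thA d1 (kbind t K) (b :: tT) tG p.
    apply: H1 Hi1 _; split; first by apply: com_clean; exact: (kbind_com Hi Tt).
    by apply: tv_impl gu => T' x; exact: (kbind_clean Hi).
  apply: (bind_ex Hi Tt _ Hsz Hi1 A1 Eb He) => //.
    by apply: clean_com gv _; rewrite -Eb.
  move=> Ur r r' S Hr Hz; split.
    by have [S1 S2] := sat_same Hi S Hr.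
  by move=> /= E; rewrite -(teval_same gu Hr) -E.
- move: (He (Nd Lf Lf)); rewrite tif_Nd tif_txnor; case: eqP => [Eb|Nb] {}He.
    have [||e Se Ee] := H1' _ _ _ _ _ p Hi0 => //.
      by split=> //; rewrite -Eb.
    exists (NSing (T := TSet T) e).
      move=> Ur u0 dflt c r Ha S /=; rewrite (Se _ u0 _ _ _ Ha S) /=.
      by rewrite (sat_sound d1 Hi0 S).
    have E := emits_cons (W [:: 5]) Ee.
    by apply: (emits_le _ (emits_gen _ Hi He (emits_eq E _))) => //; nia.
  have Eb := bool_neq Nb; rewrite Eb in cv.
  have sv : tsz (rawterm v) <= tsz (rawsequent (Sequent (Mem t v :: Th) Ga (GIn u v))) by rewrite /=; lia.
  have [ev Sev Eev] := @tm_at get _ _ _ _ _ _ _ _ _ _ _ Hi sv (clean_com gv cv).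
  exists ev; first by move=> Ur u0 dflt c r Ha S; rewrite /= (Sev _ _ _ _ Ha); exact: (sat_sound (DInSetR d1) Hi S).
  apply: (emits_le _ (emits_gen _ Hi He Eev)) => //.
  have hq := QQ_ge B; have hC := iC Hi; have hd := deriv_gt20 (DInSetR d1).
  by apply: cost_v => //; move: (Q1 B * B) hq => x; lia.
Qed.

Section All.
Variables (G : ctx) (Th : seq (atom G)) (Ga : seq (form G)) (T : ty) (t : term G T) (z : var G (TSet T)).
Variables (f : form (T :: G)) (g : goal G).
Let q := Sequent (Mem t (Var z) :: Th) (FAll (Var z) f :: Ga) g.
Let q1 := Sequent (Mem t (Var z) :: Th) (fsubst (scons t (@ids G)) f :: Ga) g.
Variables (C : ctx) (K : kmap G C) (J : vpred G) (b b' : bool) (tT tG : seq bool) (N : nat).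
Hypothesis Hi : inv B q K J (b :: tT) (b' :: tG) N.

Lemma all_clean : [/\ clean b K z, clean b' K z & tv (clean b K) t].
Proof. by case: Hi => _ _ /= [[[? ?] _] _] [[[? ?] _] _]. Qed.

(** The second alternative of [aJ] would put [z] in [J], but [z] occurs in the quantified formula
    and hypotheses avoid [J]. *)
Lemma all_notJ : tup t /\ tv (fun T x => ~ @J T x) t.
Proof. by case: Hi => _ _ /= [[_ [//|[_ Jz]]] _] [[_ [nz _]] _]. Qed.

(** The instance contains [t] and keeps the side of the formula; this is what forces the variables
    of [t] to be common when its membership is on the other side. *)
Lemma all_inv C1 (K1 : kmap G C1) N1 : inv B q K1 J (b :: tT) (b' :: tG) N1 -> tv (clean b' K1) t ->
  inv B q1 K1 J (b :: tT) (b' :: tG) N1.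
Proof.
case=> h1 h2 h3 [[[cz cf] [nz nf]] h4'] h5 h6 ct; split=> //; split=> //=; split; apply/fv_subst.
  by apply: fv_impl cf; apply: var_case.
by apply: fv_impl nf; apply: var_case => // _; exact: all_notJ.2.
Qed.

Lemma all_sat (s : bool) Ur (r r' : env Ur G) : sat (fun c => c = s) q (b :: tT) (b' :: tG) r ->
  (forall T' (x : var G T'), clean s K x -> lookup x r' = lookup x r) ->
  (lookup z r : set (obj Ur T)) (teval r' t) ->
  sat (fun c => c = s) q1 (b :: tT) (b' :: tG) r'.
Proof.
move=> S Hr Hz; have [S1 [S2 S3]] := sat_same Hi S Hr; split=> //; split=> // Eb /=.
apply/(holds_subst _ (sub_scons t (sub_ids r'))); apply: (S2 Eb) => /=.
by rewrite Hr // -Eb; case: all_clean.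
Qed.
End All.

Lemma gen_all G Th Ga T (t : term G T) (z : var G (TSet T)) f T' (v : term G T') w
   (d1 : deriv (Sequent (Mem t (Var z) :: Th) (fsubst (scons t (@ids G)) f :: Ga) (GIn v w))) :
  thS d1 -> vS d1 -> thS (DAllL d1) /\ vS (DAllL d1).
Proof.
move=> H1 H1'; apply: spec_at => C K J [|b tT] [|b' tG] p Hi; try by [have := iT Hi|have := iG Hi].
have Hsz : tsz (rawderiv d1) + tsz (rawterm t) + tsz (rawterm (Var z)) + 20 < tsz (rawderiv (DAllL d1)).
  by rewrite /=; lia.
have [cz cz' ct] := all_clean Hi; have [Tt _] := all_notJ Hi.
have He m : ex (gtask m (DAllL d1) K (b :: tT) (b' :: tG) p) =
  tif (txnor (Nd (tb b) (tb b'))) (ltr [:: gtask m d1 K (b :: tT) (b' :: tG) p] Lf)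
  (tif m (ltr [:: tE (TOK [:: 6]); tTm (rawterm (Var z)) (rKt K) (tn (size C));
                  gtask (Nd Lf Lf) d1 (kbind t K) (b :: tT) (b' :: tG) p] Lf)
    (tif (txnor (Nd (tb b') (tb p)))
      (ltr [:: tE (TOK [:: 6]); tTm (rawterm (Var z)) (rKt K) (tn (size C));
        tE (TOK [:: 9; 9; 5; 1; 6; 9; 5; 0; 0; 5]); tTm (rawterm t) (rKt (kbind t K)) (tn (size C).+1);
        tE (TOK [:: 5; 1; 9; 5; 1]); gtask Lf d1 (kbind t K) (b :: tT) (b' :: tG) p] Lf)
      (ltr [:: tE (TOK [:: 9; 5; 1; 6]); tTm (rawterm (Var z)) (rKt K) (tn (size C));
        tE (TOK [:: 9; 9; 5; 1; 6; 9; 5; 0; 0; 5]); tTm (rawterm t) (rKt (kbind t K)) (tn (size C).+1);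
        tE (TOK [:: 5; 1]); gtask Lf d1 (kbind t K) (b :: tT) (b' :: tG) p] Lf))).
  by rewrite /gtask !kbind_E.
case: (eqVneq b b') He => [Eb|/eqP Nb] He.
  subst b'.
  have He1 m : ex (gtask m (DAllL d1) K (b :: tT) (b :: tG) p) = ltr [:: gtask m d1 K (b :: tT) (b :: tG) p] Lf.
    by rewrite He tif_txnor eqxx.
  have Hsz1 : tsz (rawderiv d1) < tsz (rawderiv (DAllL d1)) by lia.
  apply: (same_at (d1 := d1) (K1 := K) (J1 := J) (tT1 := b :: tT) (tG1 := b :: tG) Hi Hsz1) => //.
  - by apply: (all_inv Hi) => //; exact: inv_sz (ltnW Hsz1) Hi.
  - move=> Ur u0 P r c _ Ha [[S0 S1] [S2 S3]]; exists r; split=> //; split=> //; split=> // Pb /=.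
    by apply/(holds_subst _ (sub_scons t (sub_ids r))); apply: (S2 Pb); exact: S0 Pb.
have zc : tv (com K) (Var z).
  by move: cz cz'; rewrite /= /clean /com; case: (K _ z) => // b0 ->.
have Hk : tsz (rawderiv d1) + tsz (rawterm t) < tsz (rawderiv (DAllL d1)) by lia.
have Hi1 := all_inv Hi (kbind_inv Hi Tt Hk) (com_clean b' (kbind_com Hi Tt)).
split=> -[gv gw].
- have A1 : thA d1 (kbind t K) (b :: tT) (b' :: tG) p.
    apply: H1 Hi1 _; split; first by apply: tv_impl gv => T0 x; exact: (kbind_clean Hi).
    by apply: tv_impl gw => T0 x; exact: (kbind_clean Hi).
  move: (He Lf); rewrite tif_Lf !tif_txnor; case: eqP => // _; case: eqP => [Eb|Nb'] {}He.
    subst b'; have Eb := bool_neq Nb.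
    apply: (bind_ex Hi Tt zc Hsz Hi1 A1 Eb He).
      by move=> Ur r [S1 [_ S2]]; split=> //; split=> // /negb_neq; apply.
    move=> Ur r r' S Hr Hz; split; first exact: (all_sat Hi S Hr Hz).
    by rewrite /= (teval_same gv Hr) (teval_same gw Hr).
  have Eb' := bool_neq Nb'; subst b'; have Eb : b = p by case: (b) (p) Nb => [] [].
  apply: (bind_all Hi Tt zc Hsz Hi1 A1 Eb He).
    by move=> Ur r r' S Hr Hz; exact: (all_sat Hi S Hr Hz).
  move=> Ur r [S1 [_ S2]]; split=> //; split=> //; split=> // E; by apply: (@negb_neq p).
- move: (He (Nd Lf Lf)); rewrite tif_Nd tif_txnor; case: eqP => // _ {}He.
  have [||e Se Ee] := H1' _ _ _ _ _ p Hi1 => //.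
    split; first by apply: tv_impl gv => T0 x; exact: (kbind_clean Hi).
    by apply: tv_impl gw => T0 x; exact: (kbind_clean Hi).
  have sz : tsz (rawterm (Var z)) <= tsz (rawsequent (Sequent (Mem t (Var z) :: Th) (FAll (Var z) f :: Ga) (GIn v w))).
    by rewrite /=; lia.
  have [ez Sez Eez] := @tm_at get _ _ _ _ _ _ _ _ _ _ _ Hi sz zc.
  exists (NBigU (A := T) (B := T') ez e).
    move=> Ur u0 dflt c r Ha S /=; exists (teval r t).
      by rewrite (Sez _ _ _ _ Ha); case: S => -[/(_ I)].
    apply: (Se Ur u0 dflt _ _ (kbind_agree (t := t) Ha erefl)).
    case: S => -[S0 S1] [S2 S3]; split=> //; split=> // _ /=.
    by apply/(holds_subst _ (sub_scons t (sub_ids r))); apply: (S2 I); exact: S0 I.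
  have E := emits_cons (W [:: 6]) (emits_cons Eez Ee).
  apply: (emits_le _ (emits_gen _ Hi He (emits_eq E _))) => //.
  have hq := QQ_ge B; have hR := RR_ge B; move: QQ_pos RR_pos hR Hsz hq.
  move: (Q1 B * B) (tsz (rawderiv (DAllL d1))) (tsz (rawderiv d1)) => x n n1.
  by nia.
Qed.

Section EqSubst.
Variables (G : ctx) (Th : seq (atom G)) (Ga : seq (form G)) (x y : var G TUr).
Variables (T : ty) (v : term G T) (w : term G (TSet T)).
Let q0 := Sequent Th Ga (GIn v w).
Let s := upd x (Var y) (@ids G).
Variables (d1 : deriv (ssubst s q0)) (C : ctx) (K : kmap G C) (J : vpred G) (b : bool) (tT tG : seq bool) (p : bool).
Let d := DEqSubst d1.
Hypothesis Hi : inv B (Sequent Th (FEq (Var x) (Var y) :: Ga) (GIn v w)) K J tT (b :: tG) (tsz (rawderiv d)).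
Hypotheses (H1 : thS d1) (H1' : vS d1).

Let Hsz : tsz (rawderiv d1) + 20 < tsz (rawderiv d).
Proof. by rewrite /d /=; move: (rawderiv d1) => z; lia. Qed.

Let Hi0 : inv B q0 K J tT tG (tsz (rawderiv d)).
Proof. by case: Hi => ? [?] ? [_ ?] ? ?; split. Qed.

Let Hxy : [/\ clean b K x, clean b K y, ~ J x & ~ J y].
Proof. by case: Hi => _ _ _ [[[? ?] [? ?]] _]. Qed.

Lemma eqsubst_inv (K1 : kmap G C) : (forall c T' (z : var G T'), clean c K z -> tv (clean c K1) (s z)) ->
  (forall T' (z : var G T'), tsz (rk (K1 T' z)) + 12 * tsz (rawderiv d1) <= B) ->
  inv B (ssubst s q0) K1 J tT tG (tsz (rawderiv d1)).
Proof.
move=> Hc HK; have [_ _ nx ny] := Hxy.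
apply: (inv_subst _ Hi0) => //; first by lia.
- by apply: (@upd_ind _ _ _ _ (fun T y v => ~ @J T y -> tup v /\ tv (fun T0 x0 => ~ @J T0 x0) v)).
- by apply: (@upd_ind _ _ _ _ (fun T y v => @J T y -> tv J v)).
Qed.

Lemma eqsubst_refl Ur (r : env Ur G) : lookup x r = lookup y r -> sub_ok s r r.
Proof. by move=> E; apply: sub_upd. Qed.

(** Here [y] is private to the same side as [x] or common, so replacing [x] by [y] moves no formula
    to another side. *)
Lemma gen_eqsubst_side b0 : K x = KS b0 ->
  (gv (clean p K) (GIn v w) -> thA d K tT (b :: tG) p) /\ (vclean p K (GIn v w) -> vA d K tT (b :: tG) p).
Proof.
move=> Ex; have [cx cy _ _] := Hxy; move: (cx); rewrite /clean Ex => Eb; subst b0.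
have Hsz1 : tsz (rawderiv d1) < tsz (rawderiv d) by lia.
have Hc c : forall T' (z : var G T'), clean c K z -> tv (clean c K) (s z).
  apply: (@upd_ind _ _ _ _ (fun T' z a => clean c K z -> tv (clean c K) a)) => //=.
  by rewrite {1}/clean Ex => <-.
have He m : ex (gtask m d K tT (b :: tG) p) = ltr [:: gtask m d1 K tT tG p] Lf.
  rewrite -[ex _]/(x_eqsubst (gtask m d K tT (b :: tG) p)) /x_eqsubst.
  have -> : eqv_ (gtask m d K tT (b :: tG) p) = cdr (rk (K x)) by rewrite -nth_rK -tnth_E.
  by rewrite Ex; case: (b).
apply: (same_at (d1 := d1) (K1 := K) (J1 := J) (tT1 := tT) (tG1 := tG) Hi Hsz1) => //.
- by apply: eqsubst_inv => // T' z; have := iK Hi z; lia.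
- by move=> c; split=> H; apply/tv_subst; apply: tv_impl H => T' z; exact: Hc.
move=> Ur u0 P r c Hp Ha [S1 [S2 S3]]; exists r.
have Hl e : P e -> forall T' (z : var G T'), clean e K z -> teval r (s z) = lookup z r.
  move=> Pe; apply: (@upd_ind _ _ _ _ (fun T' z a => clean e K z -> teval r a = lookup z r)) => //=.
  by rewrite {1}/clean Ex => E; subst e; symmetry; exact: (S2 Pe).
split=> //; first by apply: (sat_subst _ Hi0 _ (conj S1 S3)) => e T' z Pe; exact: Hl.
move=> Pp; case: Hp => [AP|[gv gw]]; last by rewrite !(teval_subst_on (Hl _ Pp)).
have W := eqsubst_refl (S2 (AP b)).
by rewrite !(teval_subst _ W).
Qed.

Section Com.
Variable e : term C TUr.
Hypothesis Ex : K x = KC e.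
Let K1 := ksetif y e K.

Let K1x : kincl b K K1.
Proof. by apply: ksetif_incl; case: Hxy. Qed.

Let cy1 : com K1 y.
Proof. exact: ksetif_com. Qed.

Let Hc c : forall T' (z : var G T'), clean c K z -> tv (clean c K1) (s z).
Proof.
apply: (@upd_ind _ _ _ _ (fun T' z a => clean c K z -> tv (clean c K1) a)) => //= [_|T' z].
  exact: (@com_clean c _ _ K1 _ (Var y) cy1).
exact: kincl_clean K1x.
Qed.

Let Hi1 : inv B (ssubst s q0) K1 J tT tG (tsz (rawderiv d1)).
Proof.
apply: eqsubst_inv => // T' z; have := iK Hi z; have := iK Hi x; rewrite Ex.
rewrite /K1 /ksetif; case: (K y) => [b'|e'] hx hz; last by lia.
move: T' z hz; apply: (@vupd_ind _ _ _ _ (fun T' z k => tsz (rk (K z)) + 12 * tsz (rawderiv d) <= B ->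
  tsz (rk k) + 12 * tsz (rawderiv d1) <= B)) => [|T' z] hz; lia.
Qed.

Lemma eqsubst_agree Ur (r : env Ur G) c : agree K r c -> lookup x r = lookup y r -> agree K1 r c.
Proof. by move=> Ha E; apply: agree_ksetif => //; have := Ha _ x; rewrite Ex -E. Qed.

(** If [y] was private, it is private to side [b], so the other side keeps its values when [y] is
    reset to fit the term of [x]. *)
Lemma eqsubst_override Ur (r : env Ur G) c : agree K r c ->
  exists2 r' : env Ur G, agree K1 r' c & lookup x r = lookup y r' ->
    forall T' (z : var G T'), clean (~~ b) K z -> teval r' (s z) = lookup z r.
Proof.
move=> Ha; have [r' Ha' Hr'] := override K1x Ha; exists r' => // E.
by apply: (@upd_ind _ _ _ _ (fun T' z a => clean (~~ b) K z -> teval r' a = lookup z r)).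
Qed.

Lemma eqsubst_ex m : ex (gtask m d K tT (b :: tG) p) =
  tif m (ltr [:: gtask m d1 K1 tT tG p] Lf)
    (tif (txnor (Nd (tb b) (tb p)))
      (ltr [:: tE (TOK [:: 9; 5; 1; 9; 9; 5; 1; 6; 9; 5]); tTm (rawterm (Var x)) (rKt K) (tn (size C));
               tE (TOK [:: 5]); tTm (rawterm (Var y)) (rKt K1) (tn (size C)); tE (TOK [:: 5; 1]);
               gtask m d1 K1 tT tG p] Lf)
      (ltr [:: tE (TOK [:: 9; 9; 5; 1; 6; 9; 5]); tTm (rawterm (Var x)) (rKt K) (tn (size C));
               tE (TOK [:: 5]); tTm (rawterm (Var y)) (rKt K1) (tn (size C)); tE (TOK [:: 5; 1; 9; 5; 1]);
               gtask m d1 K1 tT tG p] Lf)).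
Proof.
rewrite -[ex _]/(x_eqsubst (gtask m d K tT (b :: tG) p)) /x_eqsubst.
have Ee : eqv_ (gtask m d K tT (b :: tG) p) = rlev e.
  rewrite -[eqv_ _]/(cdr (tnth_ (Nd (tn (var_index x)) (rKt K)))).
  by rewrite tnth_E nth_rK Ex.
have -> : set_ (gtask m d K tT (b :: tG) p) = rKt K1 by rewrite /set_ Ee -setif_E.
by rewrite Ee {1}/tif isN_rlev.
Qed.

Lemma gen_eqsubst_com :
  (gv (clean p K) (GIn v w) -> thA d K tT (b :: tG) p) /\ (vclean p K (GIn v w) -> vA d K tT (b :: tG) p).
Proof.
split=> -[gv gw].
- have [|th Sth Eth] := H1 Hi1 (p := p).
    by split; apply/tv_subst; [apply: tv_impl gv|apply: tv_impl gw] => T' z; exact: Hc.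
  have sx : tsz (rawterm (Var x)) <= tsz (rawsequent (Sequent Th (FEq (Var x) (Var y) :: Ga) (GIn v w))).
    by rewrite /=; lia.
  have sy : tsz (rawterm (Var y)) <= tsz (rawderiv d).
    by rewrite /d /=; lia.
  have cx : tv (com K) (Var x) by rewrite /= /com Ex.
  have [ex Sex Eex] := @tm_at get _ _ _ _ _ _ _ _ _ _ _ Hi sx cx.
  have [ey Sey Eey] : exists2 e : nrc get C TUr,
    (forall Ur (dflt : get -> Ur) r c, agree K1 r c -> neval dflt e c = lookup y r) &
    emits (TB B) (Q1 B * B) [:: tTm (rawterm (Var y)) (rKt K1) (tn (size C))] (enc_nrc e).
    have Hd := tsz_deriv d; have hC := iC Hi.
    have [||||| ey [E1 E2]] := @emits_tm get B _ _ K1 _ (Var y) _ _ _ _ _ cy1.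
    - by move=> T' z; have := iK Hi1 z; lia.
    - exact: K_size Hi1.
    - by lia.
    - by move=> T' z; have := iK Hi1 z; have := tsz_deriv d1; lia.
    - by lia.
    - by exists ey => //; apply: emits_le E2; apply: leq_mul => //; lia.
  have cost : 500 + 2 * (Q1 B * B) + tsz (rawderiv d1) * QQ B < tsz (rawderiv d) * QQ B.
    have hq := QQ_ge B; move: QQ_pos hq Hsz; move: (Q1 B * B) (tsz (rawderiv d)) (tsz (rawderiv d1)) => z n n1.
    by nia.
  have Eq0 Ur (r : env Ur G) P : sat P (Sequent Th (FEq (Var x) (Var y) :: Ga) (GIn v w)) tT (b :: tG) r ->
     sat P q0 tT tG r by case=> S1 [_ S3].
  move: (eqsubst_ex Lf); rewrite tif_Lf tif_txnor; case: eqP => [Eb|Nb] He.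
  + exists (nimp (neq ex ey) th).
      move=> Ur u0 dflt c r Ha; rewrite tru_imp tru_eq (Sex _ _ _ _ Ha); split=> [S E|S Tt].
        have [r' Ha' Hr'] := eqsubst_override Ha.
        apply: (Sth _ u0 _ _ _ Ha').1; apply: (sat_subst _ Hi0 _ (Eq0 _ _ _ S)) => b0 T' z -> cz.
        by apply: Hr'; rewrite ?Eb // -(Sey _ dflt _ _ Ha') -E.
      have Exy : lookup x r = lookup y r by case: S => _ [/(_ Eb)].
      have Ha' := eqsubst_agree Ha Exy; have W := eqsubst_refl Exy.
      have := (Sth _ u0 dflt _ _ Ha').2; rewrite /= !(teval_subst _ W); apply.
        by apply: (sat_subst _ Hi0 _ (Eq0 _ _ _ S)) => b0 T' z _ _; exact: W.
      by apply: Tt; rewrite (Sey _ dflt _ _ Ha').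
    have E := emits_cons (W [:: 9; 5; 1; 9; 9; 5; 1; 6; 9; 5]) (emits_cons Eex (emits_cons (W [:: 5])
      (emits_cons Eey (emits_cons (W [:: 5; 1]) Eth)))).
    by apply: (emits_le _ (emits_gen _ Hi He (emits_eq E _))) => //; [lia|weq].
  have Eb := bool_neq Nb.
  exists (nand (neq ex ey) th).
    move=> Ur u0 dflt c r Ha; rewrite tru_and tru_eq (Sex _ _ _ _ Ha); split=> [S|S [E Tt]].
      have Exy : lookup x r = lookup y r by case: S => _ [/(_ Eb)].
      have Ha' := eqsubst_agree Ha Exy; have W := eqsubst_refl Exy.
      split; first by rewrite (Sey _ dflt _ _ Ha').
      apply: (Sth _ u0 _ _ _ Ha').1.
      by apply: (sat_subst _ Hi0 _ (Eq0 _ _ _ S)) => b0 T' z _ _; exact: W.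
    have [r' Ha' Hr'] := eqsubst_override Ha.
    have {}Hr' : forall T' (z : var G T'), clean p K z -> teval r' (s z) = lookup z r.
      by move: Hr'; rewrite Eb negbK; apply; rewrite -(Sey _ dflt _ _ Ha') -E.
    have := (Sth _ u0 dflt _ _ Ha').2; rewrite /= !(teval_subst_on Hr') //; apply=> //.
    by apply: (sat_subst _ Hi0 _ (Eq0 _ _ _ S)) => b0 T' z -> ; exact: Hr'.
  have E := emits_cons (W [:: 9; 9; 5; 1; 6; 9; 5]) (emits_cons Eex (emits_cons (W [:: 5])
      (emits_cons Eey (emits_cons (W [:: 5; 1; 9; 5; 1]) Eth)))).
  by apply: (emits_le _ (emits_gen _ Hi He (emits_eq E _))) => //; [lia|weq].
- have [||e' Se Ee] := H1' Hi1 (p := p) => //.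
    by split; apply/tv_subst; [apply: tv_impl gv|apply: tv_impl gw] => T' z; exact: Hc.
  move: (eqsubst_ex (Nd Lf Lf)); rewrite tif_Nd => He.
  exists e'.
    move=> Ur u0 dflt c r Ha [S1 [S2 S3]].
    have Exy : lookup x r = lookup y r by exact: S2.
    have Ha' := eqsubst_agree Ha Exy; have W := eqsubst_refl Exy.
    have := Se Ur u0 dflt _ _ Ha'; rewrite /= !(teval_subst _ W); apply.
    by apply: (sat_subst _ Hi0 _ (conj S1 S3)) => b0 T' z _ _; exact: W.
  by apply: (emits_le _ (emits_gen _ Hi He Ee)) => //; nia.
Qed.
End Com.
End EqSubst.

Lemma gen_eqsubst G Th Ga (x y : var G TUr) T (v : term G T) w
    (d1 : deriv (ssubst (upd x (Var y) (@ids G)) (Sequent Th Ga (GIn v w)))) :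
  thS d1 -> vS d1 -> thS (DEqSubst d1) /\ vS (DEqSubst d1).
Proof.
move=> H1 H1'; apply: spec_at => C K J tT [|b tG] p Hi; first by have := iG Hi.
case Ex : (K _ x) => [b0|e]; first exact: (gen_eqsubst_side p Hi H1 H1' Ex).
exact: (gen_eqsubst_com p Hi H1 H1' Ex).
Qed.

Theorem gen_all_rules G (q : sequent G) (d : deriv q) : thS d /\ vS d.
Proof.
elim: d => {G q}.
- by move=> G Th Ga Th' Ga' g P1 P2 d [? ?]; exact: gen_exch.
- by move=> G Th Ga f T t u d [? ?]; exact: gen_contr.
- by move=> G Th Ga t u; exact: gen_inur.
- by move=> G Th Ga T t u d1 [? ?] d2 [? ?]; exact: gen_eqset.
- by move=> G Th Ga A A' t u d1 [? ?] d2 [? ?]; exact: gen_eqprod.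
- by move=> G Th Ga t u; exact: gen_equnit.
- by move=> G Th Ga t u d1 [? ?]; exact: gen_equr.
- by move=> G Th Ga T t u d1 [? ?]; exact: gen_sub.
- by move=> G Th Ga T t u v d1 [? ?]; exact: gen_inset.
- by move=> G Th Ga T t u; apply: gen_false => // Ur r [].
- by move=> G Th Ga f1 f2 T t u d1 [? ?]; exact: gen_and.
- by move=> G Th Ga f1 f2 T t u d1 [? ?] d2 [? ?]; exact: gen_or.
- by move=> G Th Ga T t z f T' v w d1 [? ?]; exact: gen_all.
- by move=> G Th Ga T y f T' t v d1 [? ?]; exact: gen_ex.
- by move=> G Th Ga x y T v w d1 [? ?]; exact: gen_eqsubst.
- by move=> G Th Ga t T u v; apply: gen_false => // Ur r [].
- by move=> G A A' t1 t2 Th Ga T t u d1 [? ?]; exact: gen_beta1.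
- by move=> G A A' t1 t2 Th Ga T t u d1 [? ?]; exact: gen_beta2.
- by move=> G A A' x Th Ga T t u d1 [? ?]; exact: gen_eta.
Qed.
End Gen2.

(** * The theorem *)

Section Naturality.
Variables (U V : Type) (f : U -> V).
Hypothesis f_inj : injective f.

Fixpoint jo T : obj U T -> obj V T :=
  match T return obj U T -> obj V T with
  | TUr => f
  | TProd A B => fun x => (jo x.1, jo x.2)
  | TUnit => id
  | TSet A => fun s => (@jo A @` (s : set (obj U A)))%classic
  end.

Fixpoint je G : env U G -> env V G :=
  match G return env U G -> env V G with
  | [::] => id
  | A :: G' => fun r => (jo r.1, je r.2)
  end.

Lemma jo_inj T : injective (@jo T).
Proof.
elim: T => [|A IA B IB||A IA] //= x y.
- by case: x y => [a b] [a' b'] /= [/IA -> /IB ->].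
- have H (s s' : set (obj U A)) : (@jo A @` s)%classic = (@jo A @` s')%classic -> subset s s'.
    by move=> E z Hz; have [z' Hz' /IA <-] : (@jo A @` s')%classic (jo z) by rewrite -E; exists z.
  by move=> E; rewrite eqEsubset; split; apply: H.
Qed.

Lemma lookup_je G T (x : var G T) (r : env U G) : lookup x (je r) = jo (lookup x r).
Proof. by elim: x r => //= G' T' A x IH [a r]; exact: IH. Qed.

Lemma teval_je G T (t : term G T) (r : env U G) : teval (je r) t = jo (teval r t).
Proof.
by elim: t => //= [T' x|A B t -> u ->|A B t ->|A B t ->] //; exact: lookup_je.
Qed.

(** The quantifiers are bounded by images, so elements outside the range of [f] are never
    reached. *)
Lemma holds_je G (g : form G) (r : env U G) : holds g (je r) <-> holds g r.
Proof.
elim: g r => {G} /= [G t u|G t u|G|G|G g IF g' IG|G g IF g' IG|G T t g IF|G T t g IF] r //;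
  rewrite ?teval_je ?IF ?IG //.
- by split=> [/f_inj|->].
- by split=> H E; apply: H; [rewrite E|exact: f_inj].
- split=> [H x Hx|H _ [x Hx <-]].
    by apply/(IF ((x, r) : env U (T :: G))); apply: H; exists x.
  by apply/(IF ((x, r) : env U (T :: G))); apply: H.
- split=> [[_ [x Hx <-]]|[x Hx]] /(IF ((x, r) : env U (T :: G))) H; first by exists x.
  by exists (jo x) => //; exists x.
Qed.

Lemma unique_elt_inj (s : set U) d : unique_elt (f @` s)%classic (f d) = f (unique_elt s d).
Proof.
have [[x ->]|N] := EM (exists x, s = [set x]%classic).
  by rewrite image_set1 !unique_elt1.
rewrite /unique_elt; case: pselect => [h|_]; last by case: pselect.
case: N; case: h => y E.
have [x Hx Ex] : (f @` s)%classic y by rewrite E.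
exists x; rewrite eqEsubset; split=> [z Hz|_ -> //].
have : (f @` s)%classic (f z) by exists z.
by rewrite E /= -Ex => /f_inj.
Qed.

(** Difference commutes with images because [jo] is injective at every type, and extraction because
    an image is a singleton only if the set is. *)
Lemma neval_je (get : bool) (dflt : get -> U) G T (e : nrc get G T) (r : env U G) :
  neval (fun h => f (dflt h)) e (je r) = jo (neval dflt e r).
Proof.
elim: e r => {G T} /= [G T x|G|G A B e1 I1 e2 I2|G A B e1 I1|G A B e1 I1|G T e1 I1|G A B e1 I1 e2 I2
  |G T|G T e1 I1 e2 I2|G T e1 I1 e2 I2|G h e1 I1] r; rewrite ?I1 ?I2 //.
- exact: lookup_je.
- by rewrite image_set1.
- rewrite eqEsubset; split=> y.
    case=> _ [x Hx <-]; rewrite (I2 ((x, r) : env U (A :: G))) => -[z Hz <-].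
    by exists z => //; exists x.
  case=> z [x Hx Hz] <-; exists (jo x); first by exists x.
  by rewrite (I2 ((x, r) : env U (A :: G))); exists z.
- by rewrite image_set0.
- by rewrite image_setU.
- rewrite eqEsubset; split=> y.
    by case=> -[x Hx <-] N; exists x => //; split=> // Hx'; apply: N; exists x.
  by case=> x [Hx N] <-; split; [exists x|case=> z Hz /jo_inj E; apply: N; rewrite -E].
- exact: unique_elt_inj.
Qed.
End Naturality.

Lemma tv_all G (P : vpred G) A (t : term G A) : (forall A x, P A x) -> tv P t.
Proof. by move=> H; elim: t => /=. Qed.

Lemma fv_all G (g : form G) (P : vpred G) : (forall A x, P A x) -> fv g P.
Proof.
elim: g P => {G} //= [G t u|G t u|G f IF g IG|G f IF g IG|G T t f IF|G T t f IF] P H;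
  (split; try exact: tv_all; auto); by apply: IF; apply: var_case.
Qed.

(** * The sides of the definability sequent *)

Section Initial.
Variables (Tin T : ty) (As : ctx).
Notation C := [:: Tin].
Notation TA := (T :: As).
Notation D := (Tin :: TA ++ TA).

(** [o_in] is the only common variable; the first [size TA] of the remaining variables are those of
    the left copy, on side [true]. *)
Definition kinit : kmap D C := kcons (KC (Var VZ)) (fun A x => KS (var_index x < size TA)).

Lemma index_inl G G' A (x : var G A) : var_index (var_inl G' x) = var_index x.
Proof. by elim: x => //= G1 A' A1 x ->. Qed.
Lemma index_inr G G' A (x : var G' A) : var_index (var_inr G x) = size G + var_index x.
Proof. by elim: G => //= A' G ->. Qed.

Fixpoint ecat Ur G G' : env Ur G -> env Ur G' -> env Ur (G ++ G') :=
  match G return env Ur G -> env Ur G' -> env Ur (G ++ G') with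
  | [::] => fun _ r' => r'
  | A :: G1 => fun r r' => (r.1, ecat r.2 r')
  end.
Lemma lookup_inl Ur G G' A (x : var G A) (r : env Ur G) (r' : env Ur G') :
  lookup (var_inl G' x) (ecat r r') = lookup x r.
Proof. by elim: x r => //= G1 A' A1 x IH r; exact: IH. Qed.
Lemma lookup_inr Ur G G' A (x : var G' A) (r : env Ur G) (r' : env Ur G') :
  lookup (var_inr G x) (ecat r r') = lookup x r'.
Proof. by elim: G r => //= A' G1 IH r; exact: IH. Qed.

Lemma rK_side G m n : rK (fun A (x : var G A) => KS (m + var_index x < n) : kind C A) =
  [seq tb (i < n) | i <- iota m (size G)].
Proof.
elim: G m => //= A G IH m; rewrite addn0; congr (_ :: _); rewrite -IH.
by apply: rK_ext => A' x /=; rewrite addSnnS.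
Qed.

Lemma iota_side n m k (b : bool) : (b -> m + k <= n) -> (~~ b -> n <= m) ->
  [seq tb (i < n) | i <- iota m k] = nseq k (tb b).
Proof.
move=> Ht Hf; elim: k m Ht Hf => //= k IH m Ht Hf.
rewrite IH; first by congr (tb _ :: _); move: Ht Hf; clear; case: b => Ht Hf; [have := Ht isT|have := Hf isT]; lia.
  by move=> /Ht; lia.
by move=> /Hf; lia.
Qed.

Lemma kinit_E : rK kinit = Nd Lf (rlev (Var VZ : term C Tin)) ::
  nseq (size TA) (tb true) ++ nseq (size TA) (tb false).
Proof.
rewrite -[rK kinit]/(_ :: rK (fun A (x : var (TA ++ TA) A) => KS (0 + var_index x < size TA) : kind C A)).
congr (_ :: _); rewrite rK_side size_cat iotaD map_cat; congr (_ ++ _).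
  by apply: iota_side => //; lia.
by apply: iota_side => //; lia.
Qed.

(** Both copies are evaluated at the same solution, so all hypotheses hold and the value obtained is
    its own [o_out]. *)
Definition copies Ur (r : env Ur (Tin :: TA)) : env Ur D := (r.1, @ecat Ur TA TA r.2 r.2).

Lemma left_copies Ur (r : env Ur (Tin :: TA)) : sub_ok (@left_copy Tin T As) (copies r) r.
Proof. by apply: var_case => // A x; exact: (@lookup_inl Ur TA TA A x r.2 r.2). Qed.

Lemma right_copies Ur (r : env Ur (Tin :: TA)) : sub_ok (@right_copy Tin T As) (copies r) r.
Proof. by apply: var_case => // A x; exact: (@lookup_inr Ur TA TA A x r.2 r.2). Qed.

Variables (S : form (Tin :: T :: As)) (d : deriv (definability_sequent S)).
Let q := definability_sequent S.
Let B := 12 * tsz (rawderiv d) + 40.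

Lemma init_inv : inv B q kinit (fun _ _ => False) [::] [:: true; false] (tsz (rawderiv d)).
Proof.
split=> //; last by rewrite /B [size C]/=; lia.
  have L : forall A (x : var (Tin :: TA) A), tv (clean true kinit) (left_copy x).
    by apply: var_case => // A x; have := var_index_lt x; rewrite -(index_inl TA x); apply.
  have R : forall A (x : var (Tin :: TA) A), tv (clean false kinit) (right_copy x).
    apply: var_case => // A x; have : (var_index (var_inr TA x) < size TA) = false; last by apply.
    by rewrite index_inr; lia.
  have N G (f : form G) : fv f (fun _ _ => ~ False) by apply: fv_all => ? ? [].
  by do ![split=> //]; try exact: N; apply/fv_subst; apply: fv_all.
apply: var_case => [|A x]; first by rewrite -[rk _]/(Nd Lf (rlev (Var VZ : term C Tin))) rlevVZ [tsz (Nd _ (tVar _))]/= /B; lia.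
by rewrite -[rk _]/(tb (var_index x < size TA)); have := tsz_tb (var_index x < size TA); rewrite /B; lia.
Qed.

Definition defines (E : nrc (bare_ur T) C T) : Prop :=
  forall (Ur : Type) (dflt : bare_ur T -> Ur) (o_in : obj Ur Tin) (o_out : obj Ur T) (a : env Ur As),
    holds S ((o_in, (o_out, a)) : env Ur (Tin :: TA)) ->
    neval dflt E ((o_in, tt) : env Ur C) = o_out.

(* [sem_v] needs an Ur-element, which is adjoined when there is none. *)
Lemma definition_generated : exists2 E : nrc (bare_ur T) C T, defines E &
  emits (TB B) (tsz (rawderiv d) * RR B)
    [:: gtask (Nd Lf Lf) d kinit [::] [:: true; false] true] (enc_nrc E).
Proof.
have [||E SE EE] := (gen_all_rules (bare_ur T) B d).2 _ _ _ _ _ true init_inv => //.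
  split=> /=; first by have := index_inl TA (@VZ As T).
  by have := index_inr TA (@VZ As T); rewrite /clean /kinit /= => ->; rewrite addn0 ltnn.
exists E => // Ur dflt o_in o_out a HS.
have inj : injective (@Some Ur) by move=> x y [].
apply: (jo_inj inj); rewrite -(neval_je inj dflt E ((o_in, tt) : env Ur C)).
move/(holds_je inj): HS => HS.
apply: (SE _ None _ _ (copies (je (@Some Ur) ((o_in, (o_out, a)) : env Ur (Tin :: TA))))).
  by apply: var_case.
by split=> //; split=> [_|]; [apply/(holds_subst _ (left_copies _))|split=> // _; apply/(holds_subst _ (right_copies _))].
Qed.
End Initial.

(** * The complete program and its running time *)

Definition dbl (x : tr) : tr := Nd x x.
Lemma tsz_dbl x : tsz (dbl x) = 2 * tsz x + 1. Proof. by rewrite /dbl /=; lia. Qed.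
Lemma PT_dbl : PT anyt dbl. Proof. by rewrite /dbl; pt. Qed.

(** Four doublings give at least 16 rounds per input bit, more than the 10 allowed by [parses]; the
    parser is stable afterwards. *)
Definition parse (x : tr) : tr :=
  car (cdr (cdr (iter (llen (ones (dbl (dbl (dbl (dbl x)))))) pstep
    (Nd x (Nd (Nd (cTok (tn 8) Lf) Lf) Lf))))).

Lemma PT_parse : PT anyt parse.
Proof.
have H1 := PT_dbl; have H2 := PT_ones'; have H3 := PT_pstep.
rewrite /parse; pt_step; do 2 (apply: (@PT_call _ cdr); first exact: PT_cdr).
apply: (PT_it_add (K := tsz T_args + tsz T_item + 2 * tsz T_sort + 50)) => //; try by pt.
exact: tsz_pstep.
Qed.

Lemma tsz_wtr w : size w < tsz (wtr w).
Proof. by rewrite /wtr /ltb; elim: w => //= b w; have := tsz_gt0 (tb b); lia. Qed.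

Lemma parse_E G (q : sequent G) (d : deriv q) : parse (wtr (enc_deriv d)) = rawderiv d.
Proof.
have [m Hm E] := parses_deriv d; rewrite /parse llen_tn !tsz_dbl; have Hw := tsz_wtr (enc_deriv d).
set n := (X in iter X); have Hn : m <= n by rewrite /n; lia.
have stab k b v : iter k pstep (Nd b (Nd Lf v)) = Nd b (Nd Lf v) by elim: k => //= k ->.
by have := E Lf Lf Lf; rewrite /pst -(subnK Hn) iterD => ->; rewrite stab.
Qed.

(** The boundary between the two copies is not marked in the context. Removing two items per round
    and adding one tag for each copy finds the middle. *)
Definition half_step (s : tr) : tr :=
  If car s Then Nd (cdr (cdr (car s))) (Nd (Nd (tb true) (car (cdr s))) (Nd (tb false) (cdr (cdr s))))
  Else s.
Definition sides (l : tr) : tr := revcat (cdr (iter (llen l) half_step (Nd l (Nd Lf Lf)))).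

Lemma PT_sides : PT anyt sides.
Proof.
rewrite /sides; apply: (@PT_call _ revcat); first exact: PT_revcat.
apply: (@PT_call _ cdr); first exact: PT_cdr.
apply: (PT_it_add (K := 20)); try by [pt|rewrite /half_step; pt].
case=> [|[|a [|b c]] [|e f]] //; rewrite /half_step /tif /=; lia.
Qed.

Lemma sides_E l l' : size l = size l' ->
  sides (ltr (l ++ l') Lf) = ltr (nseq (size l) (tb true) ++ nseq (size l) (tb false)) Lf.
Proof.
move=> Hl; have stab k b : iter k half_step (Nd Lf b) = Nd Lf b by elim: k => //= k ->.
have H n k s a b : n <= k -> size s = n + n -> iter k half_step (Nd (ltr s Lf) (Nd (ltr (nseq a (tb true)) Lf) (ltr (nseq b (tb false)) Lf))) =
   Nd Lf (Nd (ltr (nseq (n + a) (tb true)) Lf) (ltr (nseq (n + b) (tb false)) Lf)).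
  elim: n k s a b => [|n IH] k s a b Hk; first by move/size0nil => ->; rewrite stab.
  case: k Hk => // k Hk; case: s => [|x [|y s]] //= Hs; first by lia.
  rewrite -iterS iterSr (_ : half_step _ = Nd (ltr s Lf) (Nd (ltr (nseq a.+1 (tb true)) Lf) (ltr (nseq b.+1 (tb false)) Lf))) //.
  by rewrite IH; [rewrite !addnS|lia|lia].
rewrite /sides (H (size l) _ _ 0 0); last by rewrite size_cat -Hl.
  by rewrite /= !addn0 revcat_E /ltr rev_nseq foldr_cat.
suff -> : llen (ltr (l ++ l') Lf) = size (l ++ l') by rewrite size_cat; lia.
by elim: (l ++ l') => //= x s ->.
Qed.

Definition kcom0 : tr := Eval compute in Nd Lf (rlev (Var VZ : term [:: TUnit] TUnit)).
Definition kctx (d : tr) : tr := Nd kcom0 (sides (cdr (cdr (car (cdr (dsq d)))))).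
Definition task0 (d : tr) : tr :=
  tGen (Nd Lf Lf) d (kctx d) Lf (Nd (tb true) (Nd (tb false) Lf)) (tb true) (tn 1).

Lemma PT_task0 : PT anyt task0.
Proof. by have H := PT_sides; rewrite /task0 /tGen /kctx; pt. Qed.

Lemma task0_E Tin T As (S : form (Tin :: T :: As)) (d : deriv (definability_sequent S)) :
  gtask (Nd Lf Lf) d (@kinit Tin T As) [::] [:: true; false] true = task0 (rawderiv d).
Proof.
rewrite /gtask kinit_E /task0 /kctx (rawderiv_sq d).
rewrite -[cdr (cdr _)]/(ltr (map rawty ((T :: As) ++ (T :: As))) Lf) map_cat sides_E //.
by rewrite size_map.
Qed.

(** The size bound on the tasks of a run is available for encodings of derivations only, hence this
    domain. *)
Definition dset (x : tr) : Prop :=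
  exists Tin T As (S : form (Tin :: T :: As)) (d : deriv (definability_sequent S)), x = wtr (enc_deriv d).

Definition run0 (x : tr) : tr := Nd (Nd (task0 (parse x)) Lf) Lf.

Transparent RR QQ TB.
(** With [X = 64 * N], [QQ] is at most [X ^ 4], and [B + 1] and [N] contribute one factor each. In
    [compile_PT], 64 is realised by six doublings and the sixth power by [PT_big]. *)
Lemma bounds_le N : 20 < N ->
  N * RR (12 * N + 40) <= (64 * N) ^ 6 /\ TB (12 * N + 40) <= (64 * N) ^ 3.
Proof.
rewrite /RR /QQ /TB /Q1 => HN; set X := 64 * N; set B := 12 * N + 40.
have h1 : B + 40 <= X by rewrite /X /B; lia.
have h2 : 1344 <= X by rewrite /X; lia.
have h3 : N <= X by rewrite /X; lia.
have hQ : (3 * B + 40) * B + 40 <= 4 * X ^ 2 by rewrite expnS expn1; nia.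
have hQB : ((3 * B + 40) * B + 40) * B <= 4 * X ^ 3.
  by rewrite (expnSr X 2) mulnA; apply: leq_mul => //; lia.
have hX3 : X <= X ^ 3 by rewrite -{1}(expn1 X); apply: leq_pexp2l; lia.
have hQQ : 1000 + 10 * (((3 * B + 40) * B + 40) * B + 40 * B) <= X ^ 4.
  have : 1344 * X ^ 3 <= X ^ 4 by rewrite (expnS X 3) leq_mul2r h2 orbT.
  by move: (X ^ 4) (X ^ 3) hQB hX3 => x4 x3; move: (_ * B) => y; lia.
split; last by rewrite !expnS expn0 muln1; nia.
rewrite (expnSr X 5) (expnS X 4) [in leqRHS]mulnC; apply: leq_mul => //; apply: leq_mul => //.
by lia.
Qed.

Lemma mstep_done n acc : iter n mstep (Nd Lf acc) = Nd Lf acc.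
Proof. by elim: n => //= n ->. Qed.

Lemma hsz_iter B B' m ts w acc i : 0 < B' -> B <= B' -> emits B m ts w ->
  hsz (iter i mstep (Nd (ltr ts Lf) acc)) <= B'.
Proof.
move=> HB HB' [k _ H]; have [E Hk] := H Lf acc.
case: (ltnP i k) => [/Hk h|Hi]; first exact: leq_trans h HB'.
by rewrite -(subnK Hi) iterD E mstep_done.
Qed.

Lemma iter_emits B m ts w acc i : emits B m ts w -> m <= i ->
  iter i mstep (Nd (ltr ts Lf) acc) = Nd Lf (lbits (rev w) acc).
Proof.
move=> [k Hk H] Hi; have [E _] := H Lf acc.
have Hki : k <= i by lia.
by rewrite -(subnK Hki) iterD E mstep_done.
Qed.

Lemma compile_PT : exists2 f, PT dset f &
  forall Tin T As (S : form (Tin :: T :: As)) (d : deriv (definability_sequent S)),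
  exists2 E, defines S E & f (wtr (enc_deriv d)) = wtr (enc_nrc E).
Proof.
pose c x := dbl (dbl (dbl (dbl (dbl (dbl (parse x)))))).
have Pp : PT dset parse by apply: PT_sub PT_parse.
have Pc : PT dset c by rewrite /c; have H := PT_dbl; pt.
have Pr : PT dset run0 by rewrite /run0; have H := PT_task0; pt.
have [g [Pg Hg]] := PT_big 6 Pc.
have [qc Hc] := PT_size Pc; have [qr Hr] := PT_size Pr; have [qg Hgs] := PT_size Pg.
have [qm Hm] := tsz_mstep.
have key Tin T As (S : form (Tin :: T :: As)) (d : deriv (definability_sequent S)) x : x = wtr (enc_deriv d) ->
   exists B m E, [/\ B <= tsz (c x) ^ 3, m <= llen (g x), defines S E &
     emits B m [:: task0 (parse x)] (enc_nrc E)].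
  move=> Ex; have Dx : dset x by exists Tin, T, As, S, d.
  have [E DE EE] := definition_generated d.
  have Ep : parse x = rawderiv d by rewrite Ex parse_E.
  have [b1 b2] := bounds_le (deriv_gt20 d).
  have Hcx : 64 * tsz (rawderiv d) <= tsz (c x) by rewrite /c !tsz_dbl Ep; lia.
  exists (TB (12 * tsz (rawderiv d) + 40)), (tsz (rawderiv d) * RR (12 * tsz (rawderiv d) + 40)), E.
  split=> //; last by rewrite Ep -task0_E.
    by apply: leq_trans b2 _; rewrite leq_exp2r.
  by apply: leq_trans b1 (leq_trans _ (Hg x Dx)); rewrite leq_exp2r.
exists (fun x => revcat (Nd (cdr (iter (llen (g x)) mstep (run0 x))) Lf)).
  apply: (@PT_call _ revcat); first exact: PT_revcat.
  apply: PT_Nd; last exact: PT_const.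
  apply: (@PT_call _ cdr); first exact: PT_cdr.
  (* The bound is the initial size plus the number of rounds times the growth of one round, for head
     tasks of size at most the cube of [tsz (c x)]. *)
  apply: (@PT_it _ _ _ _ (PA qr (PM qg (psub qm (PM qc (PM qc qc)))))) => //; first exact: PT_mstep.
  move=> x i Dx Hi; case: (Dx) => Tin [T [As [S [d Ex]]]].
  have [B [m [E [HB _ _ EE]]]] := key _ _ _ _ _ _ Ex.
  have H j : tsz (iter j mstep (run0 x)) <= tsz (run0 x) + j * ev qm (tsz (c x) ^ 3).
    elim: j => [|j IH]; first by rewrite mul0n addn0.
    have Hj : hsz (iter j mstep (run0 x)) <= tsz (c x) ^ 3.
      by have := @hsz_iter _ (tsz (c x) ^ 3) _ _ _ Lf j _ HB EE; apply; rewrite expn_gt0 tsz_gt0.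
    by rewrite iterS mulSn; have := Hm (iter j mstep (run0 x)); have := ev_mono qm Hj; lia.
  have Eq n : ev (PA qr (PM qg (psub qm (PM qc (PM qc qc))))) n =
    ev qr n + ev qg n * ev qm (ev qc n * (ev qc n * ev qc n)) by rewrite /= ev_psub.
  apply: leq_trans (H i) _; rewrite Eq.
  have h1 := Hr x Dx; have h2 := Hgs x Dx; have h3 := Hc x Dx; have h4 := llen_tsz (g x).
  apply: leq_add => //; apply: leq_mul; first by lia.
  by apply: ev_mono; rewrite !expnS expn0 muln1; do 2 apply: leq_mul => //.
move=> Tin T As S d; have [B [m [E [_ Hml DE EE]]]] := key _ _ _ _ d _ erefl.
exists E => //; rewrite (@iter_emits _ _ _ _ Lf _ EE Hml) [cdr _]/= [lbits _ _]/(ltr (map tb _) Lf).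
by rewrite map_rev revcat_E revK.
Qed.

Theorem theorem4p2 :
  exists (M : tm) (c k : nat),
  forall (Tin T : ty) (As : ctx) (S : form (Tin :: T :: As))
    (d : deriv (definability_sequent S)),
  exists E : nrc (bare_ur T) [:: Tin] T,
    computes_within M (c * size (enc_deriv d) ^ k + c)
      (enc_deriv d) (enc_nrc E) /\
    forall (Ur : Type) (dflt : bare_ur T -> Ur)
      (o_in : obj Ur Tin) (o_out : obj Ur T) (a : env Ur As),
      holds S ((o_in, (o_out, a)) : env Ur (Tin :: T :: As)) ->
      neval dflt E ((o_in, tt) : env Ur [:: Tin]) = o_out.
Proof.
have [f Pf Hf] := compile_PT; have [M [c [k HM]]] := PT_tm Pf.
exists M, c, k => Tin T As S d; have [E DE Ef] := Hf _ _ _ _ d.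
exists E; split; last exact: DE.
by apply: HM => //; exists Tin, T, As, S, d.
Qed.
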